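(* Let $q\in\Bbbk^*\setminus\{\pm1\}$. Then the only cocommutative Hopf algebras which right coact on $A_q(3)$ inner-faithfully (compatibly with its $\mathbb{N}$-grading) are, up to isomorphism, precisely the Hopf quotients of $\Bbbk\mathbb{Z}^3$, $\mathcal{B}_q$, $\mathcal{B}_{q^{-1}}$, $\mathcal{C}_q$, and $\mathcal{C}_{q^{-1}}$. Consequently, $A_q(3)$ does not have a faithful grading (refining its $\mathbb{N}$-grading) by a nonabelian group.
   Context: $\Bbbk$ is an algebraically closed field of characteristic zero. $A_q(3)=\Bbbk\langle x_1,x_2,x_3\rangle/(x_jx_i-qx_ix_j\mid i<j)$, with its $\mathbb{N}$-grading in which every $x_i$ has degree $1$. A Hopf algebra $H$ right coacts on an algebra $A$ if $A$ is a right $H$-comodule via a map $\rho:A\to A\otimes H$ that is an algebra homomorphism. All coactions on $A_q(3)$ are required to preserve the $\mathbb{N}$-grading: $\rho(A_k)\subseteq A_k\otimes H$. The coaction is inner-faithful if $\rho(A)\not\subseteq A\otimes H'$ for every proper Hopf subalgebra $H'\subsetneq H$. A grading of an algebra $A$ by a group $G$ is a decomposition $A=\bigoplus_{g\in G}A_g$ with $A_gA_h\subseteq A_{gh}$ (corresponding to a right coaction of $\Bbbk G$); it is faithful if $\{g\in G\mid A_g\ne0\}$ generates $G$. Only gradings compatible with (refining) the $\mathbb{N}$-grading of $A_q(3)$ are considered, i.e. those for which the corresponding $\Bbbk G$-coaction preserves the $\mathbb{N}$-grading. For $q\in\Bbbk^*$, $$\mathcal{B}_q=\frac{\Bbbk\langle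 x^{\pm1},y^{\pm1},z\rangle}{(yx-xy,\ zx-qxz,\ zy-yz)},\qquad \mathcal{C}_q=\frac{\Bbbk\langle x^{\pm1},y^{\pm1},z\rangle}{(yx-xy,\ zx-qxz,\ zy-q^2yz)},$$ with Hopf structures in which $x$ and $y$ are group-like and $z$ is primitive. *)

(* Defs.v *)
From HB Require Import structures.
From mathcomp Require Import all_boot all_order all_algebra.
From mathcomp Require Import sesquilinear finmap boolp classical_sets monalg.

Set Implicit Arguments.
Unset Strict Implicit.
Unset Printing Implicit Defensive.

Import GRing.Theory.
Local Open Scope ring_scope.
Local Open Scope quotient_scope.

Section LinearFunctional.
Local Open Scope classical_set_scope.
Variables (k : fieldType) (V : lmodType k).

Let lin_closed (U : set V) := forall (c : k) a b, U a -> U b -> U (c *: a + b).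

Lemma maximal_avoiding_subspace (v : V) : v != 0 ->
  exists U : set V, [/\ U 0, lin_closed U, ~ U v &
    forall x, ~ U x -> exists c : k, exists2 u, U u & v = u + c *: x].
Proof.
move=> v0.
have [|U [[Ul Uv] Umax]] := @Zorn_bigcup V
    (fun U : set V => lin_closed U /\ ~ U v).
  move=> F FP tot; split; last by case=> X FX Xv; case: (FP _ FX).
  move=> c a b [X FX Xa] [Y FY Yb].
  have [XY|YX] := tot _ _ FX FY.
    by exists Y => //; case: (FP _ FY) => Yl _; apply: Yl => //; apply: XY.
  by exists X => //; case: (FP _ FX) => Xl _; apply: Xl => //; apply: YX.
have U0 : U 0.
  apply: contrapT => nU0; apply: (Umax (U `|` [set 0])).
    split; first by move=> x; left.
    by move=> /(_ 0) h; apply: nU0; apply: h; right.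
  split; last by case=> // /eqP; rewrite (negbTE v0).
  move=> c a b [Ua|->] [Ub|->].
  - by left; apply: Ul.
  - left; rewrite addr0; have := Ul (c - 1) _ _ Ua Ua.
    by rewrite scalerBl scale1r subrK.
  - by left; rewrite scaler0 add0r.
  - by right; rewrite scaler0 add0r.
exists U; split=> // x nUx; apply: contrapT => nex.
apply: (Umax [set y | exists c : k, exists2 u, U u & y = u + c *: x]).
  split=> [y Uy|]; first by exists 0, y => //; rewrite scale0r addr0.
  by move=> /(_ x) h; apply: nUx; apply: h; exists 1, 0; rewrite ?scale1r ?add0r.
split=> // c _ _ [d [u Uu ->]] [e [w Uw ->]].
exists (c * d + e), (c *: u + w); first exact: Ul.
by rewrite scalerDr scalerDl scalerA addrACA.
Qed.

Lemma exists_functional (v : V) : v != 0 ->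
  exists f : V -> k, (forall c a b, f (c *: a + b) = c * f a + f b) /\ f v = 1.
Proof.
move=> /maximal_avoiding_subspace [U [U0 Ul nUv Umax]].
have ex x : exists c : k, U (x - c *: v).
  have [Ux|/Umax [c [u Uu vE]]] := pselect (U x).
    by exists 0; rewrite scale0r subr0.
  have c0 : c != 0.
    by apply: contra_notN nUv => /eqP c0; rewrite vE c0 scale0r addr0.
  exists c^-1; rewrite vE scalerDr scalerA mulVf // scale1r opprD addrCA subrr.
  by rewrite addr0; have := Ul (- c^-1) _ _ Uu U0; rewrite addr0 scaleNr.
have uniqc (c : k) : U (c *: v) -> c = 0.
  move=> Ucv; apply: contrapT => /eqP c0; apply: nUv.
  by have := Ul c^-1 _ _ Ucv U0; rewrite addr0 scalerA mulVf // scale1r.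
pose f x := sval (cid (ex x)).
have fP x : U (x - f x *: v) by rewrite /f; case: cid.
have UB a b : U a -> U b -> U (a - b).
  by move=> Ua Ub; have := Ul (-1) _ _ Ub Ua; rewrite scaleN1r addrC.
have fE x c : U (x - c *: v) -> f x = c.
  move=> Uc; apply/eqP; rewrite -subr_eq0; apply/eqP/uniqc.
  by have := UB _ _ Uc (fP x); rewrite opprB addrC addrA subrK -scalerBl.
exists f; split=> [c a b|]; apply: fE.
  have := Ul c _ _ (fP a) (fP b).
  by rewrite scalerBr scalerA scalerDl opprD addrACA.
by rewrite scale1r subrr.
Qed.

End LinearFunctional.

(* {malg k[M]} is a ring in monalg.v only for monoids in which g * h = 1      *)
(* forces g = h = 1, which excludes groups; hence the alias with its own      *)
(* convolution product.                                                       *)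
Definition monoid_algebra (k : fieldType) (M : monoidType) := {malg k[M]}.

HB.instance Definition _ (k : fieldType) (M : monoidType) :=
  GRing.Lmodule.on (monoid_algebra k M).

Section MonoidAlgebra.
Variables (k : fieldType) (M : monoidType).
Implicit Types (x y z : monoid_algebra k M) (g h : M).

Definition mbasis g : monoid_algebra k M := << g >>.

Definition mlift (V : lmodType k) (f : M -> V) x : V :=
  \sum_(g <- msupp x) x@_g *: f g.

Section Mlift.
Variables (V : lmodType k) (f : M -> V).

Lemma mliftE (E : {fset M}) x : (msupp x `<=` E)%fset ->
  mlift f x = \sum_(g <- E) x@_g *: f g.
Proof.
move=> le; rewrite /mlift (big_fset_incl _ le) // => g _ /mcoeff_outdom ->.
by rewrite scale0r.
Qed.

Lemma mlift_is_linear : linear (mlift f).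
Proof.
move=> c x y; pose E := (msupp x `|` msupp y `|` msupp (c *: x + y))%fset.
rewrite !(@mliftE E) ?fsubsetUr // /E;
  try by rewrite -fsetUA ?fsubsetUl // fsetUCA fsubsetUl.
rewrite scaler_sumr -big_split; apply: eq_bigr => g _ /=.
by rewrite mcoeffD mcoeffZ scalerDl scalerA.
Qed.

HB.instance Definition _ :=
  GRing.isLinear.Build k (monoid_algebra k M) V *:%R (mlift f) mlift_is_linear.

Lemma mlift_basis g : mlift f (mbasis g) = f g.
Proof.
rewrite (@mliftE [fset g]%fset) ?msuppU_le // big_seq_fset1.
by rewrite mcoeffUU scale1r.
Qed.

End Mlift.

Lemma monoid_algebraE x : x = \sum_(g <- msupp x) x@_g *: mbasis g.
Proof.
rewrite {1}[x]monalgE; apply: eq_bigr => g _.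
by apply/malgP => h; rewrite mcoeffZ !mcoeffU mulrnAr mulr1.
Qed.

Lemma mbasis_ext (V : lmodType k) (f1 f2 : monoid_algebra k M -> V) :
  linear f1 -> linear f2 -> (forall g, f1 (mbasis g) = f2 (mbasis g)) ->
  f1 =1 f2.
Proof.
move=> l1 l2 e x; pose F1 := GRing.isLinear.Build _ _ _ _ f1 l1.
pose F2 := GRing.isLinear.Build _ _ _ _ f2 l2.
pose L1 : {linear monoid_algebra k M -> V} := HB.pack f1 F1.
pose L2 : {linear monoid_algebra k M -> V} := HB.pack f2 F2.
rewrite -[f1 x]/(L1 x) -[f2 x]/(L2 x) [x]monoid_algebraE !linear_sum.
by apply: eq_bigr => g _; rewrite !linearZ /= e.
Qed.

Definition mamul x y : monoid_algebra k M :=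
  mlift (fun g => mlift (fun h => mbasis (g * h)%g) y) x.

Lemma mamul_basis g h : mamul (mbasis g) (mbasis h) = mbasis (g * h)%g.
Proof. by rewrite /mamul !mlift_basis. Qed.

Lemma mamulDl_linear y : linear (mamul^~ y).
Proof. exact: mlift_is_linear. Qed.

Lemma mamulDr_linear x : linear (mamul x).
Proof.
move=> c y z; rewrite /mamul /mlift scaler_sumr -big_split.
apply: eq_bigr => g _ /=; rewrite scalerA [c * _]mulrC -scalerA -scalerDr.
by congr (_ *: _); apply: mlift_is_linear.
Qed.

Lemma mamulA : associative mamul.
Proof.
move=> x y z.
move: x; apply: mbasis_ext => [c a b|c a b|g].
- exact: mamulDl_linear.
- by rewrite !mamulDl_linear.
move: y; apply: mbasis_ext => [c a b|c a b|h].
- by rewrite mamulDl_linear mamulDr_linear.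
- by rewrite mamulDr_linear mamulDl_linear.
move: z; apply: mbasis_ext => [c a b|c a b|l].
- by rewrite !mamulDr_linear.
- by rewrite mamulDr_linear.
by rewrite !mamul_basis mulgA.
Qed.

Lemma mamul1l : left_id (mbasis 1%g) mamul.
Proof.
apply: mbasis_ext => [c a b|//|g]; first exact: mamulDr_linear.
by rewrite mamul_basis mul1g.
Qed.

Lemma mamul1r : right_id (mbasis 1%g) mamul.
Proof.
apply: mbasis_ext => [c a b|//|g]; first exact: mamulDl_linear.
by rewrite mamul_basis mulg1.
Qed.

Lemma mamulDl : left_distributive mamul +%R.
Proof.
by move=> x y z; have := mamulDl_linear z 1 x y; rewrite !scale1r.
Qed.

Lemma mamulDr : right_distributive mamul +%R.
Proof.
by move=> x y z; have := mamulDr_linear x 1 y z; rewrite !scale1r.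
Qed.

Lemma mabasis1_neq0 : mbasis 1%g != 0.
Proof. by rewrite /mbasis monalgU_eq0 oner_eq0. Qed.

HB.instance Definition _ := GRing.Zmodule_isNzRing.Build (monoid_algebra k M)
  mamulA mamul1l mamul1r mamulDl mamulDr mabasis1_neq0.

Lemma mamulAl (c : k) x y : c *: (x * y) = (c *: x) * y.
Proof.
by have := mamulDl_linear y c x 0; rewrite addr0 -[mamul 0 y]/(0 * y) mul0r addr0.
Qed.

HB.instance Definition _ :=
  GRing.Lmodule_isLalgebra.Build k (monoid_algebra k M) mamulAl.

Lemma mamulAr (c : k) x y : c *: (x * y) = x * (c *: y).
Proof.
by have := mamulDr_linear x c y 0; rewrite addr0 -[mamul x 0]/(x * 0) mulr0 addr0.
Qed.

HB.instance Definition _ :=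
  GRing.Lalgebra_isAlgebra.Build k (monoid_algebra k M) mamulAr.

Lemma mbasisM g h : mbasis (g * h)%g = mbasis g * mbasis h.
Proof. by rewrite -mamul_basis. Qed.

Lemma mbasis1 : mbasis 1%g = 1.
Proof. by []. Qed.

Lemma mlift_monoid_morphism (A : algType k) (f : M -> A) :
  f 1%g = 1 -> {morph f : g h / (g * h)%g >-> g * h} ->
  monoid_morphism (mlift f).
Proof.
move=> f1 fM; split=> [|x y]; first by rewrite -mbasis1 mlift_basis.
move: x; apply: mbasis_ext => [c a b|c a b|g].
- by rewrite mulrDl -scalerAl linearP.
- by rewrite linearP mulrDl -scalerAl.
move: y; apply: mbasis_ext => [c a b|c a b|h].
- by rewrite mulrDr -scalerAr linearP.
- by rewrite linearP mulrDr -scalerAr.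
by rewrite -mbasisM !mlift_basis fM.
Qed.

End MonoidAlgebra.


Definition free_monoid (X : choiceType) := seq X.

HB.instance Definition _ (X : choiceType) := Choice.on (free_monoid X).
HB.instance Definition _ (X : choiceType) :=
  isMonoid.Build (free_monoid X) (@catA X) (@cat0s X) (@cats0 X).

Definition free_algebra (k : fieldType) (X : choiceType) :=
  monoid_algebra k (free_monoid X).

HB.instance Definition _ (k : fieldType) (X : choiceType) :=
  GRing.Algebra.on (free_algebra k X).

Definition free_gen (k : fieldType) (X : choiceType) (i : X) :
  free_algebra k X := mbasis k ([:: i] : free_monoid X).

Section FreeAlgebra.
Variables (k : fieldType) (X : choiceType) (A : algType k) (v : X -> A).

Definition free_eval : free_algebra k X -> A :=
  mlift (fun w : free_monoid X => \prod_(i <- w) v i).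

HB.instance Definition _ := GRing.Linear.on free_eval.

Lemma free_eval_monoid_morphism : monoid_morphism free_eval.
Proof.
apply: mlift_monoid_morphism => [|w1 w2]; first by rewrite big_nil.
by rewrite big_cat.
Qed.

HB.instance Definition _ :=
  GRing.isMonoidMorphism.Build (free_algebra k X) A free_eval
    free_eval_monoid_morphism.

Lemma free_eval_gen i : free_eval (free_gen k i) = v i.
Proof. by rewrite /free_eval mlift_basis big_seq1. Qed.

End FreeAlgebra.

Lemma free_algebra_ind (k : fieldType) (X : choiceType)
    (P : free_algebra k X -> Prop) :
  P 1 -> (forall i, P (free_gen k i)) ->
  (forall a b, P a -> P b -> P (a * b)) ->
  (forall c a b, P a -> P b -> P (c *: a + b)) ->
  forall a, P a.
Proof.
move=> P1 Pg PM PL a; rewrite [a]monoid_algebraE.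
have P0 : P 0 by have := PL (-1) _ _ P1 P1; rewrite scaleN1r addNr.
elim/big_rec: _ => // w b _ Pb; apply: PL => //.
elim: w => [|i w IHw] //.
by rewrite -[i :: w]/(([:: i] : free_monoid X) * w)%g mbasisM; apply: PM => //; apply: Pg.
Qed.

Section Ideal.
Variables (k : fieldType) (A : algType k).

Definition two_sided_ideal (I : A -> Prop) : Prop :=
  [/\ I 0, forall a b, I a -> I b -> I (a + b),
      forall a b, I b -> I (a * b) & forall a b, I a -> I (a * b)].

Definition ideal_gen (S : A -> Prop) (a : A) : Prop :=
  forall I, two_sided_ideal I -> (forall s, S s -> I s) -> I a.

Lemma ideal_gen_ideal S : two_sided_ideal (ideal_gen S).
Proof.
split=> [I [] //|a b Ia Ib I II SI|a b Ib I II SI|a b Ia I II SI];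
  have [I0 ID IMl IMr] := II.
- by apply: ID; [apply: Ia|apply: Ib].
- by apply: IMl; apply: Ib.
- by apply: IMr; apply: Ia.
Qed.

Lemma ideal_gen_sub (S : A -> Prop) s : S s -> ideal_gen S s.
Proof. by move=> Ss I _; apply. Qed.

Lemma ideal_gen_ker (S : A -> Prop) (B : algType k) (f : {lrmorphism A -> B}) :
  (forall s, S s -> f s = 0) -> forall a, ideal_gen S a -> f a = 0.
Proof.
move=> fS a Ia; apply: (Ia (fun x => f x = 0)) => //.
split=> [|x y|x y|x y]; first exact: rmorph0.
- by rewrite rmorphD /= => -> ->; rewrite addr0.
- by rewrite rmorphM /= => ->; rewrite mulr0.
- by rewrite rmorphM /= => ->; rewrite mul0r.
Qed.

(* Mathcomp algebras are nonzero, so the generated ideal has to be proper.    *)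
Record relators := Relators {
  relator :> A -> Prop;
  relators_proper : ~ ideal_gen relator 1 }.

End Ideal.

Section QuotientAlgebra.
Variables (k : fieldType) (A : algType k) (S : relators A).
Implicit Types a b : A.

Let I := ideal_gen S.
Let I_ideal : two_sided_ideal I := ideal_gen_ideal S.

Definition ideal_eqv a b : bool := `[< I (a - b) >].

Let I0 : I 0. Proof. by case: I_ideal. Qed.
Let ID a b : I a -> I b -> I (a + b). Proof. by case: I_ideal => _ + _ _; apply. Qed.
Let IMl a b : I b -> I (a * b). Proof. by case: I_ideal => _ _ + _; apply. Qed.
Let IMr a b : I a -> I (a * b). Proof. by case: I_ideal => _ _ _; apply. Qed.
Let IZ (c : k) a : I a -> I (c *: a).
Proof. by move=> Ia; rewrite -[a]mul1r scalerAl; apply: IMl. Qed.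
Let IN a : I a -> I (- a).
Proof. by rewrite -scaleN1r; apply: IZ. Qed.

Lemma ideal_eqv_refl : reflexive ideal_eqv.
Proof. by move=> a; apply/asboolP; rewrite subrr. Qed.

Lemma ideal_eqv_sym : symmetric ideal_eqv.
Proof.
by move=> a b; apply/asboolP/asboolP => /IN; rewrite opprB.
Qed.

Lemma ideal_eqv_trans : transitive ideal_eqv.
Proof.
move=> b a c /asboolP ab /asboolP bc; apply/asboolP.
by have := ID ab bc; rewrite addrA subrK.
Qed.

Canonical ideal_eqv_equiv :=
  EquivRel ideal_eqv ideal_eqv_refl ideal_eqv_sym ideal_eqv_trans.

Definition quotient_algebra := {eq_quot ideal_eqv}.

HB.instance Definition _ := Choice.on quotient_algebra.
HB.instance Definition _ := Quotient.on quotient_algebra.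

Definition qproj a : quotient_algebra := \pi_quotient_algebra a.

Lemma qprojP a b : qproj a = qproj b <-> ideal_gen S (a - b).
Proof.
split=> [/eqmodP /asboolP //|h]; apply/eqmodP.
exact/asboolP.
Qed.

Lemma qproj_repr (x : quotient_algebra) : qproj (repr x) = x.
Proof. exact: reprK. Qed.

Lemma quotient_ind (P : quotient_algebra -> Prop) :
  (forall a, P (qproj a)) -> forall x, P x.
Proof. by move=> Pq x; rewrite -[x]qproj_repr. Qed.

Lemma repr_qproj a : I (repr (qproj a) - a).
Proof. by apply/qprojP; rewrite qproj_repr. Qed.

Definition qadd (x y : quotient_algebra) := qproj (repr x + repr y).
Definition qopp (x : quotient_algebra) := qproj (- repr x).
Definition qmul (x y : quotient_algebra) := qproj (repr x * repr y).
Definition qscale (c : k) (x : quotient_algebra) := qproj (c *: repr x).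

Lemma qaddE a b : qadd (qproj a) (qproj b) = qproj (a + b).
Proof.
by apply/qprojP; rewrite opprD addrACA; apply: ID; apply: repr_qproj.
Qed.

Lemma qoppE a : qopp (qproj a) = qproj (- a).
Proof. by apply/qprojP; rewrite -opprD; apply: IN; apply: repr_qproj. Qed.

Lemma qmulE a b : qmul (qproj a) (qproj b) = qproj (a * b).
Proof.
apply/qprojP; set a' := repr _; set b' := repr _.
have -> : a' * b' - a * b = (a' - a) * b' + a * (b' - b).
  by rewrite mulrBl mulrBr addrA subrK.
by apply: ID; [apply: IMr|apply: IMl]; apply: repr_qproj.
Qed.

Lemma qscaleE (c : k) a : qscale c (qproj a) = qproj (c *: a).
Proof. by apply/qprojP; rewrite -scalerBr; apply: IZ; apply: repr_qproj. Qed.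

Lemma qaddA : associative qadd.
Proof.
elim/quotient_ind=> a; elim/quotient_ind=> b; elim/quotient_ind=> c.
by rewrite !qaddE addrA.
Qed.

Lemma qaddC : commutative qadd.
Proof. by elim/quotient_ind=> a; elim/quotient_ind=> b; rewrite !qaddE addrC. Qed.

Lemma qadd0 : left_id (qproj 0) qadd.
Proof. by elim/quotient_ind=> a; rewrite qaddE add0r. Qed.

Lemma qaddN : left_inverse (qproj 0) qopp qadd.
Proof. by elim/quotient_ind=> a; rewrite qoppE qaddE addNr. Qed.

HB.instance Definition _ :=
  GRing.isZmodule.Build quotient_algebra qaddA qaddC qadd0 qaddN.

Lemma qmulA : associative qmul.
Proof.
elim/quotient_ind=> a; elim/quotient_ind=> b; elim/quotient_ind=> c.
by rewrite !qmulE mulrA.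
Qed.

Lemma qmul1l : left_id (qproj 1) qmul.
Proof. by elim/quotient_ind=> a; rewrite qmulE mul1r. Qed.

Lemma qmul1r : right_id (qproj 1) qmul.
Proof. by elim/quotient_ind=> a; rewrite qmulE mulr1. Qed.

Lemma qmulDl : left_distributive qmul qadd.
Proof.
elim/quotient_ind=> a; elim/quotient_ind=> b; elim/quotient_ind=> c.
by rewrite !(qaddE, qmulE) mulrDl.
Qed.

Lemma qmulDr : right_distributive qmul qadd.
Proof.
elim/quotient_ind=> a; elim/quotient_ind=> b; elim/quotient_ind=> c.
by rewrite !(qaddE, qmulE) mulrDr.
Qed.

Lemma qone_neq0 : qproj 1 != qproj 0.
Proof.
by apply/eqP => /qprojP; rewrite subr0; apply: relators_proper.
Qed.

HB.instance Definition _ := GRing.Zmodule_isNzRing.Build quotient_algebra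
  qmulA qmul1l qmul1r qmulDl qmulDr qone_neq0.

Lemma qscaleA (c d : k) (x : quotient_algebra) : qscale c (qscale d x) = qscale (c * d) x.
Proof. by elim/quotient_ind: x => a; rewrite !qscaleE scalerA. Qed.

Lemma qscale1 : left_id 1 qscale.
Proof. by elim/quotient_ind => a; rewrite !qscaleE scale1r. Qed.

Lemma qscaleDr : right_distributive qscale +%R.
Proof.
move=> c; elim/quotient_ind => a; elim/quotient_ind => b.
by rewrite -[LHS]/(qscale c (qadd _ _)) -[RHS]/(qadd _ _)
     !(qscaleE, qaddE) scalerDr.
Qed.

Lemma qscaleDl (x : quotient_algebra) : {morph qscale^~ x : c d / c + d}.
Proof.
elim/quotient_ind: x => a c d.
by rewrite -[RHS]/(qadd _ _) !(qscaleE, qaddE) scalerDl.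
Qed.

HB.instance Definition _ := GRing.Zmodule_isLmodule.Build k quotient_algebra
  qscaleA qscale1 qscaleDr qscaleDl.

Lemma qscaleAl (c : k) (x y : quotient_algebra) : c *: (x * y) = (c *: x) * y.
Proof.
elim/quotient_ind: x => a; elim/quotient_ind: y => b.
by rewrite -[LHS]/(qscale c (qmul _ _)) -[RHS]/(qmul (qscale c _) _)
     !(qscaleE, qmulE) scalerAl.
Qed.

HB.instance Definition _ :=
  GRing.Lmodule_isLalgebra.Build k quotient_algebra qscaleAl.

Lemma qscaleAr (c : k) (x y : quotient_algebra) : c *: (x * y) = x * (c *: y).
Proof.
elim/quotient_ind: x => a; elim/quotient_ind: y => b.
by rewrite -[LHS]/(qscale c (qmul _ _)) -[RHS]/(qmul _ (qscale c _))
     !(qscaleE, qmulE) scalerAr.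
Qed.

HB.instance Definition _ :=
  GRing.Lalgebra_isAlgebra.Build k quotient_algebra qscaleAr.

Lemma qproj_is_linear : linear qproj.
Proof.
by move=> c a b; rewrite -[RHS]/(qadd (qscale c _) _) qscaleE qaddE.
Qed.

HB.instance Definition _ :=
  GRing.isLinear.Build k A quotient_algebra *:%R qproj qproj_is_linear.

Lemma qproj_monoid_morphism : monoid_morphism qproj.
Proof. by split=> // a b; rewrite -[RHS]/(qmul _ _) qmulE. Qed.

HB.instance Definition _ :=
  GRing.isMonoidMorphism.Build A quotient_algebra qproj qproj_monoid_morphism.

Section Lift.
Variables (B : algType k) (f : {lrmorphism A -> B}).
Hypothesis fS : forall s, S s -> f s = 0.

Definition qlift (_ : forall s, S s -> f s = 0) (x : quotient_algebra) : B :=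
  f (repr x).

Lemma qliftE a : qlift fS (qproj a) = f a.
Proof.
apply/eqP; rewrite /qlift -subr_eq0 -linearB; apply/eqP.
by apply: (ideal_gen_ker fS); apply: repr_qproj.
Qed.

Lemma qlift_is_linear : linear (qlift fS).
Proof.
move=> c; elim/quotient_ind => a; elim/quotient_ind => b.
by rewrite -linearP !qliftE linearP.
Qed.

HB.instance Definition _ := GRing.isLinear.Build k quotient_algebra B *:%R
  (qlift fS) qlift_is_linear.

Lemma qlift_monoid_morphism : monoid_morphism (qlift fS).
Proof.
split=> [|]; first by rewrite -(rmorph1 qproj) qliftE rmorph1.
elim/quotient_ind => a; elim/quotient_ind => b.
by rewrite -rmorphM !qliftE rmorphM.
Qed.

HB.instance Definition _ := GRing.isMonoidMorphism.Build quotient_algebra B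
  (qlift fS) qlift_monoid_morphism.

End Lift.

End QuotientAlgebra.

Lemma bilinearP (k : fieldType) (A B W : lmodType k) (f : A -> B -> W) :
  (forall b, linear (f^~ b)) -> (forall a, linear (f a)) ->
  bilinear_for *:%R *:%R f.
Proof. by []. Qed.

Section Tensor.
Variables (k : fieldType) (A B : lmodType k).
Implicit Types s t : seq (A * B).

(* The tensor product: finite formal sums of pairs (a, b), two of them being  *)
(* identified when every bilinear map takes the same value on both.           *)
Definition formal_eval (W : lmodType k) (f : A -> B -> W) s : W :=
  \sum_(p <- s) f p.1 p.2.

Definition tensor_eqv s t : bool :=
  `[< forall (W : lmodType k) (f : A -> B -> W),
        bilinear_for *:%R *:%R f -> formal_eval f s = formal_eval f t >].

Lemma tensor_eqv_refl : reflexive tensor_eqv.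
Proof. by move=> s; apply/asboolP. Qed.

Lemma tensor_eqv_sym : symmetric tensor_eqv.
Proof. by move=> s t; apply/asboolP/asboolP => h W f fb; rewrite h. Qed.

Lemma tensor_eqv_trans : transitive tensor_eqv.
Proof.
move=> t s u /asboolP h1 /asboolP h2; apply/asboolP => W f fb.
by rewrite h1 // h2.
Qed.

Canonical tensor_eqv_equiv :=
  EquivRel tensor_eqv tensor_eqv_refl tensor_eqv_sym tensor_eqv_trans.

Definition tensor := {eq_quot tensor_eqv}.

HB.instance Definition _ := Choice.on tensor.
HB.instance Definition _ := Quotient.on tensor.

Implicit Types x y z : tensor.

Definition tclass s : tensor := \pi_tensor s.

Definition tens (a : A) (b : B) : tensor := tclass [:: (a, b)].

Definition tlift (W : lmodType k) (f : A -> B -> W) x : W :=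
  formal_eval f (repr x).

Section Bilinear.
Variables (W : lmodType k) (f : A -> B -> W).
Hypothesis fb : bilinear_for *:%R *:%R f.

Lemma tlift_class s : tlift f (tclass s) = formal_eval f s.
Proof.
have /eqmodP/asboolP : repr (tclass s) = s %[mod tensor] by rewrite reprK.
exact.
Qed.

Lemma tlift_tens a b : tlift f (tens a b) = f a b.
Proof. by rewrite tlift_class /formal_eval big_seq1. Qed.

End Bilinear.

Lemma tensorP x y :
  (forall (W : lmodType k) (f : A -> B -> W), bilinear_for *:%R *:%R f ->
     tlift f x = tlift f y) -> x = y.
Proof.
by move=> h; rewrite -[x]reprK -[y]reprK; apply/eqmodP/asboolP.
Qed.

Definition tzero := tclass [::].
Definition tadd x y := tclass (repr x ++ repr y).
Definition tscale (c : k) x := tclass [seq (c *: p.1, p.2) | p <- repr x].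
Definition topp x := tscale (-1) x.

Section Ops.
Variables (W : lmodType k) (f : A -> B -> W).
Hypothesis fb : bilinear_for *:%R *:%R f.

Lemma tlift_zero : tlift f tzero = 0.
Proof. by rewrite tlift_class // /formal_eval big_nil. Qed.

Lemma tlift_add x y : tlift f (tadd x y) = tlift f x + tlift f y.
Proof. by rewrite tlift_class // /formal_eval big_cat. Qed.

Lemma bilinZl c a b : f (c *: a) b = c *: f a b.
Proof. exact: (scalable_linear (fb.1 b)). Qed.
Lemma bilinZr c a b : f a (c *: b) = c *: f a b.
Proof. exact: (scalable_linear (fb.2 a)). Qed.

Lemma tlift_scale c x : tlift f (tscale c x) = c *: tlift f x.
Proof.
rewrite tlift_class // /tlift /formal_eval big_map scaler_sumr.
by apply: eq_bigr => p _; rewrite bilinZl.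
Qed.

Lemma tlift_opp x : tlift f (topp x) = - tlift f x.
Proof. by rewrite tlift_scale scaleN1r. Qed.

End Ops.

Lemma taddA : associative tadd.
Proof. by move=> x y z; apply: tensorP => W f fb; rewrite !tlift_add // addrA. Qed.

Lemma taddC : commutative tadd.
Proof. by move=> x y; apply: tensorP => W f fb; rewrite !tlift_add // addrC. Qed.

Lemma tadd0 : left_id tzero tadd.
Proof.
by move=> x; apply: tensorP => W f fb; rewrite tlift_add // tlift_zero // add0r.
Qed.

Lemma taddN : left_inverse tzero topp tadd.
Proof.
move=> x; apply: tensorP => W f fb.
by rewrite tlift_add // tlift_opp // tlift_zero // addNr.
Qed.

HB.instance Definition _ := GRing.isZmodule.Build tensor taddA taddC tadd0 taddN.

Lemma tscaleA c d x : tscale c (tscale d x) = tscale (c * d) x.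
Proof. by apply: tensorP => W f fb; rewrite !tlift_scale // scalerA. Qed.

Lemma tscale1 : left_id 1 tscale.
Proof. by move=> x; apply: tensorP => W f fb; rewrite !tlift_scale // scale1r. Qed.

Lemma tscaleDr : right_distributive tscale +%R.
Proof.
move=> c x y; apply: tensorP => W f fb.
by rewrite -[x + y]/(tadd x y) -[RHS]/(tlift f (tadd _ _))
     !(tlift_add, tlift_scale) // scalerDr.
Qed.

Lemma tscaleDl x : {morph tscale^~ x : c d / c + d}.
Proof.
move=> c d; apply: tensorP => W f fb.
by rewrite -[RHS]/(tlift f (tadd _ _)) !(tlift_add, tlift_scale) // scalerDl.
Qed.

HB.instance Definition _ := GRing.Zmodule_isLmodule.Build k tensor
  tscaleA tscale1 tscaleDr tscaleDl.

Lemma tlift_is_linear (W : lmodType k) (f : A -> B -> W) :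
  bilinear_for *:%R *:%R f -> linear (tlift f).
Proof.
move=> fb c x y; rewrite -[c *: x + y]/(tadd (tscale c x) y).
by rewrite tlift_add // tlift_scale.
Qed.

Lemma tens_bilinear : bilinear_for *:%R *:%R tens.
Proof.
split=> [b|a] c u v; apply: tensorP => W f fb; rewrite tlift_is_linear //.
  by rewrite !tlift_tens // (fb.1 b).
by rewrite !tlift_tens // (fb.2 a).
Qed.

Lemma tensorE x : x = \sum_(p <- repr x) tens p.1 p.2.
Proof.
rewrite -[LHS]reprK -/(tclass _).
elim: (repr x) => [|p s IHs]; first by rewrite big_nil.
rewrite big_cons -IHs; apply: tensorP => W f fb.
rewrite -[_ + _]/(tadd _ _) tlift_add // tlift_tens // !tlift_class //.
by rewrite /formal_eval big_cons.
Qed.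

Lemma tensor_ext (W : lmodType k) (f1 f2 : tensor -> W) :
  linear f1 -> linear f2 ->
  (forall a b, f1 (tens a b) = f2 (tens a b)) -> f1 =1 f2.
Proof.
move=> l1 l2 e x; pose F1 := GRing.isLinear.Build _ _ _ _ f1 l1.
pose F2 := GRing.isLinear.Build _ _ _ _ f2 l2.
pose L1 : {linear tensor -> W} := HB.pack f1 F1.
pose L2 : {linear tensor -> W} := HB.pack f2 F2.
rewrite -[f1 x]/(L1 x) -[f2 x]/(L2 x) [x]tensorE !linear_sum.
by apply: eq_bigr => p _; apply: e.
Qed.

End Tensor.

Notation "A ⊗ B" := (tensor A%type B%type) (at level 40, left associativity) : type_scope.
Notation "a ⊗ b" := (tens a b) (at level 40, left associativity) : ring_scope.

Section TensorAlgebra.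
Variables (k : fieldType) (A B : algType k).
Implicit Types x y z : A ⊗ B.

Lemma tmul_inner_bilinear (W : lmodType k) (f : A -> B -> W) a b :
  bilinear_for *:%R *:%R f ->
  bilinear_for *:%R *:%R (fun c d => f (a * c) (b * d)).
Proof.
move=> fb; split=> [d|c] e u v.
  by rewrite mulrDr -scalerAr (fb.1 (b * d)).
by rewrite mulrDr -scalerAr (fb.2 (a * c)).
Qed.

Lemma tmul_outer_bilinear (W : lmodType k) (f : A -> B -> W) y :
  bilinear_for *:%R *:%R f ->
  bilinear_for *:%R *:%R
    (fun a b => tlift (fun c d => f (a * c) (b * d)) y).
Proof.
move=> fb; apply: bilinearP => [b|a] e u v; rewrite /tlift /formal_eval scaler_sumr;
  rewrite -big_split; apply: eq_bigr => p _ /=; rewrite mulrDl -scalerAl.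
  by rewrite (fb.1 (b * p.2)).
by rewrite (fb.2 (a * p.1)).
Qed.

Definition tmul x y : A ⊗ B :=
  tlift (fun a b => tlift (fun c d => (a * c) ⊗ (b * d)) y) x.

Lemma tmul_linearl y : linear (tmul^~ y).
Proof.
by apply: tlift_is_linear; apply: tmul_outer_bilinear; apply: tens_bilinear.
Qed.

Lemma tmul_linearr x : linear (tmul x).
Proof.
move=> c y z; rewrite /tmul {1 3 5}/tlift /formal_eval scaler_sumr -big_split.
apply: eq_bigr => p _ /=; apply: tlift_is_linear.
by apply: tmul_inner_bilinear; apply: tens_bilinear.
Qed.

Lemma tmul_tens a b c d : tmul (a ⊗ b) (c ⊗ d) = (a * c) ⊗ (b * d).
Proof.
rewrite /tmul tlift_tens; last exact/tmul_outer_bilinear/tens_bilinear.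
by rewrite tlift_tens //; apply/tmul_inner_bilinear/tens_bilinear.
Qed.

Lemma tmulA : associative tmul.
Proof.
move=> x y z.
move: x; apply: tensor_ext => [c u v|c u v|a b].
- exact: tmul_linearl.
- by rewrite !tmul_linearl.
move: y; apply: tensor_ext => [c u v|c u v|a' b'].
- by rewrite tmul_linearl tmul_linearr.
- by rewrite tmul_linearr tmul_linearl.
move: z; apply: tensor_ext => [c u v|c u v|a'' b''].
- by rewrite !tmul_linearr.
- by rewrite tmul_linearr.
by rewrite !tmul_tens !mulrA.
Qed.

Lemma tmul1l : left_id (1 ⊗ 1) tmul.
Proof.
apply: tensor_ext => [c u v|//|a b]; first exact: tmul_linearr.
by rewrite tmul_tens !mul1r.
Qed.

Lemma tmul1r : right_id (1 ⊗ 1) tmul.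
Proof.
apply: tensor_ext => [c u v|//|a b]; first exact: tmul_linearl.
by rewrite tmul_tens !mulr1.
Qed.

Lemma tmulDl : left_distributive tmul +%R.
Proof. by move=> x y z; have := tmul_linearl z 1 x y; rewrite !scale1r. Qed.

Lemma tmulDr : right_distributive tmul +%R.
Proof. by move=> x y z; have := tmul_linearr x 1 y z; rewrite !scale1r. Qed.

Lemma tone_neq0 : 1 ⊗ 1 != 0 :> A ⊗ B.
Proof.
have [f [fl f1]] := exists_functional (oner_neq0 A).
have [g [gl g1]] := exists_functional (oner_neq0 B).
pose h a b : k^o := f a * g b.
have hb : bilinear_for *:%R *:%R h.
  split=> [b|a] c u v; rewrite /h ?fl ?gl.
    by rewrite mulrDl -mulrA.
  by rewrite mulrDr mulrCA.
apply/eqP => /(congr1 (tlift h)); rewrite tlift_tens //.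
rewrite -[0]/(tzero A B) tlift_zero // /h f1 g1 mulr1.
by apply/eqP; apply: oner_neq0.
Qed.

HB.instance Definition _ := GRing.Zmodule_isNzRing.Build (A ⊗ B)%type
  tmulA tmul1l tmul1r tmulDl tmulDr tone_neq0.

Lemma tmulAl (c : k) x y : c *: (x * y) = (c *: x) * y.
Proof.
by have := tmul_linearl y c x 0; rewrite addr0 -[tmul 0 y]/(0 * y) mul0r addr0.
Qed.

HB.instance Definition _ := GRing.Lmodule_isLalgebra.Build k (A ⊗ B)%type tmulAl.

Lemma tmulAr (c : k) x y : c *: (x * y) = x * (c *: y).
Proof.
by have := tmul_linearr x c y 0; rewrite addr0 -[tmul x 0]/(x * 0) mulr0 addr0.
Qed.

HB.instance Definition _ := GRing.Lalgebra_isAlgebra.Build k (A ⊗ B)%type tmulAr.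

Lemma tensM (a c : A) (b d : B) : (a ⊗ b) * (c ⊗ d) = (a * c) ⊗ (b * d).
Proof. exact: tmul_tens. Qed.

Lemma tens1 : 1 ⊗ 1 = 1 :> A ⊗ B.
Proof. by []. Qed.

End TensorAlgebra.

Section TensorMaps.
Variable k : fieldType.

Section Linear.
Variables A B C D : lmodType k.

Definition tmap (f : A -> C) (g : B -> D) : A ⊗ B -> C ⊗ D :=
  tlift (fun a b => f a ⊗ g b).

Definition tassoc : (A ⊗ B) ⊗ C -> A ⊗ (B ⊗ C) :=
  tlift (fun t c => tlift (fun a b => a ⊗ (b ⊗ c)) t).

Definition tswap : A ⊗ B -> B ⊗ A := tlift (fun a b => b ⊗ a).

Lemma tensZDl c (a a' : A) (b : B) :
  (c *: a + a') ⊗ b = c *: (a ⊗ b) + a' ⊗ b.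
Proof. exact: (tens_bilinear A B).1. Qed.

Lemma tensZDr c (a : A) (b b' : B) :
  a ⊗ (c *: b + b') = c *: (a ⊗ b) + a ⊗ b'.
Proof. exact: (tens_bilinear A B).2. Qed.

End Linear.

Lemma tmap_bilinear (A B C D : lmodType k) (f : A -> C) (g : B -> D) :
  linear f -> linear g ->
  bilinear_for *:%R *:%R (fun a b => f a ⊗ g b).
Proof.
move=> fl gl; apply: bilinearP => [b|a] c u v.
  by rewrite fl tensZDl.
by rewrite gl tensZDr.
Qed.

Lemma tmap_linear (A B C D : lmodType k) (f : A -> C) (g : B -> D) :
  linear f -> linear g -> linear (tmap f g).
Proof. by move=> fl gl; apply: tlift_is_linear; apply: tmap_bilinear. Qed.

Lemma tmap_tens (A B C D : lmodType k) (f : A -> C) (g : B -> D) a b :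
  linear f -> linear g -> tmap f g (a ⊗ b) = f a ⊗ g b.
Proof. by move=> fl gl; rewrite /tmap tlift_tens //; apply: tmap_bilinear. Qed.

Lemma tassoc_inner_bilinear (A B C : lmodType k) (c : C) :
  bilinear_for *:%R *:%R (fun (a : A) (b : B) => a ⊗ (b ⊗ c)).
Proof.
apply: bilinearP => [b|a] d u v; first exact: tensZDl.
by rewrite tensZDl tensZDr.
Qed.

Lemma tassoc_outer_bilinear (A B C : lmodType k) :
  bilinear_for *:%R *:%R
    (fun (t : A ⊗ B) (c : C) => tlift (fun a b => a ⊗ (b ⊗ c)) t).
Proof.
apply: bilinearP => [c|t] d u v.
  by apply: tlift_is_linear; apply: tassoc_inner_bilinear.
rewrite /tlift /formal_eval scaler_sumr -big_split; apply: eq_bigr => p _ /=.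
by rewrite !tensZDr.
Qed.

Lemma tassoc_linear (A B C : lmodType k) : linear (@tassoc A B C).
Proof. by apply: tlift_is_linear; apply: tassoc_outer_bilinear. Qed.

Lemma tassoc_tens (A B C : lmodType k) (a : A) (b : B) (c : C) :
  tassoc ((a ⊗ b) ⊗ c) = a ⊗ (b ⊗ c).
Proof.
rewrite /tassoc tlift_tens; last exact: tassoc_outer_bilinear.
by rewrite tlift_tens //; apply: tassoc_inner_bilinear.
Qed.

Lemma tensor3_ext (A B C V : lmodType k) (f1 f2 : (A ⊗ B) ⊗ C -> V) :
  linear f1 -> linear f2 ->
  (forall a b c, f1 ((a ⊗ b) ⊗ c) = f2 ((a ⊗ b) ⊗ c)) -> f1 =1 f2.
Proof.
move=> l1 l2 e; apply: tensor_ext => // t c; move: t.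
by apply: tensor_ext => [d u v|d u v|a b]; rewrite ?tensZDl ?l1 ?l2.
Qed.

Lemma tmapM (A B C D : algType k) (f : {lrmorphism A -> C})
    (g : {lrmorphism B -> D}) : {morph tmap f g : x y / x * y}.
Proof.
have fl : linear f by exact: linearP.
have gl : linear g by exact: linearP.
have tl := tmap_linear fl gl.
move=> x y; move: x; apply: tensor_ext => [c u v|c u v|a b].
- by rewrite mulrDl -scalerAl tl.
- by rewrite tl mulrDl -scalerAl.
move: y; apply: tensor_ext => [c u v|c u v|a' b'].
- by rewrite mulrDr -scalerAr tl.
- by rewrite tl mulrDr -scalerAr.
by rewrite tensM !tmap_tens // tensM !rmorphM.
Qed.

Lemma tassocM (A B C : algType k) : {morph @tassoc A B C : x y / x * y}.
Proof.
have tl := @tassoc_linear A B C.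
move=> x y; move: x; apply: tensor3_ext => [c u v|c u v|a b c].
- by rewrite mulrDl -scalerAl tl.
- by rewrite tl mulrDl -scalerAl.
move: y; apply: tensor3_ext => [d u v|d u v|a' b' c'].
- by rewrite mulrDr -scalerAr tl.
- by rewrite tl mulrDr -scalerAr.
by rewrite !tensM !tassoc_tens !tensM.
Qed.

End TensorMaps.

HB.mixin Record isHopf (k : fieldType) H of GRing.Algebra k H := {
  comul : {lrmorphism H -> (H ⊗ H)%type};
  counit : {lrmorphism H -> k^o};
  antipode : {linear H -> H};
  coassoc : forall h, tassoc (tmap comul idfun (comul h)) =
                      tmap idfun comul (comul h);
  counitl : forall h, tlift (fun a b => (counit a : k) *: b) (comul h) = h;
  counitr : forall h, tlift (fun a b => (counit b : k) *: a) (comul h) = h;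
  antipodel : forall h,
    tlift (fun a b => antipode a * b) (comul h) = (counit h : k)%:A;
  antipoder : forall h,
    tlift (fun a b => a * antipode b) (comul h) = (counit h : k)%:A
}.

#[short(type="hopfAlgType")]
HB.structure Definition HopfAlgebra (k : fieldType) :=
  {H of isHopf k H & GRing.Algebra k H}.

Section HopfFromGenerators.
Variables (k : fieldType) (H : algType k).
Variables (D : {lrmorphism H -> (H ⊗ H)%type}) (e : {lrmorphism H -> k^o}).
Variable S : {linear H -> H}.
Hypothesis S1 : S 1 = 1.
Hypothesis SM : forall a b, S (a * b) = S b * S a.

Definition hopf_axioms_at (h : H) : Prop :=
  [/\ tassoc (tmap D idfun (D h)) = tmap idfun D (D h),
      tlift (fun a b => (e a : k) *: b) (D h) = h,
      tlift (fun a b => (e b : k) *: a) (D h) = h,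
      tlift (fun a b => S a * b) (D h) = (e h : k)%:A &
      tlift (fun a b => a * S b) (D h) = (e h : k)%:A].

Let eP c a b : e (c *: a + b) = c * e a + e b :> k.
Proof. exact: linearP. Qed.

Let SP c u v : S (c *: u + v) = c *: S u + S v.
Proof. exact: linearP. Qed.

Lemma el_bilinear :
  bilinear_for *:%R *:%R (fun a b : H => (e a : k) *: b).
Proof.
apply: bilinearP => [b|a] c u v; first by rewrite eP scalerDl scalerA.
by rewrite scalerDr !scalerA mulrC.
Qed.

Lemma er_bilinear :
  bilinear_for *:%R *:%R (fun a b : H => (e b : k) *: a).
Proof.
apply: bilinearP => [b|a] c u v; last by rewrite eP scalerDl scalerA.
by rewrite scalerDr !scalerA mulrC.
Qed.

Lemma Sl_bilinear : bilinear_for *:%R *:%R (fun a b : H => S a * b).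
Proof.
apply: bilinearP => [b|a] c u v; first by rewrite SP mulrDl scalerAl.
by rewrite mulrDr scalerAr.
Qed.

Lemma Sr_bilinear : bilinear_for *:%R *:%R (fun a b : H => a * S b).
Proof.
apply: bilinearP => [b|a] c u v; first by rewrite mulrDl scalerAl.
by rewrite SP (mulrDr a (c *: S u) (S v)) scalerAr.
Qed.

Let Dl : linear D. Proof. exact: linearP. Qed.
Let idl : linear (idfun : H -> H). Proof. by []. Qed.

Let ell := tlift_is_linear el_bilinear.
Let erl := tlift_is_linear er_bilinear.
Let Sll := tlift_is_linear Sl_bilinear.
Let Srl := tlift_is_linear Sr_bilinear.
Let Dil := tmap_linear Dl idl.
Let iDl := tmap_linear idl Dl.

Lemma hopf_axioms_lin c a b :
  hopf_axioms_at a -> hopf_axioms_at b -> hopf_axioms_at (c *: a + b).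
Proof.
move=> [a1 a2 a3 a4 a5] [b1 b2 b3 b4 b5]; split; rewrite Dl.
- by rewrite Dil tassoc_linear iDl a1 b1.
- by rewrite ell a2 b2.
- by rewrite erl a3 b3.
- by rewrite Sll a4 b4 eP scalerDl scalerA.
- by rewrite Srl a5 b5 eP scalerDl scalerA.
Qed.

Lemma hopf_axioms_one : hopf_axioms_at 1.
Proof.
have e1 : e 1 = 1 :> k by exact: rmorph1.
split; rewrite rmorph1 -tens1.
- by rewrite !tmap_tens // rmorph1 -tens1 tassoc_tens.
- by rewrite tlift_tens ?e1 ?scale1r //; apply: el_bilinear.
- by rewrite tlift_tens ?e1 ?scale1r //; apply: er_bilinear.
- by rewrite tlift_tens ?S1 ?e1 ?scale1r ?mul1r //; apply: Sl_bilinear.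
- by rewrite tlift_tens ?S1 ?e1 ?scale1r ?mul1r //; apply: Sr_bilinear.
Qed.

Let eM a b : e (a * b) = e a * e b :> k. Proof. exact: rmorphM. Qed.

Lemma tlift_elM x y : tlift (fun a b : H => (e a : k) *: b) (x * y) =
  tlift (fun a b => (e a : k) *: b) x * tlift (fun a b => (e a : k) *: b) y.
Proof.
move: x; apply: tensor_ext => [c u v|c u v|a b].
- by rewrite mulrDl -scalerAl ell.
- by rewrite ell mulrDl -scalerAl.
move: y; apply: tensor_ext => [c u v|c u v|a' b'].
- by rewrite mulrDr -scalerAr ell.
- by rewrite ell mulrDr -scalerAr.
rewrite tensM !tlift_tens ?eM; try exact: el_bilinear.
by rewrite -scalerAl -scalerAr scalerA.
Qed.

Lemma tlift_erM x y : tlift (fun a b : H => (e b : k) *: a) (x * y) =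
  tlift (fun a b => (e b : k) *: a) x * tlift (fun a b => (e b : k) *: a) y.
Proof.
move: x; apply: tensor_ext => [c u v|c u v|a b].
- by rewrite mulrDl -scalerAl erl.
- by rewrite erl mulrDl -scalerAl.
move: y; apply: tensor_ext => [c u v|c u v|a' b'].
- by rewrite mulrDr -scalerAr erl.
- by rewrite erl mulrDr -scalerAr.
rewrite tensM !tlift_tens ?eM; try exact: er_bilinear.
by rewrite -scalerAl -scalerAr scalerA.
Qed.

Lemma tlift_SlM x c d : tlift (fun a b => S a * b) (x * (c ⊗ d)) =
  S c * tlift (fun a b => S a * b) x * d.
Proof.
move: x; apply: tensor_ext => [t u v|t u v|a b].
- by rewrite mulrDl -scalerAl Sll.
- by rewrite Sll mulrDr -scalerAr mulrDl -scalerAl.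
by rewrite tensM !tlift_tens ?SM ?mulrA //; apply: Sl_bilinear.
Qed.

Lemma tlift_SrM x a b : tlift (fun a b => a * S b) ((a ⊗ b) * x) =
  a * tlift (fun a b => a * S b) x * S b.
Proof.
move: x; apply: tensor_ext => [t u v|t u v|c d].
- by rewrite mulrDr -scalerAr Srl.
- by rewrite Srl mulrDr -scalerAr mulrDl -scalerAl.
by rewrite tensM !tlift_tens ?SM ?mulrA //; apply: Sr_bilinear.
Qed.

Lemma hopf_axioms_mul a b :
  hopf_axioms_at a -> hopf_axioms_at b -> hopf_axioms_at (a * b).
Proof.
move=> [a1 a2 a3 a4 a5] [b1 b2 b3 b4 b5]; split; rewrite rmorphM /=.
- by rewrite (tmapM D idfun) tassocM a1 b1 (tmapM idfun D).
- by rewrite tlift_elM a2 b2.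
- by rewrite tlift_erM a3 b3.
- rewrite eM -scalerA -b4; move: (D b); apply: tensor_ext => [t u v|t u v|c d].
  + by rewrite mulrDr -scalerAr Sll.
  + by rewrite Sll scalerDr !scalerA mulrC.
  rewrite tlift_SlM a4 tlift_tens; last exact: Sl_bilinear.
  by rewrite -scalerAr -scalerAl mulr1.
- rewrite eM mulrC -scalerA -a5; move: (D a).
  apply: tensor_ext => [t u v|t u v|c d].
  + by rewrite mulrDl -scalerAl Srl.
  + by rewrite Srl scalerDr !scalerA mulrC.
  rewrite tlift_SrM b5 tlift_tens; last exact: Sr_bilinear.
  by rewrite -scalerAr -scalerAl mulr1.
Qed.

Lemma hopf_axioms_grouplike g g' :
  D g = g ⊗ g -> e g = 1 :> k -> S g = g' -> g * g' = 1 -> g' * g = 1 ->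
  hopf_axioms_at g.
Proof.
move=> Dg eg Sg gg' g'g; split; rewrite Dg.
- by rewrite !tmap_tens // Dg tassoc_tens.
- by rewrite tlift_tens ?eg ?scale1r //; apply: el_bilinear.
- by rewrite tlift_tens ?eg ?scale1r //; apply: er_bilinear.
- by rewrite tlift_tens ?Sg ?g'g ?eg ?scale1r //; apply: Sl_bilinear.
- by rewrite tlift_tens ?Sg ?gg' ?eg ?scale1r //; apply: Sr_bilinear.
Qed.

Lemma hopf_axioms_primitive z :
  D z = z ⊗ 1 + 1 ⊗ z -> e z = 0 :> k -> S z = - z -> hopf_axioms_at z.
Proof.
move=> Dz ez Sz; have e1 : e 1 = 1 :> k by exact: rmorph1.
have D' : D z = 1 *: (z ⊗ 1) + 1 ⊗ z by rewrite scale1r.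
have D1 : D 1 = 1 ⊗ 1 by exact: rmorph1.
have tD (a : H) (b c : H ⊗ H) : a ⊗ (b + c) = a ⊗ b + a ⊗ c.
  by have := tensZDr 1 a b c; rewrite !scale1r.
have tD' (a : H) (b c : H ⊗ H) : (b + c) ⊗ a = b ⊗ a + c ⊗ a.
  by have := tensZDl 1 b c a; rewrite !scale1r.
split; rewrite D'.
- rewrite Dil iDl tassoc_linear !scale1r !tmap_tens // Dz D1 /=.
  have aD (x y : (H ⊗ H) ⊗ H) : tassoc (x + y) = tassoc x + tassoc y.
    by have := tassoc_linear 1 x y; rewrite !scale1r.
  by rewrite tD' aD !tassoc_tens tD addrA.
- rewrite ell !tlift_tens ?e1 ?ez ?scale0r ?scaler0 ?add0r ?scale1r //;
  exact: el_bilinear.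
- rewrite erl !tlift_tens ?e1 ?ez ?scale0r ?addr0 ?scale1r //;
  exact: er_bilinear.
- rewrite Sll !tlift_tens ?ez ?Sz ?S1 ?mulr1 ?mul1r ?scale1r ?addNr ?scale0r //;
  exact: Sl_bilinear.
- rewrite Srl !tlift_tens ?ez ?Sz ?S1 ?mulr1 ?mul1r ?scale1r ?addrN ?scale0r //;
  exact: Sr_bilinear.
Qed.

End HopfFromGenerators.

Definition group_algebra (k : fieldType) (G : groupType) := monoid_algebra k G.

HB.instance Definition _ (k : fieldType) (G : groupType) :=
  GRing.Algebra.on (group_algebra k G).

Section GroupAlgebraHopf.
Variables (k : fieldType) (G : groupType).
Local Notation kG := (group_algebra k G).

Definition group_elt (g : G) : kG := mbasis k g.

Definition group_comul : kG -> (kG ⊗ kG)%type :=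
  mlift (fun g => group_elt g ⊗ group_elt g).

Definition group_counit : kG -> k^o := mlift (fun=> 1).

Definition group_antipode : kG -> kG := mlift (fun g => group_elt g^-1%g).

HB.instance Definition _ := GRing.Linear.on group_comul.
HB.instance Definition _ := GRing.Linear.on group_counit.
HB.instance Definition _ := GRing.Linear.on group_antipode.

Lemma group_comul_monoid_morphism : monoid_morphism group_comul.
Proof.
by apply: mlift_monoid_morphism => // g h; rewrite /group_elt mbasisM tensM.
Qed.

HB.instance Definition _ := GRing.isMonoidMorphism.Build kG (kG ⊗ kG)%type
  group_comul group_comul_monoid_morphism.

Lemma group_counit_monoid_morphism : monoid_morphism group_counit.
Proof. by apply: mlift_monoid_morphism => // g h; rewrite mulr1. Qed.

HB.instance Definition _ := GRing.isMonoidMorphism.Build kG k^o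
  group_counit group_counit_monoid_morphism.

Lemma group_antipode1 : group_antipode 1 = 1.
Proof. by rewrite -[1 in LHS]mbasis1 /group_antipode mlift_basis invg1. Qed.

Lemma group_antipodeM a b :
  group_antipode (a * b) = group_antipode b * group_antipode a.
Proof.
move: a; apply: mbasis_ext => [c u v|c u v|g].
- by rewrite mulrDl -scalerAl linearP.
- by rewrite linearP mulrDr -scalerAr.
move: b; apply: mbasis_ext => [c u v|c u v|h].
- by rewrite mulrDr -scalerAr linearP.
- by rewrite linearP mulrDl -scalerAl.
by rewrite -mbasisM /group_antipode !mlift_basis -mbasisM invgM.
Qed.

Lemma group_hopf_axioms h :
  hopf_axioms_at group_comul group_counit group_antipode h.
Proof.
rewrite [h]monoid_algebraE.
elim/big_rec: _ => [|g b _ IHb].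
  have := hopf_axioms_lin (-1)
    (hopf_axioms_one group_comul group_counit group_antipode1)
    (hopf_axioms_one group_comul group_counit group_antipode1).
  by rewrite scaleN1r addNr.
apply: hopf_axioms_lin => //.
apply: (@hopf_axioms_grouplike _ _ _ _ _ _ (group_elt g^-1%g)).
- by rewrite /= /group_comul mlift_basis.
- by rewrite /= /group_counit mlift_basis.
- by rewrite /= /group_antipode mlift_basis.
- by rewrite -mbasisM mulgV.
- by rewrite -mbasisM mulVg.
Qed.

HB.instance Definition _ := isHopf.Build k kG
  (fun h => let: And5 p _ _ _ _ := group_hopf_axioms h in p)
  (fun h => let: And5 _ p _ _ _ := group_hopf_axioms h in p)
  (fun h => let: And5 _ _ p _ _ := group_hopf_axioms h in p)
  (fun h => let: And5 _ _ _ p _ := group_hopf_axioms h in p)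
  (fun h => let: And5 _ _ _ _ p := group_hopf_axioms h in p).

End GroupAlgebraHopf.

(* The opposite algebra, as the target of antipodes.                          *)
HB.instance Definition _ (k : fieldType) (A : lmodType k) :=
  GRing.Zmodule_isLmodule.Build k A^c
    (@scalerA k A) (@scale1r k A) (@scalerDr k A) (@scalerDl k A).

Lemma converse_scalerAl (k : fieldType) (A : algType k) (c : k) (a b : A^c) :
  c *: (a * b) = (c *: a) * b.
Proof. exact: (@scalerAr k A). Qed.

Lemma converse_scalerAr (k : fieldType) (A : algType k) (c : k) (a b : A^c) :
  c *: (a * b) = a * (c *: b).
Proof. exact: (@scalerAl k A). Qed.

HB.instance Definition _ (k : fieldType) (A : algType k) :=
  GRing.Lmodule_isLalgebra.Build k A^c (@converse_scalerAl k A).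
HB.instance Definition _ (k : fieldType) (A : algType k) :=
  GRing.Lalgebra_isAlgebra.Build k A^c (@converse_scalerAr k A).

Lemma converse_morphM (k : fieldType) (A B : algType k)
    (f : {lrmorphism A -> B^c}) (u v : A) : f (u * v) = (f v : B) * f u.
Proof. exact: (rmorphM f u v). Qed.

Lemma proper_of_lrmorphism (k : fieldType) (A B : algType k) (S : A -> Prop)
    (f : {lrmorphism A -> B}) :
  (forall s, S s -> f s = 0) -> ~ ideal_gen S 1.
Proof.
by move=> fS /(ideal_gen_ker fS) /eqP; rewrite rmorph1 oner_eq0.
Qed.

Section QuantumRelation.
Variables (k : fieldType) (A B : algType k) (f : {lrmorphism A -> B}).

Lemma lrmorph_qcomm (u v : A) (c : k) :
  f (u * v - c *: (v * u)) = f u * f v - c *: (f v * f u).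
Proof. by rewrite linearB linearZ !rmorphM. Qed.

Lemma lrmorph_comm (u v : A) : f (u * v - v * u) = f u * f v - f v * f u.
Proof. by rewrite rmorphB !rmorphM. Qed.

Lemma lrmorph_inv (u v : A) : f (u * v - 1) = f u * f v - 1.
Proof. by rewrite rmorphB rmorphM rmorph1. Qed.

End QuantumRelation.

Lemma free_eval_qcomm (k : fieldType) (X : choiceType) (A : algType k)
    (v : X -> A) (i j : X) (c : k) :
  free_eval v (free_gen k i * free_gen k j - c *: (free_gen k j * free_gen k i))
  = v i * v j - c *: (v j * v i).
Proof. by rewrite lrmorph_qcomm /= !free_eval_gen. Qed.

Section QuantumAffineSpace.
Variables (k : fieldType) (q : k) (n : nat).

Definition quantum_relator (r : free_algebra k 'I_n) : Prop :=
  exists2 ij : 'I_n * 'I_n, (ij.1 < ij.2)%N &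
    r = free_gen k ij.2 * free_gen k ij.1
        - q *: (free_gen k ij.1 * free_gen k ij.2).

Lemma quantum_relator_proper : ~ ideal_gen quantum_relator 1.
Proof.
apply: (@proper_of_lrmorphism _ _ k^o _ (free_eval (fun=> 0))) => _ [ij _ ->].
by apply: etrans (free_eval_qcomm _ _ _ _) _; rewrite !mul0r scaler0 subr0.
Qed.

Definition quantum_affine : algType k :=
  quotient_algebra (Relators quantum_relator_proper).

Definition qvar (i : 'I_n) : quantum_affine := qproj _ (free_gen k i).

(* The span of the monomials of length d, every variable having degree 1.     *)
Definition degree_part (d : nat) (a : quantum_affine) : Prop :=
  exists s : seq (k * d.-tuple 'I_n),
    a = \sum_(m <- s) m.1 *: \prod_(i <- m.2) qvar i.

End QuantumAffineSpace.

Inductive skew_gen := GenX | GenXinv | GenY | GenYinv | GenZ.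

Definition skew_gen_code (g : skew_gen) : nat :=
  match g with GenX => 0 | GenXinv => 1 | GenY => 2 | GenYinv => 3 | GenZ => 4 end.
Definition skew_gen_decode (m : nat) : skew_gen :=
  match m with 0 => GenX | 1 => GenXinv | 2 => GenY | 3 => GenYinv | _ => GenZ end%N.
Lemma skew_gen_codeK : cancel skew_gen_code skew_gen_decode.
Proof. by case. Qed.

HB.instance Definition _ := Choice.copy skew_gen (can_type skew_gen_codeK).

Lemma skew_inv (k : fieldType) (A : algType k) (c : k) (u u' w : A) :
  u * u' = 1 -> u' * u = 1 -> w * u = c *: (u * w) -> u' * w = c *: (w * u').
Proof.
move=> uu' u'u wu; rewrite -[LHS]mulr1 -uu' mulrA -[u' * w * u]mulrA wu.
by rewrite -scalerAr mulrA u'u mul1r -scalerAl.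
Qed.

Section SkewAlgebra.
Variables (k : fieldType) (a b : k).

Definition skew_relations (A : algType k) (v : skew_gen -> A) : seq A :=
  [:: v GenX * v GenXinv - 1; v GenXinv * v GenX - 1;
      v GenY * v GenYinv - 1; v GenYinv * v GenY - 1;
      v GenY * v GenX - v GenX * v GenY;
      v GenZ * v GenX - a *: (v GenX * v GenZ);
      v GenZ * v GenY - b *: (v GenY * v GenZ)].

Definition skew_relator (r : free_algebra k skew_gen) : Prop :=
  r \in skew_relations (@free_gen k skew_gen).

Lemma skew_relations_morph (A B : algType k) (f : {lrmorphism A -> B}) v :
  map f (skew_relations v) = skew_relations (f \o v).
Proof. by rewrite /skew_relations /= !lrmorph_inv lrmorph_comm !lrmorph_qcomm. Qed.

Lemma skew_relationsP (A : algType k) (v : skew_gen -> A) :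
  v GenX * v GenXinv = 1 -> v GenXinv * v GenX = 1 ->
  v GenY * v GenYinv = 1 -> v GenYinv * v GenY = 1 ->
  v GenY * v GenX = v GenX * v GenY ->
  v GenZ * v GenX = a *: (v GenX * v GenZ) ->
  v GenZ * v GenY = b *: (v GenY * v GenZ) ->
  forall r, r \in skew_relations v -> r = 0.
Proof.
move=> e1 e2 e3 e4 e5 e6 e7 r.
by rewrite /skew_relations e1 e2 e3 e4 e5 e6 e7 !subrr !inE !orbb => /eqP.
Qed.

Lemma skew_relations_eqs (A : algType k) (v : skew_gen -> A) :
  (forall r, r \in skew_relations v -> r = 0) ->
  [/\ v GenX * v GenXinv = 1, v GenXinv * v GenX = 1,
      v GenY * v GenYinv = 1 & v GenYinv * v GenY = 1] /\
  [/\ v GenY * v GenX = v GenX * v GenY,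
      v GenZ * v GenX = a *: (v GenX * v GenZ) &
      v GenZ * v GenY = b *: (v GenY * v GenZ)].
Proof.
by move=> h; split; split; apply/eqP; rewrite -subr_eq0; apply/eqP; apply: h;
  rewrite !inE eqxx ?orbT.
Qed.

Section SkewTriple.
Variables (A : algType k) (v : skew_gen -> A).
Hypothesis v0 : forall r, r \in skew_relations v -> r = 0.

Local Notation x := (v GenX).
Local Notation x' := (v GenXinv).
Local Notation y := (v GenY).
Local Notation y' := (v GenYinv).
Local Notation z := (v GenZ).

Definition skew_comul_val (g : skew_gen) : (A ⊗ A)%type :=
  if g is GenZ then z ⊗ 1 + 1 ⊗ z else v g ⊗ v g.

Lemma skew_comul_relations r : r \in skew_relations skew_comul_val -> r = 0.
Proof.
have [[xx' x'x yy' y'y] [yx zx zy]] := skew_relations_eqs v0.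
have Zl c (u w : A) : (c *: u) ⊗ w = c *: (u ⊗ w).
  exact: (bilinZl (tens_bilinear A A)).
have Zr c (u w : A) : u ⊗ (c *: w) = c *: (u ⊗ w).
  exact: (bilinZr (tens_bilinear A A)).
apply: skew_relationsP; rewrite /skew_comul_val ?mulrDl ?mulrDr !tensM
  ?xx' ?x'x ?yy' ?y'y ?yx ?zx ?zy ?mul1r ?mulr1 //.
- by rewrite Zl Zr -scalerDr.
- by rewrite Zl Zr -scalerDr.
Qed.

Definition skew_antipode_val (g : skew_gen) : A^c :=
  match g with
  | GenX => x' | GenXinv => x | GenY => y' | GenYinv => y | GenZ => - z
  end.

Lemma skew_antipode_relations r :
  r \in skew_relations skew_antipode_val -> r = 0.
Proof.
have [[xx' x'x yy' y'y] [yx zx zy]] := skew_relations_eqs v0.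
have x'y : x' * y = 1 *: (y * x').
  by apply: (skew_inv xx' x'x); rewrite scale1r.
have y'x' : x' * y' = y' * x'.
  by have := skew_inv yy' y'y x'y; rewrite scale1r.
have x'z := skew_inv xx' x'x zx; have y'z := skew_inv yy' y'y zy.
apply: skew_relationsP.
- exact: xx'.
- exact: x'x.
- exact: yy'.
- exact: y'y.
- exact: y'x'.
- by rewrite -[LHS]/(x' * - z) -[RHS]/(a *: (- z * x')) mulrN mulNr scalerN x'z.
- by rewrite -[LHS]/(y' * - z) -[RHS]/(b *: (- z * y')) mulrN mulNr scalerN y'z.
Qed.

End SkewTriple.

Lemma skew_eval_relator (A : algType k) (v : skew_gen -> A) :
  (forall r, r \in skew_relations v -> r = 0) ->
  forall s, skew_relator s -> free_eval v s = 0.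
Proof.
move=> v0 s sR; apply: v0.
suff -> : skew_relations v = map (free_eval v) (skew_relations (@free_gen k _)).
  exact: map_f.
rewrite skew_relations_morph; congr skew_relations.
by apply/funext => g; rewrite /= free_eval_gen.
Qed.

Definition skew_counit_val (g : skew_gen) : k^o := if g is GenZ then 0 else 1.

Lemma skew_counit_relations r : r \in skew_relations skew_counit_val -> r = 0.
Proof.
by apply: skew_relationsP;
  rewrite /= ?mulr1 ?mul0r ?mulr0 ?scaler0.
Qed.

Lemma skew_relator_proper : ~ ideal_gen skew_relator 1.
Proof.
exact: (@proper_of_lrmorphism _ _ _ _ (free_eval skew_counit_val)
          (skew_eval_relator skew_counit_relations)).
Qed.

(* k<x^{+-1}, y^{+-1}, z> / (yx - xy, zx - a xz, zy - b yz)                   *)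
Definition skew_algebra :=
  quotient_algebra (Relators skew_relator_proper).

HB.instance Definition _ := GRing.Algebra.on skew_algebra.

Definition skew_elt (g : skew_gen) : skew_algebra := qproj _ (free_gen k g).

Local Notation H := skew_algebra.
Local Notation x := (skew_elt GenX).
Local Notation x' := (skew_elt GenXinv).
Local Notation y := (skew_elt GenY).
Local Notation y' := (skew_elt GenYinv).
Local Notation z := (skew_elt GenZ).

Lemma skew_elt_relations r : r \in skew_relations skew_elt -> r = 0.
Proof.
have -> : skew_relations skew_elt =
    map (qproj (Relators skew_relator_proper)) (skew_relations (@free_gen k _)).
  by rewrite skew_relations_morph.
case/mapP=> s sR ->; rewrite -(linear0 (qproj (Relators skew_relator_proper))).
by apply/qprojP; rewrite subr0; apply: ideal_gen_sub.
Qed.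

Lemma skew_eqs :
  [/\ x * x' = 1, x' * x = 1, y * y' = 1 & y' * y = 1] /\
  [/\ y * x = x * y, z * x = a *: (x * z) & z * y = b *: (y * z)].
Proof. exact: skew_relations_eqs skew_elt_relations. Qed.

Definition skew_comul : H -> (H ⊗ H)%type :=
  qlift (S := Relators skew_relator_proper)
        (skew_eval_relator (skew_comul_relations skew_elt_relations)).

Definition skew_counit : H -> k^o :=
  qlift (S := Relators skew_relator_proper)
        (skew_eval_relator skew_counit_relations).

Definition skew_antipode_conv : H -> H^c :=
  qlift (S := Relators skew_relator_proper)
        (skew_eval_relator (skew_antipode_relations skew_elt_relations)).

Definition skew_antipode : H -> H := skew_antipode_conv.

HB.instance Definition _ := GRing.LRMorphism.on skew_comul.
HB.instance Definition _ := GRing.LRMorphism.on skew_counit.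
HB.instance Definition _ := GRing.LRMorphism.on skew_antipode_conv.

Lemma skew_antipode_is_linear : linear skew_antipode.
Proof. exact: (linearP skew_antipode_conv). Qed.

HB.instance Definition _ := GRing.isLinear.Build k H H *:%R
  skew_antipode skew_antipode_is_linear.

Lemma skew_comulE g : skew_comul (skew_elt g) = skew_comul_val skew_elt g.
Proof. exact: etrans (qliftE _ _) (free_eval_gen _ _). Qed.

Lemma skew_counitE g : skew_counit (skew_elt g) = skew_counit_val g.
Proof. exact: etrans (qliftE _ _) (free_eval_gen _ _). Qed.

Lemma skew_antipode_convE g :
  skew_antipode_conv (skew_elt g) = skew_antipode_val skew_elt g.
Proof. by rewrite /skew_antipode_conv qliftE; apply: free_eval_gen. Qed.

Lemma skew_antipodeE g :
  skew_antipode (skew_elt g) = skew_antipode_val skew_elt g.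
Proof. by rewrite -skew_antipode_convE. Qed.

Lemma skew_antipode1 : skew_antipode 1 = 1.
Proof. exact: (rmorph1 skew_antipode_conv). Qed.

Lemma skew_antipodeM (u v : H) :
  skew_antipode (u * v) = skew_antipode v * skew_antipode u.
Proof. exact: (converse_morphM skew_antipode_conv u v). Qed.

Lemma skew_hopf_axioms h :
  hopf_axioms_at skew_comul skew_counit skew_antipode h.
Proof.
have [[xx' x'x yy' y'y] _] := skew_eqs.
elim/quotient_ind: h; apply: free_algebra_ind => [|g|u v|c u v].
- by rewrite rmorph1; apply: hopf_axioms_one; apply: skew_antipode1.
- have gl g1 g2 : skew_comul_val skew_elt g1 = skew_elt g1 ⊗ skew_elt g1 ->
      skew_counit_val g1 = 1 -> skew_antipode_val skew_elt g1 = skew_elt g2 ->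
      skew_elt g1 * skew_elt g2 = 1 -> skew_elt g2 * skew_elt g1 = 1 ->
      hopf_axioms_at skew_comul skew_counit skew_antipode (skew_elt g1).
    move=> e1 e2 e3 e4 e5.
    refine (hopf_axioms_grouplike _ _ _ e4 e5).
    + by rewrite -e1; apply: skew_comulE.
    + by rewrite -e2; apply: skew_counitE.
    + by rewrite -e3; apply: skew_antipodeE.
  rewrite -/(skew_elt g); case: g.
  + exact: (gl _ GenXinv).
  + exact: (gl _ GenX).
  + exact: (gl _ GenYinv).
  + exact: (gl _ GenY).
  + apply: hopf_axioms_primitive.
    * exact: skew_antipode1.
    * exact: skew_comulE.
    * exact: skew_counitE.
    * exact: skew_antipodeE.
- rewrite rmorphM; apply: hopf_axioms_mul; exact: skew_antipodeM.
- by rewrite linearP; apply: hopf_axioms_lin.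
Qed.

HB.instance Definition _ := isHopf.Build k H
  (fun h => let: And5 p _ _ _ _ := skew_hopf_axioms h in p)
  (fun h => let: And5 _ p _ _ _ := skew_hopf_axioms h in p)
  (fun h => let: And5 _ _ p _ _ := skew_hopf_axioms h in p)
  (fun h => let: And5 _ _ _ p _ := skew_hopf_axioms h in p)
  (fun h => let: And5 _ _ _ _ p := skew_hopf_axioms h in p).

End SkewAlgebra.

(* The relation zy - yz of B_q reads zy - 1 *: yz here.                       *)
Definition B_alg (k : fieldType) (q : k) : hopfAlgType k := skew_algebra q 1.

Definition C_alg (k : fieldType) (q : k) : hopfAlgType k :=
  skew_algebra q (q ^+ 2).

Section HopfNotions.
Variable k : fieldType.

Definition cocommutative (H : hopfAlgType k) : Prop :=
  forall h : H, tswap (comul h) = comul h.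

Definition is_hopf_morphism (B H : hopfAlgType k) (f : {lrmorphism B -> H}) :
    Prop :=
  [/\ forall b, comul (f b) = tmap f f (comul b),
      forall b, counit (f b) = counit b &
      forall b, antipode (f b) = f (antipode b)].

(* H is isomorphic to the quotient of B by the Hopf ideal ker f.              *)
Definition is_hopf_quotient (B H : hopfAlgType k) : Prop :=
  exists f : {lrmorphism B -> H},
    is_hopf_morphism f /\ forall h, exists b, f b = h.

(* The subspace U ⊗ V of A ⊗ B.                                               *)
Definition subtensor (A B : lmodType k) (U : A -> Prop) (V : B -> Prop)
    (t : A ⊗ B) : Prop :=
  exists s : seq (A * B),
    (forall p, p \in s -> U p.1 /\ V p.2) /\ t = \sum_(p <- s) p.1 ⊗ p.2.

Definition is_hopf_subalgebra (H : hopfAlgType k) (V : H -> Prop) : Prop :=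
  [/\ V 1, forall (c : k) a b, V a -> V b -> V (c *: a + b),
      forall a b, V a -> V b -> V (a * b),
      forall a, V a -> subtensor V V (comul a) &
      forall a, V a -> V (antipode a)].

Section Coaction.
Variables (A : algType k) (H : hopfAlgType k).
Implicit Type rho : {lrmorphism A -> (A ⊗ H)%type}.

Definition is_coaction rho : Prop :=
  (forall a, tassoc (tmap rho idfun (rho a)) = tmap idfun comul (rho a)) /\
  (forall a, tlift (fun a' h => (counit h : k) *: a') (rho a) = a).

Definition inner_faithful rho : Prop :=
  forall V : H -> Prop, is_hopf_subalgebra V ->
    (forall a, subtensor (fun=> True) V (rho a)) -> forall h, V h.

End Coaction.

Definition preserves_degree (q : k) (n : nat) (H : lmodType k)
    (rho : quantum_affine q n -> (quantum_affine q n ⊗ H)%type) : Prop :=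
  forall d a, degree_part d a -> subtensor (degree_part d) (fun=> True) (rho a).

Section Grading.
Variables (A : algType k) (G : groupType).

Definition is_grading (Ag : G -> A -> Prop) : Prop :=
  [/\ forall g, Ag g 0,
      forall g (c : k) a b, Ag g a -> Ag g b -> Ag g (c *: a + b),
      forall a, exists (s : seq G) (c : G -> A),
        (forall g, Ag g (c g)) /\ a = \sum_(g <- s) c g,
      forall (s : seq G) (c : G -> A), uniq s -> (forall g, Ag g (c g)) ->
        \sum_(g <- s) c g = 0 -> forall g, g \in s -> c g = 0 &
      forall g h a b, Ag g a -> Ag h b -> Ag (g * h)%g (a * b)].

Definition is_faithful_grading (Ag : G -> A -> Prop) : Prop :=
  forall K : G -> Prop,
    K 1%g -> (forall g h, K g -> K h -> K (g * h)%g) ->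
    (forall g, K g -> K g^-1%g) ->
    (forall g, (exists2 a, Ag g a & a != 0) -> K g) -> forall g, K g.

Definition is_grading_coaction (Ag : G -> A -> Prop)
    (rho : A -> (A ⊗ group_algebra k G)%type) : Prop :=
  forall g a, Ag g a -> rho a = a ⊗ group_elt k g.

End Grading.

Definition refines_degree (q : k) (n : nat) (G : groupType)
    (Ag : G -> quantum_affine q n -> Prop) : Prop :=
  exists rho : {linear quantum_affine q n ->
                       (quantum_affine q n ⊗ group_algebra k G)%type},
    is_grading_coaction Ag rho /\ preserves_degree rho.

End HopfNotions.

(* The additive group Z^3, written multiplicatively.                          *)
Definition Z3 : groupType := Algebra.to_multiplicative 'rV[int]_3.

(* Main.v *)
(* A degree-preserving coaction is x_j |-> sum_i x_i (x) h_ij, where h is a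
   quantum matrix with matrix comultiplication.  Cocommutativity makes the dual
   act on the span of the x_i through commuting matrices, so a change of basis
   makes h triangular, with grouplike diagonal, and splits it into weight
   blocks; according to the number of distinct weights:
   - three: the relation space R of the algebra is stable under the maps that
     separate weights, which yields a cyclic diagonal automorphism or a sign
     change preserving R; automorphisms of R are diagonal, hence so is h;
   - two: the even part of R is stable in the same way, so the associated sign
     change is diagonal, and an element c with Delta c = g (x) c + c (x) g
     whose square is spanned by g c and c g vanishes in characteristic zero;
   - one: the quantum determinant is g^3 and commutes with h_ij up to the
     Nakayama twist, so the socle of the comodule is spanned by coordinate
     vectors or q^2 = -1.
   In all cases h is diagonal except for at most one entry h_mn, which is
   primitive up to a grouplike, and (m, n) determines the commutation rules
   defining B_q, C_q and their analogues for q^-1.  A group algebra has no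
   nonzero primitive element, so for a grading h is diagonal with commuting
   entries; homogeneous degrees then commute with these entries, hence with
   each other. *)
Require Import Defs.
From HB Require Import structures.
From mathcomp Require Import all_boot all_order all_algebra.
From mathcomp Require Import boolp ring fingroup perm.

Set Implicit Arguments.
Unset Strict Implicit.
Unset Printing Implicit Defensive.

Import GRing.Theory.
Local Open Scope ring_scope.

(** The triangular form of [h] exists only after a change of basis [U], with inverse [W], in which
    the relations lose their shape; the bulk of the proof carries the information back to the given
    variables. For this the relation space is kept as a space of 3 by 3 coefficient matrices: [inR]
    in the given variables, [inRU] in the new basis, with [act2] for the operators through which
    functionals on [H] act on it. Such functionals see only products of two weights, and two
    products may coincide by accident; this is the difficulty when the weights are distinct. With a
    single weight they separate nothing, and the missing rigidity comes from the commutation of the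
    quantum determinant with [h]. Characteristic zero enters only through the invertibility of 2 and
    3. *)

Section Contraction.
Variables (k : fieldType) (A B : lmodType k).

(** * Linear functionals and contractions of tensors *)

Lemma functional_eq0 (v : A) : (forall f : {linear A -> k^o}, f v = 0) -> v = 0.
Proof.
move=> h; apply/eqP; apply: contraT => /exists_functional [f [fl f1]].
pose F : {linear A -> k^o} := HB.pack f (GRing.isLinear.Build _ _ _ _ f fl).
by have := h F; rewrite /= f1 => /eqP; rewrite oner_eq0.
Qed.

Lemma functional_eq1 (v : A) : v != 0 -> exists f : {linear A -> k^o}, f v = 1.
Proof.
move=> /exists_functional [f [fl f1]].
by exists (HB.pack f (GRing.isLinear.Build _ _ _ _ f fl) : {linear A -> k^o}).
Qed.

Lemma functional_ext (u v : A) :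
  (forall f : {linear A -> k^o}, f u = f v) -> u = v.
Proof.
move=> h; apply/eqP; rewrite -subr_eq0; apply/eqP/functional_eq0 => f.
by rewrite linearB h /= subrr.
Qed.

Lemma tensDl (a a' : A) (b : B) : (a + a') ⊗ b = a ⊗ b + a' ⊗ b.
Proof. by have := tensZDl 1 a a' b; rewrite !scale1r. Qed.

Lemma tensDr (a : A) (b b' : B) : a ⊗ (b + b') = a ⊗ b + a ⊗ b'.
Proof. by have := tensZDr 1 a b b'; rewrite !scale1r. Qed.

Lemma tensZl c (a : A) (b : B) : (c *: a) ⊗ b = c *: (a ⊗ b).
Proof. exact: (bilinZl (tens_bilinear A B)). Qed.

Lemma tensZr c (a : A) (b : B) : a ⊗ (c *: b) = c *: (a ⊗ b).
Proof. exact: (bilinZr (tens_bilinear A B)). Qed.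

Lemma tens0l (b : B) : (0 : A) ⊗ b = 0.
Proof. by have := tensZl 0 0 b; rewrite !scale0r. Qed.

Lemma tens0r (a : A) : a ⊗ (0 : B) = 0.
Proof. by have := tensZr 0 a 0; rewrite !scale0r. Qed.

Lemma tensBl (a a' : A) (b : B) : (a - a') ⊗ b = a ⊗ b - a' ⊗ b.
Proof. by rewrite -scaleN1r tensDl tensZl scaleN1r. Qed.

Lemma tensBr (a : A) (b b' : B) : a ⊗ (b - b') = a ⊗ b - a ⊗ b'.
Proof. by rewrite -scaleN1r tensDr tensZr scaleN1r. Qed.

Lemma tens_suml I (r : seq I) (P : pred I) (F : I -> A) (b : B) :
  (\sum_(i <- r | P i) F i) ⊗ b = \sum_(i <- r | P i) F i ⊗ b.
Proof.
apply: (big_morph (fun a => a ⊗ b)) => [x y|]; [exact: tensDl|exact: tens0l].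
Qed.

Lemma tens_sumr I (r : seq I) (P : pred I) (a : A) (F : I -> B) :
  a ⊗ (\sum_(i <- r | P i) F i) = \sum_(i <- r | P i) a ⊗ F i.
Proof.
apply: (big_morph (fun b => a ⊗ b)) => [x y|]; [exact: tensDr|exact: tens0r].
Qed.

Lemma contractl_bilinear (f : {linear A -> k^o}) :
  bilinear_for *:%R *:%R (fun (a : A) (b : B) => (f a : k) *: b).
Proof.
apply: bilinearP => [b|a] c u v; first by rewrite linearP scalerDl scalerA.
by rewrite scalerDr !scalerA mulrC.
Qed.

Definition contractl (f : {linear A -> k^o}) : (A ⊗ B)%type -> B :=
  tlift (fun a b => (f a : k) *: b).

HB.instance Definition _ (f : {linear A -> k^o}) :=
  GRing.isLinear.Build k (A ⊗ B)%type B *:%R (contractl f)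
    (tlift_is_linear (contractl_bilinear f)).

Lemma contractl_tens f a b : contractl f (a ⊗ b) = (f a : k) *: b.
Proof. by rewrite /contractl tlift_tens //; apply: contractl_bilinear. Qed.

Lemma contractr_bilinear (f : {linear B -> k^o}) :
  bilinear_for *:%R *:%R (fun (a : A) (b : B) => (f b : k) *: a).
Proof.
apply: bilinearP => [b|a] c u v; last by rewrite linearP scalerDl scalerA.
by rewrite scalerDr !scalerA mulrC.
Qed.

Definition contractr (f : {linear B -> k^o}) : (A ⊗ B)%type -> A :=
  tlift (fun a b => (f b : k) *: a).

HB.instance Definition _ (f : {linear B -> k^o}) :=
  GRing.isLinear.Build k (A ⊗ B)%type A *:%R (contractr f)
    (tlift_is_linear (contractr_bilinear f)).

Lemma contractr_tens f a b : contractr f (a ⊗ b) = (f b : k) *: a.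
Proof. by rewrite /contractr tlift_tens //; apply: contractr_bilinear. Qed.

End Contraction.

Lemma tlift_sum (k : fieldType) (A B V : lmodType k) (f : A -> B -> V) I (r : seq I)
    (F : I -> A) (G : I -> B) : bilinear_for *:%R *:%R f ->
  tlift f (\sum_(i <- r) F i ⊗ G i) = \sum_(i <- r) f (F i) (G i).
Proof.
move=> fb; elim: r => [|i r IHr]; first by rewrite !big_nil; apply: (tlift_zero fb).
by rewrite !big_cons -IHr -(tlift_tens fb); apply: (tlift_add fb).
Qed.

Section Tswap.
Variables (k : fieldType) (A B : lmodType k).

Lemma tswap_bilinear :
  bilinear_for *:%R *:%R (fun (a : A) (b : B) => b ⊗ a).
Proof.
by apply: bilinearP => [b|a] c u v; rewrite ?tensZDl ?tensZDr.
Qed.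

HB.instance Definition _ :=
  GRing.isLinear.Build k (A ⊗ B)%type (B ⊗ A)%type *:%R (@tswap k A B)
    (tlift_is_linear tswap_bilinear).

Lemma tswap_tens (a : A) (b : B) : tswap (a ⊗ b) = b ⊗ a.
Proof. by rewrite /tswap tlift_tens //; apply: tswap_bilinear. Qed.

End Tswap.

(** * Grouplike elements and elements primitive up to a grouplike *)

Section Grouplike.
Variables (k : fieldType) (H : hopfAlgType k).
Implicit Types (g c x y : H) (f : {linear H -> k^o}).

Definition grouplike g := comul g = g ⊗ g /\ (counit g : k) = 1.

Lemma grouplike_neq0 g : grouplike g -> g != 0.
Proof.
by case=> _ eg; apply: contra_eq_neq eg => ->; rewrite linear0 eq_sym oner_eq0.
Qed.

Lemma grouplike1 : grouplike 1.
Proof. by split; rewrite rmorph1. Qed.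

Lemma grouplikeM g g' : grouplike g -> grouplike g' -> grouplike (g * g').
Proof.
move=> [d e] [d' e']; split; first by rewrite rmorphM /= d d' tensM.
by rewrite rmorphM /= e e'; exact: mulr1.
Qed.

Lemma grouplikeV g : grouplike g -> g * antipode g = 1 /\ antipode g * g = 1.
Proof.
move=> [d e]; split.
  have := antipoder g; rewrite d tlift_tens; last exact: Sr_bilinear.
  by rewrite e scale1r.
have := antipodel g; rewrite d tlift_tens; last exact: Sl_bilinear.
by rewrite e scale1r.
Qed.

Lemma grouplike_mulrI g : grouplike g -> injective ( *%R g).
Proof.
move=> /grouplikeV [_ Vg] x y /(congr1 ( *%R (antipode g))).
by rewrite !mulrA Vg !mul1r.
Qed.

Lemma grouplike_mulIr g : grouplike g -> injective ( *%R^~ g).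
Proof.
move=> /grouplikeV [gV _] x y /(congr1 ( *%R^~ (antipode g))).
by rewrite /= -!mulrA gV !mulr1.
Qed.

(** Linear independence of grouplikes, in dual form. On a grouplike, the convolution product of two
    functionals is the product of their values, so the functional is built as in Lagrange
    interpolation, one factor for each element of [s]. *)
Lemma grouplike_sep g (s : seq H) : grouplike g ->
  (forall e, e \in s -> grouplike e) -> g \notin s ->
  exists f, f g = 1 /\ forall e, e \in s -> f e = 0.
Proof.
move=> gg; elim: s => [|e s IHs] sg.
  move=> _; have [f f1] := functional_eq1 (grouplike_neq0 gg).
  by exists f.
rewrite inE negb_or => /andP [ge gs].
have [|f [fg fs]] := IHs _ gs; first by move=> x xs; apply: sg; rewrite inE xs orbT.
have [f0 f01] : exists f0 : {linear H -> k^o}, f0 (g - e) = 1.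
  by apply: functional_eq1; rewrite subr_eq0.
have ege : grouplike e by apply: sg; rewrite inE eqxx.
(* The counit is 1 on grouplikes, so [u] vanishes at [e] and equals [f0 (g - e) = 1] at [g]. *)
pose u x := f0 x - (f0 e : k) * (counit x : k).
have ul : linear (u : H -> k^o).
  move=> c x y.
  have e1 : f0 (c *: x + y) = c * f0 x + f0 y :> k by exact: linearP.
  have e2 : counit (c *: x + y) = c * counit x + counit y :> k by exact: linearP.
  by rewrite -[RHS]/(c * u x + u y) /u e1 e2; ring.
pose U : {linear H -> k^o} := HB.pack u (GRing.isLinear.Build _ _ _ _ u ul).
pose F : {linear H -> k^o} := (f \o contractl U \o comul)%FUN.
have FE x : grouplike x -> F x = (u x : k) * f x.
  by move=> [dx _]; rewrite /F /= dx contractl_tens linearZ.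
exists F; split.
  rewrite FE // fg mulr1 /u (proj2 gg) mulr1 -f01 linearB /=.
  by [].
move=> x; rewrite inE => /predU1P [->|xs].
  by rewrite FE // /u (proj2 ege) mulr1 subrr mul0r.
by rewrite FE ?fs ?mulr0 //; apply: sg; rewrite inE xs orbT.
Qed.

(** The corner of a triangular 2 by 2 comodule matrix with both diagonal entries equal to [g];
    dividing by [g] turns it into a primitive element. *)
Definition gprimitive g x := comul x = g ⊗ x + x ⊗ g.

(** The right-hand side is primitive relative to [g * g], while the coproduct of [c * c] has the
    extra cross terms [(g * c) ⊗ (c * g) + (c * g) ⊗ (g * c)]. These must cancel, which is
    impossible for nonzero [c] when 2 is invertible. *)
Lemma gprimitive_sq g c a b : (2%:R != 0 :> k) -> grouplike g ->
  gprimitive g c -> c * c = a *: (g * c) + b *: (c * g) -> c = 0.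
Proof.
move=> two gg pc ccE; have [dg _] := gg.
have dgc : comul (g * c) = (g * g) ⊗ (g * c) + (g * c) ⊗ (g * g).
  by rewrite rmorphM /= dg pc mulrDr !tensM.
have dcg : comul (c * g) = (g * g) ⊗ (c * g) + (c * g) ⊗ (g * g).
  by rewrite rmorphM /= dg pc mulrDl !tensM.
have e0 : (g * c) ⊗ (c * g) + (c * g) ⊗ (g * c) = 0.
  have : comul (c * c) = (g * g) ⊗ (c * c) + (g * c) ⊗ (c * g) +
      ((c * g) ⊗ (g * c) + (c * c) ⊗ (g * g)).
    by rewrite rmorphM /= pc mulrDl !mulrDr !tensM.
  have -> : comul (c * c) = (g * g) ⊗ (c * c) + (c * c) ⊗ (g * g).
    rewrite ccE linearD !linearZ /= dgc dcg tensDr tensDl !tensZl !tensZr.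
    by rewrite !scalerDr addrACA.
  rewrite -!addrA => /addrI; rewrite !addrA.
  by rewrite -[X in X = _]add0r => /addIr.
have cg0 : c * g = 0.
  apply/eqP; apply: contraT => cgN0; have [f f1] := functional_eq1 cgN0.
  (* With [f (c * g) = 1], contracting on the right and applying [f] once more gives
     [f (g * c) = 0]; contracting on the left then leaves [g * c = 0]. *)
  have := congr1 (contractr f) e0; rewrite linearD /= !contractr_tens f1 linear0.
  rewrite scale1r => /(congr1 f); rewrite linearD linearZ /= f1 linear0.
  rewrite -[_ *: 1]/(_ * 1) mulr1 => /eqP; rewrite -mulr2n -mulr_natr mulf_eq0.
  rewrite (negbTE two) orbF => /eqP fgc.
  have := congr1 (contractl f) e0; rewrite linearD /= !contractl_tens f1 linear0.
  rewrite fgc scale0r add0r scale1r => gc0.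
  have c0 : c = 0 by apply: (grouplike_mulrI gg); rewrite gc0 mulr0.
  by move: cgN0; rewrite c0 mul0r eqxx.
by apply: (grouplike_mulIr gg); rewrite /= cg0 mul0r.
Qed.

(** The coproduct equals its own flip, that is [(g1 - g2) ⊗ c = c ⊗ (g1 - g2)], and vectors that
    commute under the tensor sign are proportional. *)
Lemma skew_primitive g1 g2 c : cocommutative H -> g1 != g2 ->
  comul c = g1 ⊗ c + c ⊗ g2 -> exists a, c = a *: (g1 - g2).
Proof.
move=> coc ne dc; have [|f f1] := @functional_eq1 _ _ (g1 - g2).
  by rewrite subr_eq0.
have := coc c; rewrite dc linearD /= !tswap_tens => e.
have /(congr1 (contractl f)) : (g1 - g2) ⊗ c = c ⊗ (g1 - g2).
  rewrite tensBl tensBr; apply/eqP; rewrite subr_eq addrAC.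
  by rewrite e addrK.
by rewrite !contractl_tens f1 scale1r => ->; exists (f c).
Qed.

End Grouplike.

(** * Matrices over an algebra and matrix comultiplication *)

Section TensorUnits.
Variables (k : fieldType) (A : algType k).

Definition tinl (a : A) : (A ⊗ A)%type := a ⊗ 1.
Definition tinr (a : A) : (A ⊗ A)%type := 1 ⊗ a.

Lemma tinl_linear : linear tinl. Proof. by move=> c a b; apply: tensZDl. Qed.
Lemma tinr_linear : linear tinr. Proof. by move=> c a b; apply: tensZDr. Qed.

HB.instance Definition _ := GRing.isLinear.Build k A (A ⊗ A)%type *:%R
  tinl tinl_linear.
HB.instance Definition _ := GRing.isLinear.Build k A (A ⊗ A)%type *:%R
  tinr tinr_linear.

Lemma tinl_monoid : monoid_morphism tinl.
Proof. by split=> // a b; rewrite /tinl tensM mulr1. Qed.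
Lemma tinr_monoid : monoid_morphism tinr.
Proof. by split=> // a b; rewrite /tinr tensM mulr1. Qed.

HB.instance Definition _ := GRing.isMonoidMorphism.Build A (A ⊗ A)%type
  tinl tinl_monoid.
HB.instance Definition _ := GRing.isMonoidMorphism.Build A (A ⊗ A)%type
  tinr tinr_monoid.

End TensorUnits.

Section AlgMx.
Variables (k : fieldType) (A : algType k).

Definition algmx m n (M : 'M[k]_(m, n)) : 'M[A]_(m, n) := map_mx (in_alg A) M.

Lemma algmxM m n p (M : 'M_(m, n)) (N : 'M_(n, p)) :
  algmx (M *m N) = algmx M *m algmx N.
Proof. exact: map_mxM. Qed.

Lemma algmx1 n : algmx (1%:M : 'M_n) = 1%:M.
Proof. exact: map_mx1. Qed.

Lemma algmxE m n (M : 'M_(m, n)) i j : algmx M i j = (M i j)%:A.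
Proof. by rewrite mxE. Qed.

Lemma algmxr m n p (h : 'M[A]_(m, n)) (N : 'M_(n, p)) i j :
  (h *m algmx N) i j = \sum_l N l j *: h i l.
Proof. by rewrite mxE; apply: eq_bigr => l _; rewrite algmxE -scalerAr mulr1. Qed.

Lemma algmxl m n p (M : 'M_(m, n)) (h : 'M[A]_(n, p)) i j :
  (algmx M *m h) i j = \sum_l M i l *: h l j.
Proof. by rewrite mxE; apply: eq_bigr => l _; rewrite algmxE -scalerAl mul1r. Qed.

Lemma map_algmx (B : algType k) (f : {lrmorphism A -> B}) m n (M : 'M[k]_(m, n)) :
  map_mx f (algmx M) = map_mx (in_alg B) M.
Proof. by apply/matrixP => i j; rewrite !mxE linearZ /= rmorph1. Qed.

End AlgMx.

Section MatrixCoalgebra.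
Variables (k : fieldType) (H : hopfAlgType k).

Definition fmx m n (f : {linear H -> k^o}) (h : 'M[H]_(m, n)) : 'M[k]_(m, n) :=
  \matrix_(i, j) (f (h i j) : k).

Definition mcoalg n (h : 'M[H]_n) := forall i j,
  comul (h i j) = \sum_l h i l ⊗ h l j /\ (counit (h i j) : k) = (i == j)%:R.

(** Writing the sum of tensors as one matrix product over [H ⊗ H] reduces base change to
    associativity of matrix multiplication. *)
Lemma mcoalg_mx n (h : 'M[H]_n) : mcoalg h <->
  map_mx (comul : H -> (H ⊗ H)%type) h = map_mx (@tinl _ H) h *m map_mx (@tinr _ H) h /\
  map_mx (counit : H -> k^o) h = 1%:M.
Proof.
have E i j : (map_mx (@tinl _ H) h *m map_mx (@tinr _ H) h) i j =
    \sum_l h i l ⊗ h l j.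
  rewrite mxE; apply: eq_bigr => l _.
  by rewrite !mxE tensM mulr1 mul1r.
split=> [hc|[e1 e2] i j].
  split; apply/matrixP => i j; have [e1 e2] := hc i j.
    by rewrite E mxE e1.
  by rewrite !mxE e2.
split; first by rewrite -E -e1 mxE.
by have /matrixP /(_ i j) := e2; rewrite !mxE.
Qed.

Lemma mcoalg_conj n (h : 'M[H]_n) (U W : 'M[k]_n) :
  W *m U = 1%:M -> mcoalg h -> mcoalg (algmx H W *m h *m algmx H U).
Proof.
move=> WU; have UW : U *m W = 1%:M by apply: mulmx1C.
move=> /mcoalg_mx [e1 e2]; apply/mcoalg_mx; split.
  rewrite !map_mxM e1 !map_algmx.
  have iUW : map_mx (in_alg (H ⊗ H)%type) U *m map_mx (in_alg _) W = 1%:M.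
    by rewrite -map_mxM UW map_mx1.
  by rewrite !mulmxA -[_ *m map_mx _ U *m map_mx _ W]mulmxA iUW mulmx1.
by rewrite !map_mxM e2 !map_algmx mulmx1 -map_mxM WU map_mx1.
Qed.

End MatrixCoalgebra.

(** * Simultaneous triangularization *)

Section CommonEigenvector.
Variables (k : closedFieldType) (T : Type) (n : nat) (F : T -> 'M[k]_n).
Hypothesis Fcomm : forall s t, F s *m F t = F t *m F s.

Lemma eigenvalue_closed_field m (C : 'M[k]_m) : (0 < m)%N ->
  exists a, eigenvalue C a.
Proof.
move=> m0; have [|a ra] := @closed_rootP k (char_poly C) _.
  by rewrite size_char_poly; case: m m0 C.
by exists a; rewrite eigenvalue_root_char.
Qed.

(** The family is indexed by an arbitrary type, so the induction is on the rank of a common stable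
    subspace [V]. Either every [F t] is scalar on [V] and any nonzero row will do, or some [F t] is
    not, and one of its eigenspaces meets [V] in a smaller nonzero subspace, stable because the
    family commutes. *)
Lemma common_eigenvector_sub r m (V : 'M[k]_(m, n)) : (\rank V <= r)%N -> V != 0 ->
  (forall t, stablemx V (F t)) ->
  exists2 v : 'rV_n, v != 0 & forall t, exists a, v *m F t = a *: v.
Proof.
elim: r m V => [|r IHr] m V.
  by rewrite leqn0 mxrank_eq0 => ->.
move=> rV V0 stV.
have [sc|] := pselect (forall t, exists a, V *m F t = a *: V).
  exists (nz_row V); first by rewrite nz_row_eq0.
  move=> t; have [a Va] := sc t; exists a.
  have /submxP [D ->] := nz_row_sub V.
  by rewrite -mulmxA Va scalemxAr.
move=> /existsNP [t nsc].
pose B := row_base V.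
have Bfree : row_free B by apply: row_base_free.
have BC : B *m F t = (B *m F t *m pinvmx B) *m B.
  by rewrite mulmxKpV // stablemx_row_base.
set C := _ *m pinvmx B in BC.
have [a /eigenvalueP [y yC y0]] : exists a, eigenvalue C a.
  by apply: eigenvalue_closed_field; rewrite lt0n mxrank_eq0.
pose V' := (V :&: eigenspace (F t) a)%MS.
have yB : (y *m B <= V')%MS.
  rewrite sub_capmx; apply/andP; split.
    by apply: mulmx_sub; rewrite eq_row_base.
  by apply/eigenspaceP; rewrite -mulmxA BC mulmxA yC scalemxAl.
have yB0 : y *m B != 0.
  by apply: contra_neq y0 => yB0; apply: (row_free_inj Bfree); rewrite yB0 mul0mx.
apply: (IHr _ V').
- rewrite -ltnS; apply: leq_trans rV; rewrite ltn_neqAle mxrankS ?capmxSl // andbT.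
  apply: contra_notN nsc => /eqP rk; exists a; apply/eigenspaceP.
  have [_] := mxrank_leqif_eq (capmxSl V (eigenspace (F t) a)).
  rewrite rk eqxx => /esym /andP [_ le].
  by apply: submx_trans le _; apply: capmxSr.
- by apply: contra_neq yB0 => V'0; apply/eqP; rewrite -submx0 -V'0.
move=> s; apply: submx_trans (capmxMr _ _ _) _; rewrite sub_capmx.
apply/andP; split; first by apply: submx_trans (capmxSl _ _) (stV s).
apply: submx_trans (capmxSr _ _) _.
by apply: comm_mx_stable_eigenspace; apply: Fcomm.
Qed.

Lemma common_eigenvector_closed_field : (0 < n)%N ->
  exists2 v : 'rV_n, v != 0 & forall t, exists a, v *m F t = a *: v.
Proof.
move=> n0; apply: (@common_eigenvector_sub n n 1%:M).
- exact: rank_leq_row.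
- by case: n n0 => // p _; apply: oner_neq0.
- by move=> t; apply: submx1.
Qed.

End CommonEigenvector.

(** Since [v^T] has rank 1, its rank decomposition exhibits it as a multiple of the first row of the
    invertible matrix [row_ebase v^T]. *)
Lemma extend_col (k : fieldType) n (v : 'cV[k]_n.+1) : v != 0 ->
  exists U W : 'M[k]_n.+1, [/\ U *m W = 1%:M, W *m U = 1%:M & col 0 U = v].
Proof.
move=> v0; have vT0 : v^T != 0 by rewrite trmx_eq0.
have rk1 : \rank v^T = 1 by apply/eqP; rewrite eqn_leq rank_leq_row lt0n mxrank_eq0.
pose R := row_ebase v^T; pose c := col_ebase v^T 0 0.
have vE : v^T = c *: row 0 R.
  rewrite -[LHS]mulmx_ebase rk1 -/R; apply/rowP => j; rewrite !mxE (bigD1 0) //=.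
  rewrite big1 => [|i /negbTE i0]; rewrite !mxE big_ord1 !mxE.
    by rewrite eqxx mulr1 addr0.
  have -> : (0%N == i :> nat) = false by rewrite eq_sym -i0.
  by rewrite mulr0 mul0r.
have c0 : c != 0 by apply: contra_neq vT0 => c0; rewrite vE c0 scale0r.
have RU : (c *: R)^T \in unitmx.
  by rewrite unitmx_tr unitmxZ ?unitfE // row_ebase_unit.
exists (c *: R)^T, (invmx (c *: R)^T); split; first exact: mulmxV.
  exact: mulVmx.
apply/colP => i; have /rowP /(_ i) := vE; rewrite !mxE => ->.
by [].
Qed.

Section Comodule.
Variables (k : closedFieldType) (H : hopfAlgType k).
Hypothesis coc : cocommutative H.

Definition coeigen n (h : 'M[H]_n) (v : 'cV[k]_n) (g : H) : Prop :=
  forall i, \sum_j v j 0 *: h i j = v i 0 *: g.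

(** The product is the matrix of the convolution of [f] and [f'], and convolution is commutative
    when [H] is cocommutative. *)
Lemma fmx_comm n (h : 'M[H]_n) (f f' : {linear H -> k^o}) : mcoalg h ->
  fmx f h *m fmx f' h = fmx f' h *m fmx f h.
Proof.
move=> hc; apply/matrixP => i j; rewrite !mxE.
have [d _] := hc i j.
have e1 := congr1 (contractl f) d; have e2 := congr1 (contractr f) d.
have e3 : contractl f (comul (h i j)) = contractr f (comul (h i j)).
  rewrite -{1}coc; move: (comul (h i j)).
  apply: tensor_ext => [c x y|c x y|a b]; rewrite ?linearP //.
  by rewrite tswap_tens contractl_tens contractr_tens.
move: e1 e2; rewrite e3 => ->; rewrite !linear_sum /= => /(congr1 f').
rewrite !linear_sum /=.
under eq_bigr => l _ do rewrite contractl_tens linearZ /=.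
under [in RHS]eq_bigr => l _ do rewrite contractr_tens linearZ /=.
under [X in X = _ -> _]eq_bigr => l _ do rewrite -[_ *: _]/(_ * _).
under [X in _ = X -> _]eq_bigr => l _ do rewrite -[_ *: _]/(_ * _).
move=> e; transitivity (\sum_l f (h i l) * f' (h l j) : k).
  by apply: eq_bigr => l _; rewrite !mxE.
by rewrite e; apply: eq_bigr => l _; rewrite !mxE mulrC.
Qed.

Lemma exists_coeigen n (h : 'M[H]_n) : (0 < n)%N -> mcoalg h ->
  exists v g, v != 0 /\ coeigen h v g.
Proof.
move=> n0 hc.
have [|v v0 hv] := @common_eigenvector_closed_field k {linear H -> k^o} n
  (fun f => (fmx f h)^T) _ n0.
  by move=> f f'; rewrite -!trmx_mul fmx_comm.
have [i vi] : exists i, v 0 i != 0.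
  apply: contrapT => /forallNP ni; move: v0; apply/negP; rewrite negbK.
  by apply/eqP/rowP => i; rewrite !mxE; apply/eqP; have /negP := ni i; rewrite negbK.
(* The eigenvalues for all functionals are packed into one element: the eigenvalue for [f] is the
   value of [f] at this [g]. *)
exists v^T, ((v 0 i)^-1 *: \sum_j v 0 j *: h i j); split.
  by rewrite trmx_eq0.
have E f a j : v *m (fmx f h)^T = a *: v ->
    f (\sum_l v 0 l *: h j l) = a * v 0 j :> k.
  move=> /rowP /(_ j); rewrite !mxE => <-; rewrite linear_sum.
  by apply: eq_bigr => l _; rewrite linearZ !mxE.
move=> j; apply: functional_ext => f; have [a va] := hv f.
rewrite !mxE !linearZ /= (E _ _ _ va).
under eq_bigr => l _ do rewrite mxE.
rewrite (E _ _ _ va) -![_ *: (_ : k^o)]/(_ * _) mulrCA mulrA [_^-1 * _]mulrC.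
by rewrite mulrCA mulfVK // mulrC.
Qed.

(** Once an eigenvector is split off, the first column is zero below the corner, so the lower right
    block is again a matrix coalgebra. *)
Lemma upper_triangular n (h : 'M[H]_n) : mcoalg h ->
  exists U W : 'M[k]_n, [/\ U *m W = 1%:M, W *m U = 1%:M &
    forall i j : 'I_n, (j < i)%N -> (algmx H W *m h *m algmx H U) i j = 0].
Proof.
elim: n h => [|n IHn] h hc.
  by exists 0, 0; split=> [||[]//]; apply/matrixP => -[].
have [v [g [v0 hv]]] := exists_coeigen (ltn0Sn n) hc.
have [U1 [W1 [UW1 WU1 cU1]]] := extend_col v0.
pose h1 : 'M[H]_(1 + n) := algmx H W1 *m h *m algmx H U1.
have h1c : mcoalg h1 by apply: mcoalg_conj.
have h10 i : h1 i 0 = (i == 0)%:R *: g.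
  rewrite /h1 -mulmxA algmxl.
  have -> : (i == 0)%:R = (W1 *m U1) i 0 by rewrite WU1 mxE.
  rewrite mxE scaler_suml; apply: eq_bigr => l _; rewrite algmxr -scalerA.
  have cE p : U1 p 0 = v p 0 by rewrite -cU1 mxE.
  by congr (_ *: _); under eq_bigr => j _ do rewrite cE; rewrite hv cE.
have dl a : h1 (rshift 1 a) (lshift n 0) = 0.
  have -> : lshift n 0 = 0 :> 'I_(1 + n) by apply/val_inj.
  by rewrite h10 scale0r.
have dl0 : dlsubmx h1 = 0.
  apply/matrixP => i j; rewrite ord1 [LHS]mxE [LHS]mxE [RHS]mxE.
  by rewrite dl.
have dr a b : drsubmx h1 a b = h1 (rshift 1 a) (rshift 1 b).
  by rewrite [LHS]mxE [LHS]mxE.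
have [|U2 [W2 [UW2 WU2 tri]]] := IHn (drsubmx h1).
  move=> i j; have [d e] := h1c (rshift 1 i) (rshift 1 j).
  rewrite dr d e; split; last by rewrite eq_rshift.
  rewrite big_split_ord /= big_ord1 dl tens0l add0r.
  by apply: eq_bigr => l _; rewrite !dr.
pose L (A : 'M[k]_n) : 'M_(1 + n) := block_mx 1%:M 0 0 A.
have LM A B : A *m B = 1%:M -> L A *m L B = 1%:M.
  move=> AB; rewrite mulmx_block !mulmx0 !mul0mx !addr0 !add0r mulmx1 AB.
  by rewrite -scalar_mx_block.
exists ((U1 : 'M_(1 + n)) *m L U2), (L W2 *m (W1 : 'M_(1 + n))); split.
- by rewrite -mulmxA [L U2 *m _]mulmxA LM // mul1mx.
- by rewrite -mulmxA [W1 *m _]mulmxA WU1 mul1mx LM.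
have aL A : algmx H (L A) = block_mx 1%:M 0 0 (algmx H A) :> 'M_(1 + n).
  by rewrite /algmx /L map_block_mx map_mx1 !map_mx0.
rewrite !algmxM !mulmxA -[_ *m h]mulmxA -[_ *m algmx H U1]mulmxA -/h1.
suff: forall i j : 'I_(1 + n), (j < i)%N ->
    (algmx H (L W2) *m h1 *m algmx H (L U2)) i j = 0 by [].
rewrite !aL -[h1]submxK dl0 !mulmx_block !mulmx0 !mul0mx !mulmx1 !mul1mx.
rewrite ?mulmx0 ?mul0mx !addr0 ?add0r => i j ji.
case: (split_ordP i) ji => i' ->.
  by rewrite ord1.
case: (split_ordP j) => j' -> /=.
  by rewrite block_mxEdl mxE.
by rewrite ltn_add2l block_mxEdr; apply: tri.
Qed.

End Comodule.

Definition o0 : 'I_3 := @Ordinal 3 0 isT.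
Definition o1 : 'I_3 := @Ordinal 3 1 isT.
Definition o2 : 'I_3 := @Ordinal 3 2 isT.

Lemma ord3P (P : 'I_3 -> Prop) : P o0 -> P o1 -> P o2 -> forall i, P i.
Proof.
move=> p0 p1 p2 [[|[|[|//]]] lt_i].
- by rewrite (_ : Ordinal _ = o0) //; apply/val_inj.
- by rewrite (_ : Ordinal _ = o1) //; apply/val_inj.
- by rewrite (_ : Ordinal _ = o2) //; apply/val_inj.
Qed.

Lemma sum3 (V : nmodType) (F : 'I_3 -> V) : \sum_i F i = F o0 + F o1 + F o2.
Proof.
rewrite !big_ord_recr big_ord0 /= add0r.
by congr (F _ + F _ + F _); apply/val_inj.
Qed.

(** * Weight blocks and normal forms of the comodule matrix *)

Section NormalForm.
Variables (k : closedFieldType) (H : hopfAlgType k).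
Hypothesis coc : cocommutative H.
Implicit Types h : 'M[H]_3.

Lemma elementary_conj h i j (c : k) p q :
  (algmx H (1%:M - c *: delta_mx i j) *m h *m algmx H (1%:M + c *: delta_mx i j)) p q =
  h p q + (c * (q == j)%:R) *: h p i - (c * (p == i)%:R) *: h j q
  - (c * c * (p == i)%:R * (q == j)%:R) *: h j i.
Proof.
have L (x : 'M[H]_3) p' q' : (algmx H (1%:M - c *: delta_mx i j) *m x) p' q' =
    x p' q' - (c * (p' == i)%:R) *: x j q'.
  rewrite algmxl; under eq_bigr => l _ do rewrite !mxE scalerBl.
  rewrite sumrB (bigD1 p') //= eqxx scale1r big1 ?addr0; last first.
    by move=> l /negbTE lp; rewrite eq_sym lp scale0r.
  rewrite (bigD1 j) //= eqxx andbT big1 ?addr0 //.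
  by move=> l /negbTE ->; rewrite andbF mulr0 scale0r.
have R (x : 'M[H]_3) : (x *m algmx H (1%:M + c *: delta_mx i j)) p q =
    x p q + (c * (q == j)%:R) *: x p i.
  rewrite algmxr; under eq_bigr => l _ do rewrite !mxE scalerDl.
  rewrite big_split (bigD1 q) //= eqxx scale1r big1 ?addr0; last first.
    by move=> l /negbTE ->; rewrite scale0r.
  rewrite (bigD1 i) //= eqxx /= big1 ?addr0 //.
  by move=> l /negbTE ->; rewrite mulr0 scale0r.
rewrite R !L scalerBr scalerA addrACA -!addrA.
by do 3!congr (_ + _); congr (- (_ *: _)); ring.
Qed.

Lemma elementary_inv i j (c : k) : i != j ->
  (1%:M - c *: delta_mx i j) *m (1%:M + c *: delta_mx i j) = 1%:M :> 'M_3 /\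
  (1%:M + c *: delta_mx i j) *m (1%:M - c *: delta_mx i j) = 1%:M :> 'M_3.
Proof.
move=> ij; have sq : delta_mx i j *m delta_mx i j = 0 :> 'M[k]_3.
  by rewrite mul_delta_mx_0 // eq_sym.
split; rewrite ?mulmxBl ?mulmxDl ?mulmxBr ?mulmxDr !mul1mx !mulmx1.
  by rewrite -scalemxAl -scalemxAr sq !scaler0 addr0 addrK.
by rewrite -scalemxAl -scalemxAr sq !scaler0 subr0 subrK.
Qed.

(** Between distinct diagonal entries, [h i j] is a multiple of their difference by
    [skew_primitive], and an elementary conjugation clears it. This affects only entries weakly
    above and to the right of (i, j), so entries cleared earlier can be kept zero. *)
Lemma kill_entry h (i j : 'I_3) : mcoalg h -> (i < j)%N ->
  (forall p q : 'I_3, (q < p)%N -> h p q = 0) ->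
  comul (h i j) = h i i ⊗ h i j + h i j ⊗ h j j ->
  exists U W : 'M[k]_3, [/\ U *m W = 1%:M, W *m U = 1%:M,
    forall p q : 'I_3, ~~ ((p <= i)%N && (j <= q)%N) ->
      (algmx H W *m h *m algmx H U) p q = h p q &
    (algmx H W *m h *m algmx H U) i j != 0 -> h i i = h j j].
Proof.
move=> hc lt_ij up dij; have ij : i != j by rewrite -val_eqE neq_ltn lt_ij.
have [e|ne] := eqVneq (h i i) (h j j).
  by exists 1%:M, 1%:M; split=> *; rewrite ?algmx1 ?mul1mx ?mulmx1.
have [a hE] := skew_primitive coc ne dij.
have [e1 e2] := elementary_inv (- a) ij.
exists (1%:M + - a *: delta_mx i j), (1%:M - - a *: delta_mx i j); split=> //.
  move=> p q; rewrite negb_and -!ltnNge => npq; rewrite elementary_conj.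
  have -> : h j i = 0 by apply: up.
  have -> : (- a * (q == j)%:R) *: h p i = 0.
    have [qj|] := eqVneq q j; last by rewrite mulr0 scale0r.
    by move: npq; rewrite qj ltnn orbF => /up ->; rewrite scaler0.
  have -> : (- a * (p == i)%:R) *: h j q = 0.
    have [pi|] := eqVneq p i; last by rewrite mulr0 scale0r.
    by move: npq; rewrite pi ltnn => /up ->; rewrite scaler0.
  by rewrite !scaler0 addr0 !subr0.
rewrite elementary_conj !eqxx !mulr1 (up j i lt_ij) scaler0 subr0.
by rewrite {1}hE -addrA -scalerBr -scalerDl subrr scale0r eqxx.
Qed.

Lemma conj_conj h (U1 W1 U2 W2 : 'M[k]_3) :
  algmx H (W2 *m W1) *m h *m algmx H (U1 *m U2) =
  algmx H W2 *m (algmx H W1 *m h *m algmx H U1) *m algmx H U2.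
Proof. by rewrite !algmxM !mulmxA. Qed.

Lemma conj_inv (U1 W1 U2 W2 : 'M[k]_3) : U1 *m W1 = 1%:M -> W1 *m U1 = 1%:M ->
  U2 *m W2 = 1%:M -> W2 *m U2 = 1%:M ->
  (U1 *m U2) *m (W2 *m W1) = 1%:M /\ (W2 *m W1) *m (U1 *m U2) = 1%:M.
Proof.
move=> a b c d; rewrite !mulmxA -[U1 *m U2 *m W2]mulmxA c mulmx1 a.
by rewrite -[W2 *m W1 *m U1]mulmxA b mulmx1 d.
Qed.

Lemma weight_triangular h : mcoalg h ->
  exists U W : 'M[k]_3, let h' := algmx H W *m h *m algmx H U in
  [/\ U *m W = 1%:M, W *m U = 1%:M,
    forall p q : 'I_3, (q < p)%N -> h' p q = 0 &
    forall p q : 'I_3, h' p q != 0 -> h' p p = h' q q].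
Proof.
move=> hc; have [U0 [W0 [UW0 WU0 up0]]] := upper_triangular coc hc.
have hc0 := mcoalg_conj WU0 hc; set h0 := (algmx H W0 *m h *m _) in up0 hc0.
have step h1 (i j : 'I_3) : mcoalg h1 -> (i < j)%N ->
  (forall p q : 'I_3, (q < p)%N -> h1 p q = 0) ->
  (forall l : 'I_3, (i < l < j)%N -> h1 i l ⊗ h1 l j = 0) ->
  comul (h1 i j) = h1 i i ⊗ h1 i j + h1 i j ⊗ h1 j j.
  move=> hc1 ij up mid; rewrite (proj1 (hc1 i j)) (bigD1 i) //= (bigD1 j) /=; last first.
    by rewrite -val_eqE neq_ltn ij orbT.
  rewrite big1 ?addr0 // => l /andP [li lj].
  have [il|] := ltnP i l; last first.
    by rewrite leq_eqVlt val_eqE (negbTE li) /= => /up ->; rewrite tens0l.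
  have [jl|] := ltnP j l; first by rewrite (up _ _ jl) tens0r.
  by rewrite leq_eqVlt val_eqE (negbTE lj) /= => lj'; apply: mid; rewrite il.
have upk h1 h2 (i j : 'I_3) : (forall p q : 'I_3, (q < p)%N -> h1 p q = 0) ->
  (i < j)%N ->
  (forall p q : 'I_3, ~~ ((p <= i)%N && (j <= q)%N) -> h2 p q = h1 p q) ->
  forall p q : 'I_3, (q < p)%N -> h2 p q = 0.
  move=> up ij e p q qp; rewrite e ?up // negb_and -!ltnNge.
  have [//|pi] := ltnP i p; apply: ltn_trans (leq_trans qp pi) ij.
have d01 : comul (h0 o0 o1) = h0 o0 o0 ⊗ h0 o0 o1 + h0 o0 o1 ⊗ h0 o1 o1.
  by apply: step => // -[[|[|[]]]].
have [U1 [W1 [UW1 WU1 e1 n1]]] := kill_entry (i := o0) (j := o1) hc0 isT up0 d01.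
have hc1 := mcoalg_conj WU1 hc0; have up1 := upk _ _ o0 o1 up0 isT e1.
set h1 := (algmx H W1 *m h0 *m _) in e1 n1 hc1 up1.
have d12 : comul (h1 o1 o2) = h1 o1 o1 ⊗ h1 o1 o2 + h1 o1 o2 ⊗ h1 o2 o2.
  by apply: step => // -[[|[|[]]]].
have [U2 [W2 [UW2 WU2 e2 n2]]] := kill_entry (i := o1) (j := o2) hc1 isT up1 d12.
have hc2 := mcoalg_conj WU2 hc1; have up2 := upk _ _ o1 o2 up1 isT e2.
set h2 := (algmx H W2 *m h1 *m _) in e2 n2 hc2 up2.
have dg2 p : h2 p p = h0 p p by move: p; apply: ord3P; rewrite e2 // e1.
have E01 : h2 o0 o1 != 0 -> h2 o0 o0 = h2 o1 o1.
  by rewrite e2 // => /n1; rewrite -!dg2.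
have E12 : h2 o1 o2 != 0 -> h2 o1 o1 = h2 o2 o2.
  by move=> /n2; rewrite !e1 // -!dg2.
(* The corner comes last: if its two weights differ, [h2 o0 o1] and [h2 o1 o2] cannot both be
   nonzero, so the middle term of its coproduct is absent. *)
have [U [W [UW WU e n]]] : exists U W : 'M[k]_3, [/\ U *m W = 1%:M, W *m U = 1%:M,
    forall p q : 'I_3, ~~ ((p <= o0)%N && (o2 <= q)%N) ->
      (algmx H W *m h2 *m algmx H U) p q = h2 p q &
    (algmx H W *m h2 *m algmx H U) o0 o2 != 0 -> h2 o0 o0 = h2 o2 o2].
  have [e|ne] := eqVneq (h2 o0 o0) (h2 o2 o2).
    by exists 1%:M, 1%:M; split=> *; rewrite ?algmx1 ?mul1mx ?mulmx1.
  apply: kill_entry => //; apply: step => // l.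
  case: (eqVneq (h2 o0 o1) 0) => [e|/E01 e01].
    by move: l; apply: ord3P => //= _; rewrite e tens0l.
  case: (eqVneq (h2 o1 o2) 0) => [e|/E12 e12].
    by move: l; apply: ord3P => //= _; rewrite e tens0r.
  by move: ne; rewrite e01 e12 eqxx.
have [UW01 WU01] := conj_inv UW0 WU0 UW1 WU1.
have [UW012 WU012] := conj_inv UW01 WU01 UW2 WU2.
have [UWf WUf] := conj_inv UW012 WU012 UW WU.
exists (U0 *m U1 *m U2 *m U), (W *m (W2 *m (W1 *m W0))).
rewrite !conj_conj -/h0 -/h1 -/h2; split=> //; first exact: upk _ _ o0 o2 up2 isT e.
have up3 := upk _ _ o0 o2 up2 isT e.
set h3 := (algmx H W *m h2 *m _) in e n up3 *.
have dg p : h3 p p = h2 p p by move: p; apply: ord3P; rewrite e.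
apply: ord3P; apply: ord3P; rewrite ?dg //.
- by rewrite e.
- by rewrite up3 ?eqxx.
- by rewrite e.
- by rewrite up3 ?eqxx.
- by rewrite up3 ?eqxx.
Qed.

Lemma perm_conj h (s : 'S_3) p q :
  (algmx H (perm_mx s) *m h *m algmx H (perm_mx s^-1)) p q = h (s p) (s q).
Proof.
rewrite /algmx !map_perm_mx -col_permE -row_permE mxE mxE.
by [].
Qed.

Lemma normal_forms h : mcoalg h ->
  exists U W : 'M[k]_3, let h' := algmx H W *m h *m algmx H U in
  [/\ U *m W = 1%:M, W *m U = 1%:M &
  [\/ (forall p q : 'I_3, p != q -> h' p q = 0 /\ h' p p != h' q q),
      [/\ h' o0 o0 = h' o1 o1, h' o1 o1 != h' o2 o2 &
          forall p q, p != q -> (p, q) != (o0, o1) -> h' p q = 0] |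
      (forall p q : 'I_3, (q < p)%N -> h' p q = 0) /\
      (forall p q : 'I_3, h' p p = h' q q)]].
Proof.
move=> hc; have [U [W]] := weight_triangular hc.
set h' := (algmx H W *m h *m _) => -[UW WU up wt].
have wt0 p q : h' p p != h' q q -> h' p q = 0 /\ h' q p = 0.
  move=> ne; split; apply/eqP; apply: contraTT ne => /wt ->; by rewrite eqxx.
have perm (s : 'S_3) : h' (s o0) (s o0) = h' (s o1) (s o1) ->
    h' (s o1) (s o1) != h' (s o2) (s o2) -> h' (s o1) (s o0) = 0 ->
    exists U W : 'M[k]_3, let h' := algmx H W *m h *m algmx H U in
    [/\ U *m W = 1%:M, W *m U = 1%:M &
      [/\ h' o0 o0 = h' o1 o1, h' o1 o1 != h' o2 o2 &
          forall p q, p != q -> (p, q) != (o0, o1) -> h' p q = 0]].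
  move=> e ne z; have [z1 z2] := wt0 _ _ ne.
  have [z3 z4] : h' (s o0) (s o2) = 0 /\ h' (s o2) (s o0) = 0 by apply: wt0; rewrite e.
  have ss : perm_mx s *m perm_mx s^-1 = 1%:M :> 'M[k]_3.
    by rewrite -perm_mxM mulgV perm_mx1.
  have [e1 e2] := conj_inv UW WU (mulmx1C ss) ss.
  exists (U *m perm_mx s^-1), (perm_mx s *m W); rewrite conj_conj -/h'.
  split=> //; split; rewrite ?perm_conj //.
  by apply: ord3P; apply: ord3P; rewrite ?eqxx // => *; rewrite perm_conj.
have [e01|n01] := eqVneq (h' o0 o0) (h' o1 o1); have [e12|n12] := eqVneq (h' o1 o1) (h' o2 o2).
- exists U, W; split=> //; apply: Or33; split=> //.
  by apply: ord3P; apply: ord3P; rewrite ?e01 ?e12.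
- have := perm 1%g; rewrite !perm1 => -[||| U' [W' [u w n]]] //; first exact: up.
  by exists U', W'; split=> //; apply: Or32.
(* The cyclic shift 0, 1, 2 to 1, 2, 0 keeps the two indices of equal weight in increasing order, so
   the entry that has to vanish still lies below the diagonal. *)
- have := perm (tperm o0 o1 * tperm o0 o2)%g; rewrite !permM.
  rewrite tpermL tpermR (@tpermD _ o0 o1 o2) // tpermL tpermR (@tpermD _ o0 o2 o1) //.
  rewrite -e12 => -[||| U' [W' [u w n]]] //; [by rewrite eq_sym|exact: up|].
  by exists U', W'; split=> //; apply: Or32.
have [e02|n02] := eqVneq (h' o0 o0) (h' o2 o2).
  have := perm (tperm o1 o2); rewrite tpermL tpermR (@tpermD _ o1 o2 o0) //.
  move=> -[||| U' [W' [u w n]]] //; [by rewrite eq_sym|exact: up|].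
  by exists U', W'; split=> //; apply: Or32.
exists U, W; split=> //; apply: Or31.
have wt1 p q : h' p p != h' q q -> h' p q = 0 /\ h' p p != h' q q.
  by move=> ne; split=> //; have [] := wt0 _ _ ne.
by apply: ord3P; apply: ord3P; rewrite ?eqxx // => _; apply: wt1; rewrite // eq_sym.
Qed.

End NormalForm.

(** * The relation space and its linear automorphisms *)

Section Relations.
Variables (k : fieldType) (q : k).
Hypotheses (q0 : q != 0) (q1 : q != 1) (qN1 : q != -1) (two : 2%:R != 0 :> k).
Implicit Types (t M : 'M[k]_3) (i j l p r : 'I_3).

(** Here [t] holds the coefficients of a tensor on the x_i ⊗ x_j, and the conditions cut out the
    span of the relators x_j x_i - q x_i x_j with i < j, whose matrices are [relmx]. *)
Definition inR t : Prop :=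
  (forall i, t i i = 0) /\ (forall i j, (i < j)%N -> t i j = - q * t j i).

Lemma inR_lin c t t' : inR t -> inR t' -> inR (c *: t + t').
Proof.
move=> [d e] [d' e']; split=> [i|i j ij]; rewrite !mxE ?d ?d' ?mulr0 ?addr0 //.
by rewrite (e _ _ ij) (e' _ _ ij); ring.
Qed.

Lemma inR0 : inR 0.
Proof. by split=> [i|i j _]; rewrite !mxE ?mulr0. Qed.

Lemma inR_eq0 t i j : inR t -> t i j = 0 -> t j i = 0.
Proof.
move=> [d e] tij; have [ij|ji|/val_inj <- //] := ltngtP i j.
  move: tij; rewrite e // => /eqP; rewrite mulf_eq0 oppr_eq0 (negbTE q0) /=.
  by move/eqP.
by rewrite e // tij mulr0.
Qed.

Lemma inR_sym t : inR t -> (forall i j, t i j = t j i) -> t = 0.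
Proof.
move=> [d e] s; apply/matrixP => i j; rewrite !mxE.
have E (a b : 'I_3) : (a < b)%N -> t a b = 0.
  move=> ab; have /eqP := e _ _ ab; rewrite (s b a) -subr_eq0 mulNr opprK.
  rewrite -[X in X + _]mul1r -mulrDl mulf_eq0 addrC addr_eq0 (negbTE qN1) /=.
  by move/eqP.
have [ij|ji|/val_inj -> //] := ltngtP i j; first exact: E.
by rewrite s E.
Qed.

Definition relmx i j : 'M[k]_3 := delta_mx j i - q *: delta_mx i j.

Lemma inR_relmx i j : (i < j)%N -> inR (relmx i j).
Proof.
move: i j; apply: ord3P; apply: ord3P => // _;
  (split; [apply: ord3P; rewrite !mxE /=; ring
         | by apply: ord3P; apply: ord3P => // _; rewrite !mxE /=; ring]).
Qed.

Lemma conj_relmx M i j p r :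
  (M *m relmx i j *m M^T) p r = M p j * M r i - q * (M p i * M r j).
Proof.
rewrite mulmxBr mulmxBl -scalemxAr -scalemxAl !mxE.
have E a b : (M *m delta_mx a b *m M^T) p r = M p a * M r b.
  rewrite -(mul_delta_mx (0 : 'I_1)) mulmxA -colE -mulmxA -rowE.
  by rewrite mxE big_ord1 !mxE.
by rewrite -!E !mxE.
Qed.

(** The image of a relator has diagonal entries [(1 - q) * (M p j * M p i)], so each row of [M] has
    at most one nonzero entry. Its defect off the diagonal is [(1 - q) * (1 + q) * (M p j * M r i)]
    with i < j and p < r, so the permutation underlying [M] has no inversion and is the identity. *)
Lemma aut_diag M Mi : M *m Mi = 1%:M ->
  (forall t, inR t -> inR (M *m t *m M^T)) -> forall p r, p != r -> M p r = 0.
Proof.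
move=> MMi; have MiM := mulmx1C MMi => stab.
have R1 p i j : (i < j)%N -> M p j * M p i = 0.
  move=> ij; have [/(_ p) d _] := stab _ (inR_relmx ij).
  move: d; rewrite conj_relmx [M p i * _]mulrC -{1}[_ * _]mul1r -mulrBl.
  by move/eqP; rewrite mulf_eq0 subr_eq0 eq_sym (negbTE q1) /= => /eqP.
have R2 p r i j : (i < j)%N -> (p < r)%N -> M p j * M r i = 0.
  move=> ij pr; have [_ /(_ _ _ pr) e] := stab _ (inR_relmx ij).
  move: e; rewrite !conj_relmx => /eqP; rewrite -subr_eq0.
  have -> : M p j * M r i - q * (M p i * M r j) - - q * (M r j * M p i - q * (M r i * M p j))
    = (1 - q) * (1 + q) * (M p j * M r i) by ring.
  rewrite !mulf_eq0 subr_eq0 eq_sym (negbTE q1) addrC addr_eq0 (negbTE qN1) /=.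
  by rewrite -mulf_eq0 => /eqP.
have R1' p i j : M p i != 0 -> i != j -> M p j = 0.
  move=> pi; rewrite -val_eqE neq_ltn => /orP [ij|ji]; apply/eqP.
    by have /eqP := R1 p _ _ ij; rewrite mulf_eq0 (negbTE pi) orbF.
  by have /eqP := R1 p _ _ ji; rewrite mulf_eq0 (negbTE pi).
have R2' p r i j : M p j != 0 -> (i < j)%N -> (p < r)%N -> M r i = 0.
  move=> pj ij pr; have /eqP := R2 _ _ _ _ ij pr.
  by rewrite mulf_eq0 (negbTE pj) => /eqP.
have col0 j : ~ (forall p, M p j = 0).
  move=> z; have /matrixP /(_ j j) := MiM; rewrite !mxE eqxx big1; last first.
    by move=> l _; rewrite z mulr0.
  by move/eqP; rewrite eq_sym oner_eq0.
have rows p r j : p != r -> ~ ((forall l, l != j -> M p l = 0) /\ forall l, l != j -> M r l = 0).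
  move=> pr [zp zr].
  have E a b : (forall l, l != j -> M a l = 0) -> (a == b)%:R = M a j * Mi j b.
    move=> z; have /matrixP /(_ a b) := MMi; rewrite !mxE => <-.
    by rewrite (bigD1 j) //= big1 ?addr0 // => l lj; rewrite z ?mul0r.
  have := E p r zp; have := E p p zp; have := E r r zr; rewrite !eqxx (negbTE pr).
  move=> e1 e2 /esym /eqP; rewrite mulf_eq0 => /orP [] /eqP e3.
    by move: e2; rewrite e3 mul0r => /eqP; rewrite oner_eq0.
  by move: e1; rewrite e3 mulr0 => /eqP; rewrite oner_eq0.
have case p r : p != r -> (M p r != 0 -> False) -> M p r = 0.
  by move=> _ c; apply/eqP; apply: contraT => /c.
apply: ord3P; apply: ord3P => // _; apply: case => // nz.
- apply: (col0 o0); apply: ord3P; [exact: R1' nz _|exact: R2' nz _ _|exact: R2' nz _ _].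
- apply: (col0 o0); apply: ord3P; [exact: R1' nz _|exact: R2' nz _ _|exact: R2' nz _ _].
- apply: (rows o0 o1 o0) => //; split.
    move=> l l0; apply/eqP; apply: contraT => /R2' h; move: nz.
    by rewrite (h o1 o0) ?eqxx //; move: l l0 {h}; apply: ord3P.
  by move=> l l0; apply: R1' nz _; rewrite eq_sym.
- apply: (rows o1 o2 o2) => //; split.
    by move=> l l0; apply: R1' nz _; rewrite eq_sym.
  by move=> l l0; apply: R2' nz _ _ => //; move: l l0; apply: ord3P.
- apply: (rows o0 o1 o0) => //; split.
    move=> l l0; apply/eqP; apply: contraT => /R2' h; move: nz.
    by rewrite (h o2 o0) ?eqxx //; move: l l0 {h}; apply: ord3P.
  move=> l l0; apply/eqP; apply: contraT => /R2' h; move: nz.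
  by rewrite (h o2 o0) ?eqxx //; move: l l0 {h}; apply: ord3P.
- apply: (col0 o2); apply: ord3P; last exact: R1' nz _.
    apply/eqP; apply: contraT => /R2' h; move: nz.
    by rewrite (h o2 o1) ?eqxx.
  apply/eqP; apply: contraT => /R2' h; move: nz.
  by rewrite (h o2 o1) ?eqxx.
Qed.

(** The determinant of [t] is q (q - 1) times the product of its three entries below the diagonal,
    and if one of these is zero the two kernels are explicit and orthogonal for [t]. The elimination
    below reaches this through [key] without splitting on those entries. It serves to show that an
    entry of a relation is zero when the opposite row and column are. *)
Lemma inR_kernels t (x y : 'I_3 -> k) : inR t ->
  (forall p, \sum_l x l * t l p = 0) -> (forall p, \sum_l t p l * y l = 0) ->
  \sum_p \sum_l y p * t p l * x l = 0.
Proof.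
move=> [d e] hx hy; rewrite !sum3 !d.
have e01 := e o0 o1 isT; have e02 := e o0 o2 isT; have e12 := e o1 o2 isT.
have x0 := hx o0; have x1 := hx o1; have x2 := hx o2.
have y0 := hy o0; have y1 := hy o1; have y2 := hy o2.
move: x0 x1 x2 y0 y1 y2; rewrite !sum3 !d e01 e02 e12.
move: (t o1 o0) (t o2 o0) (t o2 o1) (x o0) (x o1) (x o2) (y o0) (y o1) (y o2).
move=> a b c X0 X1 X2 Y0 Y1 Y2 x0 x1 x2 y0 y1 y2.
have {x0}x0 : X1 * a = - (X2 * b) by apply/eqP; rewrite -addr_eq0 -x0; apply/eqP; ring.
have {x1}x1 : X2 * c = q * (X0 * a).
  by apply/eqP; rewrite -subr_eq0 -x1; apply/eqP; ring.
have {x2}x2 : X0 * b + X1 * c = 0.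
  have : - q * (X0 * b + X1 * c) = 0 by rewrite -x2; ring.
  by move/eqP; rewrite mulf_eq0 oppr_eq0 (negbTE q0) /= => /eqP.
have {y0}y0 : b * Y2 = - (a * Y1).
  have : - q * (a * Y1 + b * Y2) = 0 by rewrite -y0; ring.
  move/eqP; rewrite mulf_eq0 oppr_eq0 (negbTE q0) /= addrC addr_eq0 => /eqP.
  by [].
have {y1}y1 : a * Y0 = q * (c * Y2).
  by apply/eqP; rewrite -subr_eq0 -y1; apply/eqP; ring.
have {y2}y2 : c * Y1 = - (b * Y0).
  by apply/eqP; rewrite -addr_eq0 -y2; apply/eqP; ring.
have key : X0 * X1 * a = 0.
  have : (q - 1) * (X0 * X1 * a) = 0.
    have -> : (q - 1) * (X0 * X1 * a) = X1 * (q * (X0 * a)) - X0 * (X1 * a) by ring.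
    rewrite -x1 x0; have -> : X1 * (X2 * c) - X0 * - (X2 * b) = X2 * (X0 * b + X1 * c).
      by ring.
    by rewrite x2 mulr0.
  by move/eqP; rewrite mulf_eq0 subr_eq0 (negbTE q1) /= => /eqP.
have A0 : X0 * (a * Y1) = 0.
  have [z|nz] := eqVneq X1 0; last first.
    by move: key => /eqP; rewrite mulrAC mulf_eq0 (negbTE nz) orbF mulrA => /eqP ->;
      rewrite mul0r.
  have -> : X0 * (a * Y1) = - (X0 * b) * Y2.
    by rewrite mulNr -mulrA y0 mulrN opprK.
  have -> : X0 * b = - (X1 * c) by apply/eqP; rewrite -addr_eq0 x2.
  by rewrite z mul0r !oppr0 mul0r.
have B0 : X1 * (a * Y0) = 0.
  rewrite y1; have -> : X1 * (q * (c * Y2)) = q * ((X1 * c) * Y2) by ring.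
  have -> : X1 * c = - (X0 * b) by apply/eqP; rewrite -addr_eq0 addrC x2.
  by rewrite mulNr -mulrA y0 !mulrN opprK A0 mulr0.
have C0 : X1 * (c * Y2) = 0.
  have : q * (X1 * (c * Y2)) = 0 by rewrite mulrCA -y1 B0.
  by move/eqP; rewrite mulf_eq0 (negbTE q0) /= => /eqP.
have -> : Y0 * 0 * X0 + Y0 * (- q * a) * X1 + Y0 * (- q * b) * X2 +
   (Y1 * a * X0 + Y1 * 0 * X1 + Y1 * (- q * c) * X2) +
   (Y2 * b * X0 + Y2 * c * X1 + Y2 * 0 * X2) =
   - q * (X1 * (a * Y0)) - q * (Y0 * (X2 * b)) + X0 * (a * Y1)
   - q * (Y1 * (X2 * c)) + X0 * (b * Y2) + X1 * (c * Y2) by ring.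
have -> : X2 * b = - (X1 * a) by rewrite x0 opprK.
rewrite x1 y0 C0 A0 B0.
have -> : Y0 * - (X1 * a) = - (X1 * (a * Y0)) by ring.
have -> : Y1 * (q * (X0 * a)) = q * (X0 * (a * Y1)) by ring.
by rewrite !mulrN ?A0 ?B0; ring.
Qed.

Section Basis.
Variables U W : 'M[k]_3.
Hypotheses (UW : U *m W = 1%:M) (WU : W *m U = 1%:M).

(* [R] in the coordinates of the basis formed by the columns of [U] *)
Definition inRU t := inR (U *m t *m U^T).

Lemma inRU_lin c t t' : inRU t -> inRU t' -> inRU (c *: t + t').
Proof.
move=> h h'; rewrite /inRU mulmxDr mulmxDl -scalemxAr -scalemxAl.
exact: inR_lin.
Qed.

Lemma inRU0 : inRU 0.
Proof. by rewrite /inRU mulmx0 mul0mx; apply: inR0. Qed.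

Lemma conjK t : W *m (U *m t *m U^T) *m W^T = t.
Proof. by rewrite !mulmxA WU mul1mx -mulmxA -trmx_mul WU trmx1 mulmx1. Qed.

Lemma conjVK t : U *m (W *m t *m W^T) *m U^T = t.
Proof. by rewrite !mulmxA UW mul1mx -mulmxA -trmx_mul UW trmx1 mulmx1. Qed.

Lemma inRU_sym t : inRU t -> (forall i j, t i j = t j i) -> t = 0.
Proof.
move=> h s; have tT : t^T = t by apply/matrixP => i j; rewrite mxE s.
rewrite -[t]conjK (inR_sym h) ?mulmx0 ?mul0mx // => i j.
have : (U *m t *m U^T)^T = U *m t *m U^T by rewrite !trmx_mul trmxK tT mulmxA.
by move/matrixP => /(_ j i); rewrite mxE.
Qed.

Lemma inRU_kernels t a b : inRU t -> (forall c, t b c = 0) ->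
  (forall c, t c a = 0) -> t a b = 0.
Proof.
move=> h row0 col0; have e := @inR_kernels _ (fun l => W b l) (fun l => W a l) h.
have <- : \sum_p \sum_l W a p * (U *m t *m U^T) p l * W b l = t a b.
  rewrite -{2}[t]conjK mxE exchange_big; apply: eq_bigr => l _ /=.
  by rewrite mxE mxE mulr_suml.
apply: e => p.
  transitivity ((W *m (U *m t *m U^T)) b p); first by rewrite mxE.
  rewrite !mulmxA WU mul1mx mxE big1 // => l _.
  by rewrite row0 mul0r.
transitivity ((U *m t *m U^T *m W^T) p a).
  by rewrite mxE; apply: eq_bigr => l _; rewrite !mxE.
rewrite -mulmxA -trmx_mul WU trmx1 mulmx1 mxE big1 // => l _.
by rewrite col0 mulr0.
Qed.

(** In the new basis the relators have diagonal entries [(1 - q) * (W l i * W l j)]. The conclusion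
    says that each row of [W] has at most one nonzero entry. *)
Lemma inRU_diag0 : (forall t i, inRU t -> t i i = 0) ->
  forall l p r, p != r -> W l p * W l r = 0.
Proof.
move=> d l; have E i j : (i < j)%N -> W l i * W l j = 0.
  move=> ij; have h : inRU (W *m relmx i j *m W^T).
    by rewrite /inRU conjVK; apply: inR_relmx.
  have := d _ l h; rewrite conj_relmx.
  rewrite [W l j * _]mulrC -{1}[_ * _]mul1r -mulrBl.
  by move/eqP; rewrite mulf_eq0 subr_eq0 eq_sym (negbTE q1) /= => /eqP.
move=> p r; rewrite -val_eqE neq_ltn => /orP [/E //|/E].
by rewrite mulrC.
Qed.

(** In the given variables the scaling becomes [U *m D *m W], an automorphism of the relation space,
    and is diagonal by [aut_diag]; the sums are its off-diagonal entries. *)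
Lemma diag_aut (x : 'I_3 -> k) : (forall i, x i != 0) ->
  (forall t, inRU t -> inRU (\matrix_(i, j) (x i * x j * t i j))) ->
  forall p r, p != r -> \sum_l x l * (U p l * W l r) = 0.
Proof.
move=> x0 stab p r pr; pose D := diag_mx (\row_i x i).
pose D' := diag_mx (\row_i (x i)^-1).
have DD' : D *m D' = 1%:M.
  rewrite mulmx_diag; apply/matrixP => i j; rewrite !mxE mulfV //.
have e : (U *m D *m W) *m (U *m D' *m W) = 1%:M.
  rewrite !mulmxA -[U *m D *m W *m U]mulmxA WU mulmx1 -[U *m D *m D']mulmxA DD'.
  by rewrite mulmx1 UW.
have st t : inR t -> inR ((U *m D *m W) *m t *m (U *m D *m W)^T).
  move=> tR; have h : inRU (W *m t *m W^T) by rewrite /inRU conjVK.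
  have := stab _ h; rewrite /inRU; set s := \matrix_(i, j) _.
  have -> : s = D *m (W *m t *m W^T) *m D.
    rewrite {}/s; move: (W *m t *m W^T) => X; rewrite mul_mx_diag mul_diag_mx.
    by apply/matrixP => i j; rewrite !mxE mulrAC.
  by rewrite !trmx_mul tr_diag_mx !mulmxA.
transitivity ((U *m D *m W) p r); last exact: aut_diag e st _ _ pr.
by rewrite mxE; apply: eq_bigr => l _; rewrite mul_mx_diag !mxE mulrCA mulrA.
Qed.

End Basis.

End Relations.

Lemma ord3_third (i j l : 'I_3) : i != j -> j != l -> i != l ->
  forall m, [\/ m = i, m = j | m = l].
Proof.
move=> ij jl il m; have [|mi] := eqVneq m i; first by constructor 1.
have [|mj] := eqVneq m j; first by constructor 2.
constructor 3; move: i j l m ij jl il mi mj.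
by do 4!apply: ord3P.
Qed.

Lemma exists_third (i j : 'I_3) : exists l, i != j -> j != l /\ i != l.
Proof.
move: i j; apply: ord3P; apply: ord3P;
  by [exists o0 | exists o1 | exists o2].
Qed.

(** * Three distinct weights *)

Section DistinctWeights.
Variables (k : closedFieldType) (q : k).
Hypotheses (char0 : [pchar k] =i pred0) (q0 : q != 0) (q1 : q != 1) (qN1 : q != -1).
Variables (D : eqType) (U W : 'M[k]_3) (cls : 'I_3 -> 'I_3 -> D).
Hypotheses (UW : U *m W = 1%:M) (WU : W *m U = 1%:M).
Hypotheses (clsI : forall i j l, cls i j = cls i l -> j = l)
           (clsI' : forall i j l, cls j i = cls l i -> j = l).
Implicit Types (t : 'M[k]_3) (i j l m p r : 'I_3).

(** In the application [cls i j] is the product of the weights of i and j, and this is the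
    projection onto weight [d]. Only cancellation is assumed of [cls]: different pairs may well
    share a product. *)
Definition cls_mask (d : D) t : 'M[k]_3 :=
  \matrix_(i, j) if cls i j == d then t i j else 0.

Hypothesis maskR : forall d t, inRU q U t -> inRU q U (cls_mask d t).

Definition homog t := forall i j l m, t i j != 0 -> t l m != 0 -> cls i j = cls l m.

Lemma homog_mask d t : homog (cls_mask d t).
Proof.
move=> i j l m; rewrite !mxE.
have [->|_] := eqVneq (cls i j) d; last by rewrite eqxx.
by have [->|_] := eqVneq (cls l m) d; last by rewrite eqxx.
Qed.

Lemma two_neq0 : 2%:R != 0 :> k.
Proof. by rewrite ((pcharf0P k).1 char0). Qed.

Lemma mask_sum t : exists s : seq D, t = \sum_(d <- s) cls_mask d t.
Proof.
exists (undup [seq cls c.1 c.2 | c <- enum {: 'I_3 * 'I_3}]).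
apply/matrixP => i j; rewrite summxE (bigD1_seq (cls i j)) ?undup_uniq //=.
  rewrite mxE eqxx big1 ?addr0 // => d ne.
  by rewrite mxE eq_sym (negbTE ne).
by rewrite mem_undup; apply/mapP; exists (i, j) => //; rewrite mem_enum.
Qed.

Lemma scale_homog (x : 'I_3 -> k) :
  (forall t, inRU q U t -> homog t ->
     exists c : k, forall i j, x i * x j * t i j = c * t i j) ->
  forall t, inRU q U t -> inRU q U (\matrix_(i, j) (x i * x j * t i j)).
Proof.
move=> hx t tR; have [s e] := mask_sum t.
have -> : \matrix_(i, j) (x i * x j * t i j) =
    \sum_(d <- s) \matrix_(i, j) (x i * x j * cls_mask d t i j).
  apply/matrixP => i j; rewrite mxE {1}e !summxE mulr_sumr.
  by apply: eq_bigr => d _; rewrite [RHS]mxE.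
elim/big_rec: _ => [|d t' _ t'R]; first exact: inRU0.
have [c hc] := hx _ (maskR d tR) (@homog_mask d t).
have -> : \matrix_(i, j) (x i * x j * cls_mask d t i j) = c *: cls_mask d t.
  by apply/matrixP => i j; rewrite mxE hc [RHS]mxE.
by apply: inRU_lin => //; apply: maskR.
Qed.

Lemma exists_cube_root : exists w : k, 1 + w + w ^+ 2 = 0.
Proof.
have [|w rw] := @closed_rootP k ('X^2 + 'X + 1) _.
  by rewrite size_addl size_addl ?size_polyXn ?size_polyX ?size_poly1 ?size_polyC ?oner_eq0.
exists w; move: rw; rewrite rootE !hornerE /= => /eqP <-.
by ring.
Qed.

(** Without chains, cancellation confines a nonzero homogeneous relation to positions (i, j), (j,
    i), (l, l) with i, j, l distinct. As i + j = 2 l modulo 3, scaling by powers of a cube root of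
    unity multiplies it by a constant. The matrices U W, U D W and U D^2 W are then all diagonal,
    and a Fourier inversion on three points isolates each [l]. *)
Lemma diag_of_no_chain :
  (forall t i j l, inRU q U t -> homog t -> i != j -> j != l -> i != l ->
     t i j != 0 -> t j l != 0 -> False) ->
  forall l p r, p != r -> U p l * W l r = 0.
Proof.
move=> nochain; have [w w3] := exists_cube_root.
have w3' : w ^+ 3 = 1.
  by apply/eqP; rewrite -subr_eq0; apply/eqP; rewrite -(mulr0 (w - 1)) -w3; ring.
have w0 : w != 0.
  by apply: contra_eq_neq w3' => ->; rewrite expr0n eq_sym oner_eq0.
pose x i : k := w ^+ i.
have xP i j l : i != j -> j != l -> i != l -> x l * x l = x i * x j.
  have [w4 w5] : w ^+ 4 = w /\ w ^+ 5 = w ^+ 2.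
    by rewrite -[4%N]/(3 + 1)%N -[5%N]/(3 + 2)%N !exprD w3' !mul1r expr1.
  rewrite /x -!exprD; move: i j l.
  by do 3!apply: ord3P => //; rewrite /= ?addn0 ?expr0 ?expr1 ?w3' ?w4.
have stab : forall t, inRU q U t -> inRU q U (\matrix_(i, j) (x i * x j * t i j)).
  apply: scale_homog => t tR th.
  have [[i [j [ij tij]]]|none] := pselect (exists i j, i != j /\ t i j != 0); last first.
    (* A relation supported on the diagonal is symmetric, hence zero. *)
    exists 1 => i j; rewrite (inRU_sym qN1 WU tR) ?mxE ?mulr0 //.
    move=> a b; have [-> //|ab] := eqVneq a b.
    have z a' b' : a' != b' -> t a' b' = 0.
      move=> ab'; apply/eqP; apply: contraT => nz; case: none; by exists a', b'.
    by rewrite !z // eq_sym.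
  have [l /(_ ij) [jl il]] := exists_third i j.
  have ji : j != i by rewrite eq_sym.
  have lj : l != j by rewrite eq_sym.
  have li : l != i by rewrite eq_sym.
  exists (x i * x j) => a b; have [->|tab] := eqVneq (t a b) 0; first by rewrite !mulr0.
  congr (_ * _); have e := th _ _ _ _ tij tab.
  case: (ord3_third ij jl il a) e tab => ->; case: (ord3_third ij jl il b) => -> e tab //.
  - by move: ij; rewrite (clsI e) eqxx.
  - by move: jl; rewrite (clsI e) eqxx.
  - by rewrite mulrC.
  - by move: ij; rewrite (clsI' e) eqxx.
  - by case: (nochain t i j l).
  - by case: (nochain t l i j).
  - by move: il; rewrite (clsI' e) eqxx.
  - exact: xP.
have stab2 t : inRU q U t -> inRU q U (\matrix_(i, j) (x i ^+ 2 * x j ^+ 2 * t i j)).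
  move=> /stab /stab; congr (inRU _ _ _); apply/matrixP => i j; rewrite !mxE.
  by ring.
have x0 i : x i != 0 by rewrite expf_neq0.
have x02 i : x i ^+ 2 != 0 by rewrite !expf_neq0.
have three : 3%:R != 0 :> k by rewrite ((pcharf0P k).1 char0).
move=> l p r pr; have := diag_aut q1 qN1 UW WU x0 stab pr.
have := diag_aut q1 qN1 UW WU x02 stab2 pr.
have : (U *m W) p r = 0 by rewrite UW mxE (negbTE pr).
have xo0 : x o0 = 1 by [].
have xo1 : x o1 = w by exact: expr1.
have xo2 : x o2 = w ^+ 2 by [].
rewrite mxE !sum3 xo0 xo1 xo2; move: l.
set a := U p o0 * _; set b := U p o1 * _; set c := U p o2 * _ => l e1 e2 e3.
(* Powers of [w] are reduced to degree one by w^2 = - 1 - w, so that [ring] can check the inversion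
   formulas for 3 a, 3 b and 3 c. *)
have e2' : a + (- 1 - w) * b + w * c = 0.
  have -> : a + (- 1 - w) * b + w * c = 1 ^+ 2 * a + w ^+ 2 * b + (w ^+ 2) ^+ 2 * c -
    (1 + w + w ^+ 2) * (b + w * (w - 1) * c) by ring.
  by rewrite e2 w3 mul0r subr0.
have e3' : a + w * b + (- 1 - w) * c = 0.
  have -> : a + w * b + (- 1 - w) * c = 1 * a + w * b + w ^+ 2 * c -
    (1 + w + w ^+ 2) * c by ring.
  by rewrite e3 w3 mul0r subr0.
have z (u : k) : 3%:R * u = 0 -> u = 0.
  by move/eqP; rewrite mulf_eq0 (negbTE three) /= => /eqP.
have ww : w * w = - 1 - w by apply/eqP; rewrite -subr_eq0 -w3; apply/eqP; ring.
move: l; apply: ord3P; apply: z; rewrite -/a -/b -/c.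
- have -> : 3%:R * a = (a + b + c) + (a + (- 1 - w) * b + w * c) +
    (a + w * b + (- 1 - w) * c) by ring.
  by rewrite e1 e2' e3' !addr0.
- have -> : 3%:R * b = (a + b + c) + w * (a + (- 1 - w) * b + w * c) +
    (- 1 - w) * (a + w * b + (- 1 - w) * c) + (b + b - c - c) * (w * w + 1 + w).
    by ring.
  by rewrite e1 e2' e3' ww; ring.
have -> : 3%:R * c = (a + b + c) + (- 1 - w) * (a + (- 1 - w) * b + w * c) +
    w * (a + w * b + (- 1 - w) * c) + (c + c - b - b) * (w * w + 1 + w).
  by ring.
by rewrite e1 e2' e3' ww; ring.
Qed.

(** What remains is to exclude a chain of nonzero entries t0 i j and t0 j m of equal weight. In its
    presence all relations turn out to have zero diagonal, so that [W] has one nonzero entry per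
    row; then t0 j i is nonzero together with t0 i j, and [cls j i = cls j m] contradicts
    cancellation. *)
Lemma diag_weights l p r : p != r -> U p l * W l r = 0.
Proof.
have [nochain|chain] := pselect (forall t i j l, inRU q U t -> homog t -> i != j ->
    j != l -> i != l -> t i j != 0 -> t j l != 0 -> False).
  exact: diag_of_no_chain.
case: chain => t0 i j m t0R t0h ij jm im t0ij t0jm; exfalso.
have ji : j != i by rewrite eq_sym.
have mj : m != j by rewrite eq_sym.
have mi : m != i by rewrite eq_sym.
have C : cls i j = cls j m by apply: t0h.
have zero t a b c d : homog t -> t a b != 0 -> cls a b != cls c d -> t c d = 0.
  by move=> th tab; apply: contraNeq => /(th _ _ _ _ tab) ->.
have cross t a x y : homog t -> t a a != 0 -> x != y -> (x == a) || (y == a) -> t x y = 0.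
  move=> th ta xy xa; apply: (zero t a a) => //; apply: contra_neq xy => e.
  case/orP: xa => /eqP xa; rewrite xa in e *; first exact: clsI e.
  by rewrite (clsI' e).
(* A nonzero diagonal entry forces both entries of the complementary 2x2 block. *)
have claim t a b c : inRU q U t -> homog t -> a != b -> b != c -> a != c ->
    t c c != 0 -> t a b != 0 /\ t b a != 0.
  move=> tR th ab bc ac tcc; have ba : b != a by rewrite eq_sym.
  have half a' b' : a' != b' -> b' != c -> a' != c -> t a' b' = 0 -> t b' a' = 0.
    move=> ab' bc' ac' z; apply/eqP; apply: contraT => nz.
    have za : t a' a' = 0.
      by apply: (zero t b' a') => //; apply: contra_neq ab' => /clsI' ->.
    have zb : t b' b' = 0.
      by apply: (zero t b' a') => //; apply: contra_neq ab' => /clsI ->.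
    have e3 := ord3_third ab' bc' ac'.
    move: nz; rewrite (@inRU_kernels _ q q0 q1 U W WU t b' a' tR) ?eqxx // => x.
      case: (e3 x) => -> //; by apply: (cross t c) => //; rewrite ?eqxx ?orbT.
    case: (e3 x) => -> //; apply: (cross t c) => //; rewrite ?eqxx //.
    by rewrite eq_sym.
  have nz a' b' : a' != b' -> b' != c -> a' != c -> t a' b' != 0.
    move=> ab' bc' ac'; apply/eqP => z; have z' := half _ _ ab' bc' ac' z.
    suff tz : t = 0 by move: tcc; rewrite tz mxE eqxx.
    apply: (inRU_sym qN1 WU tR) => x y.
    have e3 := ord3_third ab' bc' ac'.
    have [-> //|xy] := eqVneq x y.
    have xx (u : 'I_3) : u != c -> (u = a') \/ (u = b').
      by case: (e3 u) => ->; [left|right|rewrite eqxx].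
    have [xc|xc] := boolP ((x == c) || (y == c)).
      by rewrite (cross t c x y) // (cross t c y x) // 1?orbC // eq_sym.
    move: xc; rewrite negb_or => /andP [/xx [] -> /xx [] ->] //; by rewrite z z'.
  by split; apply: nz.
(* For l' equal to i or m, the block forced by [claim] contains (j, m) or (i, j), whose class is
   that of the chain, and cancellation gives a contradiction. *)
have claim2 t l' : inRU q U t -> homog t -> t l' l' != 0 -> l' = j /\ cls j j = cls i m /\ cls j j = cls m i.
  move=> tR th tl; case: (ord3_third ij jm im l') => e; rewrite {}e in tl *.
  - have [h _] := claim t j m i tR th jm mi ji tl.
    by have := th _ _ _ _ tl h; rewrite -C => /clsI /eqP; rewrite (negbTE ij).
  - have [h1 h2] := claim t i m j tR th im mj ij tl.
    by split=> //; split; apply: th.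
  - have [h _] := claim t i j m tR th ij jm im tl.
    by have := th _ _ _ _ tl h; rewrite C => /clsI' /eqP; rewrite (negbTE mj).
(* If some relation were nonzero at (j, j), then in a homogeneous relation the nonzero entries in
   which j occurs twice or not at all would have class [cls j j], and the others a different one.
   Changing the sign of the j-th basis vector would preserve the relations, so this vector would be
   proportional to a variable, whose square occurs in no relation. *)
have dj : forall t, inRU q U t -> homog t -> t j j = 0.
  move=> t1 t1R t1h; apply/eqP; apply: contraT => t1j; exfalso.
  have [_ [Eim Emi]] := claim2 _ _ t1R t1h t1j.
  pose x (a : 'I_3) : k := if a == j then -1 else 1.
  have even t a b : inRU q U t -> homog t -> t a b != 0 -> (a == j) = (b == j) ->
      cls a b = cls j j.
    move=> tR th tab; have [-> /esym /eqP -> //|aj /esym /negbT bj] := eqVneq a j.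
    have [e|ab] := eqVneq a b.
      by rewrite -e in tab; have [] := claim2 _ _ tR th tab => e' _; move: aj; rewrite e' eqxx.
    case: (ord3_third ij jm im a) aj ab => ->; case: (ord3_third ij jm im b) bj => ->;
      by rewrite ?eqxx.
  have x0 a : x a != 0 by rewrite /x; case: ifP => _; [rewrite oppr_eq0|]; apply: oner_neq0.
  have sx t : inRU q U t -> inRU q U (\matrix_(a, b) (x a * x b * t a b)).
    apply: scale_homog => {}t tR th.
    have [[a [b [tab par]]]|none] := pselect (exists a b, t a b != 0 /\ (a == j) != (b == j)).
      exists (-1) => c d; have [->|tcd] := eqVneq (t c d) 0; first by rewrite !mulr0.
      congr (_ * _); rewrite /x.
      have [pcd|] := eqVneq (c == j) (d == j); last first.
        by case: (c == j); case: (d == j); rewrite // ?mulr1 ?mul1r.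
      have e := th _ _ _ _ tab tcd; rewrite (even _ _ _ tR th tcd pcd) in e.
      exfalso; move: par; have [aj|aj] := eqVneq a j.
        by rewrite aj in e; rewrite (clsI e) eqxx.
      have [bj|] := eqVneq b j; last by rewrite eqxx.
      by rewrite bj in e; move: aj; rewrite (clsI' e) eqxx.
    exists 1 => c d; have [->|tcd] := eqVneq (t c d) 0; first by rewrite !mulr0.
    congr (_ * _); have [pcd|npcd] := eqVneq (c == j) (d == j).
      by rewrite /x pcd; case: (d == j); rewrite ?mulrNN mulr1.
    by case: none; exists c, d.
  have key p' r' : p' != r' -> U p' j * W j r' = 0.
    move=> pr; have e1 : (U *m W) p' r' = 0 by rewrite UW mxE (negbTE pr).
    have e2 := diag_aut q1 qN1 UW WU x0 sx pr.
    move: e1 e2; rewrite mxE (bigD1 j) //= => e1.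
    rewrite (bigD1 j) //= {1}/x eqxx mulN1r.
    have -> : \sum_(a < 3 | a != j) x a * (U p' a * W a r') =
        \sum_(a < 3 | a != j) U p' a * W a r'.
      by apply: eq_bigr => a aj; rewrite /x (negbTE aj) mul1r.
    move: e1; set u := U p' j * _; set v := \sum_(_ | _) _ => e1 e2.
    have : 2%:R * u = (u + v) - (- u + v) by ring.
    rewrite e1 e2 subrr => /eqP; rewrite mulf_eq0 (negbTE two_neq0) /=.
    by move/eqP.
  have [p0 Up0] : exists p', U p' j != 0.
    apply: contrapT => /forallNP z; have /matrixP /(_ j j) := WU.
    rewrite !mxE eqxx big1; last first.
      by move=> l' _; case: (eqVneq (U l' j) 0) => [->|/z //]; rewrite mulr0.
    by move/eqP; rewrite eq_sym oner_eq0.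
  have Wj r' : r' != p0 -> W j r' = 0.
    rewrite eq_sym => /key /eqP; rewrite mulf_eq0 (negbTE Up0) /=.
    by move/eqP.
  rewrite -[t1](conjK WU) in t1j; move: t1j; have [d _] := t1R.
  set T := U *m t1 *m U^T in d *; rewrite mxE (bigD1 p0) //= big1 ?addr0; last first.
    by move=> l' lp; rewrite [X in _ * X]mxE Wj ?mulr0.
  rewrite [X in _ * X]mxE mxE (bigD1 p0) //= d mulr0 add0r big1 ?mul0r ?eqxx //.
  by move=> l' lp; rewrite Wj ?mul0r.
have d0 t a : inRU q U t -> t a a = 0.
  move=> tR; apply/eqP; apply: contraT => ta.
  have mR := maskR (cls a a) tR; have mh := @homog_mask (cls a a) t.
  have mE : cls_mask (cls a a) t a a = t a a by rewrite mxE eqxx.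
  have [e _] : a = j /\ cls j j = cls i m /\ cls j j = cls m i.
    by apply: claim2 mR mh _; rewrite mE.
  by move: ta; rewrite -mE e dj ?eqxx // -e.
have WW := inRU_diag0 q1 UW d0.
have row0 a : exists p', W a p' != 0.
  apply: contrapT => /forallNP z; have /matrixP /(_ a a) := WU.
  rewrite !mxE eqxx big1; last first.
    by move=> l' _; case: (eqVneq (W a l') 0) => [->|/z //]; rewrite mul0r.
  by move/eqP; rewrite eq_sym oner_eq0.
have [p0 Wi] := row0 i; have [r0 Wj] := row0 j.
have single a p' r' : W a p' != 0 -> r' != p' -> W a r' = 0.
  move=> ap rp; have /eqP := WW a _ _ rp; rewrite mulf_eq0 (negbTE ap) orbF.
  by move/eqP.
have E a b p' r' : W a p' != 0 -> W b r' != 0 ->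
    t0 a b = W a p' * (U *m t0 *m U^T) p' r' * W b r'.
  move=> ap br; rewrite -{1}[t0](conjK WU); move: (U *m t0 *m U^T) => T.
  rewrite mxE (bigD1 r') //= big1 ?addr0; last first.
    by move=> l' lp; rewrite [X in _ * X]mxE (single _ r') ?mulr0.
  rewrite [X in _ * X]mxE mxE (bigD1 p') //= big1 ?addr0 //.
  by move=> l' lp; rewrite (single _ p') ?mul0r.
have tji : t0 j i = 0.
  by apply: (zero t0 j m) => //; apply: contra_neq im => /clsI ->.
have Tji : (U *m t0 *m U^T) r0 p0 = 0.
  move: tji; rewrite (E j i r0 p0) // => /eqP.
  by rewrite !mulf_eq0 (negbTE Wj) (negbTE Wi) /= orbF => /eqP.
by move: t0ij; rewrite (E i j p0 r0) // (inR_eq0 q0 t0R Tji) mulr0 mul0r eqxx.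
Qed.

End DistinctWeights.

(** * Quantum matrices acting on the relation space *)

Section QuantumMatrix.
Variables (k : closedFieldType) (q : k) (H : hopfAlgType k).
Hypotheses (char0 : [pchar k] =i pred0) (q0 : q != 0) (q1 : q != 1) (qN1 : q != -1).
Hypothesis coc : cocommutative H.
Implicit Types (t : 'M[k]_3) (h : 'M[H]_3) (f : {linear H -> k^o}).

(** The condition for x_j |-> sum_i x_i ⊗ h i j to respect the relations: the coefficients of x_a
    x_a, and of x_a x_b for a < b once x_b x_a is rewritten as q x_a x_b. *)
Definition qrel h : Prop :=
  (forall (a i j : 'I_3), (i < j)%N -> h a j * h a i = q *: (h a i * h a j)) /\
  (forall (a b i j : 'I_3), (a < b)%N -> (i < j)%N ->
     h a j * h b i + q *: (h b j * h a i) =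
     q *: (h a i * h b j) + q ^+ 2 *: (h b i * h a j)).

Definition fmul2 f h (a b : 'I_3) : 'M[k]_3 :=
  \matrix_(i, j) (f (h i a * h j b) : k).

(** The tensor square of the comodule with [f] applied to its coefficients, as an operator on
    tensors of degree two. *)
Definition act2 f h t : 'M[k]_3 := \sum_a \sum_b t a b *: fmul2 f h a b.

Lemma act2E f h t i j :
  act2 f h t i j = \sum_a \sum_b t a b * (f (h i a * h j b) : k).
Proof.
rewrite summxE; apply: eq_bigr => a _; rewrite summxE; apply: eq_bigr => b _.
by rewrite !mxE.
Qed.

Lemma act2_lin f h c t t' : act2 f h (c *: t + t') = c *: act2 f h t + act2 f h t'.
Proof.
rewrite /act2 scaler_sumr -big_split; apply: eq_bigr => a _ /=.
rewrite scaler_sumr -big_split; apply: eq_bigr => b _ /=.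
by rewrite !mxE scalerDl scalerA.
Qed.

Lemma act2_0 f h : act2 f h 0 = 0.
Proof. by rewrite /act2 big1 // => a _; rewrite big1 // => b _; rewrite mxE scale0r. Qed.

Lemma act2_relmx f h (i j : 'I_3) :
  act2 f h (relmx q i j) = fmul2 f h j i - q *: fmul2 f h i j.
Proof.
have D a b : act2 f h (delta_mx a b) = fmul2 f h a b.
  rewrite /act2 (bigD1 a) //= (bigD1 b) //= !mxE !eqxx scale1r.
  rewrite !big1 ?addr0 // => [c ca|c ca].
    by rewrite big1 // => l _; rewrite mxE (negbTE ca) scale0r.
  by rewrite mxE (negbTE ca) andbF scale0r.
by rewrite /relmx addrC -scaleNr act2_lin !D scaleNr addrC.
Qed.

Lemma inR_act2 f h t : qrel h -> inR q t -> inR q (act2 f h t).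
Proof.
move=> [r1 r2] tR; have R (i j : 'I_3) : (i < j)%N -> inR q (act2 f h (relmx q i j)).
  move=> ij; rewrite act2_relmx; split=> [p|p r pr].
    by rewrite !mxE r1 // linearZ subrr.
  rewrite !mxE; have /(congr1 f) := r2 _ _ _ _ pr ij.
  rewrite !linearD !linearZ /= => e.
  have {}e : f (h p j * h r i) + q * f (h r j * h p i) =
    q * f (h p i * h r j) + q ^+ 2 * f (h r i * h p j) :> k by [].
  apply/eqP; rewrite -subr_eq0; apply/eqP.
  have -> : forall x y z w : k, x - q * y - - q * (z - q * w) =
     (x + q * z) - (q * y + q ^+ 2 * w) by move=> *; ring.
  by rewrite e subrr.
have -> : t = t o1 o0 *: relmx q o0 o1 + (t o2 o0 *: relmx q o0 o2 +
    (t o2 o1 *: relmx q o1 o2 + 0)).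
  have [d e] := tR; have e01 := e o0 o1 isT; have e02 := e o0 o2 isT.
  have e12 := e o1 o2 isT; apply/matrixP; apply: ord3P; apply: ord3P;
    rewrite !mxE /= ?d ?e01 ?e02 ?e12; ring.
rewrite act2_lin; apply: inR_lin; first exact: R.
rewrite act2_lin; apply: inR_lin; first exact: R.
rewrite act2_lin; apply: inR_lin; first exact: R.
by rewrite act2_0; apply: inR0.
Qed.

Lemma act2_mull f h (A : 'M_3) t :
  act2 f (algmx H A *m h) t = A *m act2 f h t *m A^T.
Proof.
have E a b : fmul2 f (algmx H A *m h) a b = A *m fmul2 f h a b *m A^T.
  apply/matrixP => i j; rewrite mxE [RHS]mxE !algmxl mulr_suml linear_sum /=.
  under [RHS]eq_bigr => d _ do rewrite [(A *m _) i d]mxE mulr_suml.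
  rewrite exchange_big /=; apply: eq_bigr => c _.
  rewrite mulr_sumr linear_sum; apply: eq_bigr => d _.
  by rewrite -scalerAr -scalerAl !linearZ !mxE /= [RHS]mulrC.
rewrite /act2 mulmx_sumr mulmx_suml; apply: eq_bigr => a _.
rewrite mulmx_sumr mulmx_suml; apply: eq_bigr => b _.
by rewrite E -scalemxAr -scalemxAl.
Qed.

Lemma act2_mulr f h (B : 'M_3) t :
  act2 f (h *m algmx H B) t = act2 f h (B *m t *m B^T).
Proof.
have E a b : fmul2 f (h *m algmx H B) a b =
    \sum_c \sum_d (B c a * B d b) *: fmul2 f h c d.
  apply/matrixP => i j; rewrite mxE !algmxr mulr_suml linear_sum summxE.
  apply: eq_bigr => c _; rewrite mulr_sumr linear_sum summxE.
  apply: eq_bigr => d _; rewrite -scalerAr -scalerAl !linearZ !mxE /=.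
  by rewrite -[RHS]mulrA [RHS]mulrCA.
rewrite /act2; under eq_bigr => a _ do under eq_bigr => b _ do rewrite E scaler_sumr.
under eq_bigr => a _ do rewrite exchange_big /=.
rewrite exchange_big /=; apply: eq_bigr => c _.
under eq_bigr => a _ do under eq_bigr => b _ do rewrite scaler_sumr.
under eq_bigr => a _ do rewrite exchange_big /=.
rewrite exchange_big /=; apply: eq_bigr => d _.
rewrite !mxE scaler_suml exchange_big /=; apply: eq_bigr => b _.
rewrite !mxE mulr_suml scaler_suml; apply: eq_bigr => a _.
by rewrite scalerA; congr (_ *: _); ring.
Qed.

Section Conjugate.
Variables (U W : 'M[k]_3) (h : 'M[H]_3).
Hypotheses (UW : U *m W = 1%:M) (WU : W *m U = 1%:M) (hq : qrel h) (hc : mcoalg h).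
Let h' := algmx H W *m h *m algmx H U.

Lemma inRU_act2 f t : inRU q U t -> inRU q U (act2 f h' t).
Proof.
move=> tR; rewrite /inRU /h' act2_mulr act2_mull !mulmxA UW mul1mx -mulmxA.
by rewrite -trmx_mul UW trmx1 mulmx1; apply: inR_act2.
Qed.

Lemma conj_entry p r : h p r = \sum_i \sum_j (U p i * W j r) *: h' i j.
Proof.
have -> : h = algmx H U *m h' *m algmx H W.
  rewrite /h' !mulmxA -algmxM UW algmx1 mul1mx -mulmxA -algmxM UW algmx1.
  by rewrite mulmx1.
rewrite algmxr exchange_big /=; apply: eq_bigr => j _; rewrite algmxl scaler_sumr.
by apply: eq_bigr => i _; rewrite scalerA mulrC.
Qed.

Lemma diag_grouplike i : (forall j, i != j -> h' i j = 0) -> grouplike (h' i i).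
Proof.
have h'c : mcoalg h' by apply: mcoalg_conj.
move=> z; have [d e] := h'c i i; split; last by rewrite e eqxx.
by rewrite d (bigD1 i) //= big1 ?addr0 // => l li; rewrite z ?tens0l // eq_sym.
Qed.

(** A functional equal to 1 on one product of weights and to 0 on the others acts on tensors as the
    projection [cls_mask]; the relation space is therefore stable under all these projections and
    [diag_weights] applies. *)
Lemma distinct_weights : (forall p r, p != r -> h' p r = 0 /\ h' p p != h' r r) ->
  forall p r, p != r -> h p r = 0.
Proof.
move=> D p r pr; have gl i : grouplike (h' i i).
  by apply: diag_grouplike => j /D [].
pose cls i j := h' i i * h' j j.
have inj i j : h' i i = h' j j -> i = j.
  by have [-> //|/D [_ /eqP ne] /ne] := eqVneq i j.
have clsI i j l : cls i j = cls i l -> j = l.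
  by move=> /(grouplike_mulrI (gl i)) /inj.
have clsI' i j l : cls j i = cls l i -> j = l.
  by move=> /(grouplike_mulIr (gl i)) /inj.
have mask d t : inRU q U t -> inRU q U (cls_mask cls d t).
  move=> tR; have [[a [b dE]]|none] := pselect (exists a b, cls a b = d); last first.
    have -> : cls_mask cls d t = 0; last exact: inRU0.
    apply/matrixP => a b; rewrite !mxE; case: eqP => // e.
    by case: none; exists a, b.
  pose s := [seq e <- [seq cls c.1 c.2 | c <- enum {: 'I_3 * 'I_3}] | e != d].
  have [||| f [fd fs]] := @grouplike_sep _ _ d s.
  - by rewrite -dE; apply: grouplikeM.
  - by move=> e; rewrite mem_filter => /andP [_ /mapP [c _ ->]]; apply: grouplikeM.
  - by rewrite mem_filter eqxx.
  have -> : cls_mask cls d t = act2 f h' t; last exact: inRU_act2.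
  apply/matrixP => i j; rewrite act2E mxE (bigD1 i) //= [X in _ + X]big1 ?addr0; last first.
    move=> a' ai; rewrite big1 // => b' _.
    by rewrite (proj1 (D i a' _)) 1?eq_sym // mul0r linear0 mulr0.
  rewrite (bigD1 j) //= [X in _ + X]big1 ?addr0; last first.
    move=> b' bj.
    by rewrite (proj1 (D j b' _)) 1?eq_sym // mulr0 linear0 mulr0.
  have [e|ne] := eqVneq (cls i j) d.
    by rewrite -/(cls i j) e fd mulr1.
  rewrite -/(cls i j) fs ?mulr0 // mem_filter ne; apply/mapP.
  by exists (i, j) => //; rewrite mem_enum.
rewrite conj_entry big1 // => i _; rewrite big1 // => j _.
have [<-|/D [-> _]] := eqVneq i j; last by rewrite scaler0.
by rewrite (diag_weights char0 q0 q1 qN1 UW WU clsI clsI' mask) // scale0r.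
Qed.

End Conjugate.

End QuantumMatrix.

Lemma sum3_distinct (V : nmodType) (F : 'I_3 -> V) i j l :
  i != j -> j != l -> i != l -> \sum_m F m = F i + F l + F j.
Proof.
move=> ij jl il; rewrite (bigD1 i) //= (bigD1 l) /=; last by rewrite eq_sym.
rewrite (big_pred1 j) ?addrA // => m; move: i j l ij jl il m.
by do 3!apply: ord3P => //; do ?move=> _; apply: ord3P.
Qed.

(** Induction on the list: the value at a new grouplike is corrected by a functional that vanishes
    on the earlier ones. *)
Lemma grouplike_indicator (k : fieldType) (H : hopfAlgType k) (P : pred H) (s : seq H) :
  (forall e, e \in s -> grouplike e) ->
  exists f : {linear H -> k^o}, forall e, e \in s -> f e = (P e)%:R.
Proof.
elim: s => [|e s IHs] gs; first by exists (counit : {linear H -> k^o}).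
have gs' x : x \in s -> grouplike x by move=> xs; apply: gs; rewrite inE xs orbT.
have ge : grouplike e by apply: gs; rewrite inE eqxx.
have [f fs] := IHs gs'; have [es|es] := boolP (e \in s).
  by exists f => x; rewrite inE => /predU1P [->|]; apply: fs.
have [f' [f'e f's]] := grouplike_sep ge gs' es.
exists (f \+ (((P e)%:R - f e : k) \*: f'))%R.
move=> x; rewrite inE => /predU1P [->|xs] /=.
  by rewrite f'e -[_ *: 1]/(_ * 1) mulr1 addrC subrK.
by rewrite f's // scaler0 addr0 fs.
Qed.

(** * Two distinct weights *)

Section TwoWeights.
Variables (k : closedFieldType) (q : k) (H : hopfAlgType k).
Hypotheses (char0 : [pchar k] =i pred0) (q0 : q != 0) (q1 : q != 1) (qN1 : q != -1).
Variables (U W : 'M[k]_3) (h : 'M[H]_3).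
Hypotheses (UW : U *m W = 1%:M) (WU : W *m U = 1%:M) (hq : qrel q h) (hc : mcoalg h).
Let h' := algmx H W *m h *m algmx H U.
Hypotheses (h'd : h' o0 o0 = h' o1 o1) (h'n : h' o1 o1 != h' o2 o2)
  (h'z : forall p r, p != r -> (p, r) != (o0, o1) -> h' p r = 0).
Implicit Types t : 'M[k]_3.

Let g := h' o1 o1.
Let f := h' o2 o2.
Let a := h' o0 o1.

Lemma two_weights_g : grouplike g.
Proof. by apply: diag_grouplike => // j j1; apply: h'z. Qed.

Lemma two_weights_f : grouplike f.
Proof. by apply: diag_grouplike => // j j1; apply: h'z. Qed.

Lemma two_weights_a : gprimitive g a.
Proof.
have h'c : mcoalg h' by apply: mcoalg_conj.
rewrite /gprimitive /a (proj1 (h'c o0 o1)) sum3 h'd.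
by rewrite (h'z (p := o0) (r := o2)) // tens0l addr0.
Qed.

Definition even_part t : 'M[k]_3 :=
  \matrix_(i, j) if (i == o2) == (j == o2) then t i j else 0.

Lemma inRU_even_part t : inRU q U t -> inRU q U (even_part t).
Proof.
have gg := two_weights_g; have gf := two_weights_f.
(* The functional [p] separates the even products [g * g], [f * f] from the odd ones [g * f],
   [f * g]. Its values on products involving [a] are unknown, so [N] is the even projection only up
   to nilpotent terms. *)
have [|p pE] := @grouplike_indicator _ _ (fun e => e \in [:: g * g; f * f]) [:: g * g; f * f; g * f; f * g].
  by move=> e; rewrite !inE => /or4P [] /eqP ->; apply: grouplikeM.
have gfne : (g * f \in [:: g * g; f * f]) = false.
  rewrite !inE; apply/negbTE/norP; split; apply: contra_neq h'n.
    by move/(grouplike_mulrI gg).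
  by move/(grouplike_mulIr gf).
have fgne : (f * g \in [:: g * g; f * f]) = false.
  rewrite !inE; apply/negbTE/norP; split; apply: contra_neq h'n.
    by move/(grouplike_mulIr gg).
  by move/(grouplike_mulrI gf).
have p1 : p (g * g) = 1 by rewrite pE !inE eqxx.
have p2 : p (f * f) = 1 by rewrite pE !inE eqxx ?orbT.
have p3 : p (g * f) = 0 by have := pE (g * f); rewrite gfne => -> //; rewrite !inE eqxx ?orbT.
have p4 : p (f * g) = 0 by have := pE (f * g); rewrite fgne => -> //; rewrite !inE eqxx ?orbT.
have e02 : h' o0 o2 = 0 by apply: h'z.
have e10 : h' o1 o0 = 0 by apply: h'z.
have e12 : h' o1 o2 = 0 by apply: h'z.
have e20 : h' o2 o0 = 0 by apply: h'z.
have e21 : h' o2 o1 = 0 by apply: h'z.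
pose hE := (e02, e10, e12, e20, e21, h'd, mulr0, mul0r, linear0).
pose N := act2 p h'; pose b x y : k := p (x * y).
have Nlin := inRU_act2 UW hq p.
have NE s : [/\ N s o0 o0 = s o0 o0 + b g a * s o0 o1 + b a g * s o1 o0 + b a a * s o1 o1,
   N s o0 o1 = s o0 o1 + b a g * s o1 o1, N s o1 o0 = s o1 o0 + b g a * s o1 o1 &
   N s o1 o1 = s o1 o1].
  split; rewrite /N act2E !sum3 !hE -/g -/a -/f p1 -?/(b g a) -?/(b a g) -?/(b a a); ring.
have NE' s : [/\ N s o0 o2 = b a f * s o1 o2, N s o1 o2 = 0,
   N s o2 o0 = b f a * s o2 o1, N s o2 o1 = 0 & N s o2 o2 = s o2 o2].
  by split; rewrite /N act2E !sum3 !hE -/g -/a -/f ?p2 ?p3 ?p4 -?/(b a f) -?/(b f a); ring.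
move=> tR; pose t2 := N (N t); pose t3 := N t2; pose t4 := N t3.
have t2R : inRU q U t2 by exact/Nlin/Nlin.
have t3R : inRU q U t3 by apply: Nlin.
have t4R : inRU q U t4 by apply: Nlin.
(* On the even part [N] is unipotent of index 3, on the odd part nilpotent of
   index 2, and [x^2 (3 x^2 - 8 x + 6)] is [1] mod [(x - 1)^3] and [0] mod [x^2]. *)
have -> : even_part t = 3%:R *: t4 + (- 8%:R *: t3 + (6%:R *: t2 + 0)).
  have [a0 a1 a2 a3] := NE t; have [b0 b1 b2 b3] := NE (N t).
  have [c0 c1 c2 c3] := NE t2; have [d0 d1 d2 d3] := NE t3.
  have [a4 a5 a6 a7 a8] := NE' t; have [b4 b5 b6 b7 b8] := NE' (N t).
  have [c4 c5 c6 c7 c8] := NE' t2; have [d4 d5 d6 d7 d8] := NE' t3.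
  apply/matrixP; apply: ord3P; apply: ord3P; rewrite !mxE /= -/t4;
  rewrite ?(d0, d1, d2, d3, d4, d5, d6, d7, d8) -/t3
    ?(c0, c1, c2, c3, c4, c5, c6, c7, c8) -/t2
    ?(b0, b1, b2, b3, b4, b5, b6, b7, b8) ?(a0, a1, a2, a3, a4, a5, a6, a7, a8);
  ring.
by do 3!apply: inRU_lin => //; apply: inRU0.
Qed.

(** The sign change attached to the weight [f] preserves the relations, so it is diagonal and [f]
    lives on a single variable [m]. On the other two variables [h] is [g] times the identity plus
    [a] times a rank one matrix [Nm] of trace zero, which the commutation within a row and
    [gprimitive_sq] force to be strictly triangular up to order. *)
Lemma two_weights : exists m n, [/\ m != n,
  forall p r, p != r -> (p, r) != (m, n) -> h p r = 0 &
  h m n = 0 \/ h m m = h n n /\ gprimitive (h m m) (h m n)].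
Proof.
have two : 2%:R != 0 :> k by apply: two_neq0.
pose x (i : 'I_3) : k := if i == o2 then -1 else 1.
have x0 i : x i != 0.
  by rewrite /x; case: ifP => _; [rewrite oppr_eq0|]; apply: oner_neq0.
have sx t : inRU q U t -> inRU q U (\matrix_(i, j) (x i * x j * t i j)).
  move=> tR; have -> : \matrix_(i, j) (x i * x j * t i j) = 2%:R *: even_part t + (-1 *: t + 0).
    apply/matrixP => i j; rewrite !mxE /x.
    by case: (i == o2); case: (j == o2) => /=; ring.
  apply: inRU_lin; first exact: inRU_even_part.
  by apply: inRU_lin => //; apply: inRU0.
have key p r : p != r -> U p o2 * W o2 r = 0.
  move=> pr; have := diag_aut q1 qN1 UW WU x0 sx pr.
  have : (U *m W) p r = 0 by rewrite UW mxE (negbTE pr).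
  rewrite mxE !sum3 /x /= !mul1r mulN1r => e1 e2.
  have : 2%:R * (U p o2 * W o2 r) = 0.
    by rewrite -[RHS](subrr 0) -{1}e1 -e2; ring.
  by move/eqP; rewrite mulf_eq0 (negbTE two) /= => /eqP.
have dot i j : \sum_l W i l * U l j = (i == j)%:R.
  by have /matrixP /(_ i j) := WU; rewrite !mxE.
have [m Um] : exists m, U m o2 != 0.
  apply: contrapT => /forallNP z; have := dot o2 o2; rewrite big1 ?eqxx; last first.
    by move=> l _; case: (eqVneq (U l o2) 0) => [->|/z //]; rewrite mulr0.
  by move/eqP; rewrite eq_sym oner_eq0.
have Wz r : r != m -> W o2 r = 0.
  rewrite eq_sym => /key /eqP; rewrite mulf_eq0 (negbTE Um) /=.
  by move/eqP.
have Wm : W o2 m * U m o2 = 1.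
  have := dot o2 o2; rewrite (bigD1 m) //= big1 ?addr0 // => l lm.
  by rewrite Wz ?mul0r.
have Wm0 : W o2 m != 0.
  by apply: contra_eq_neq Wm => ->; rewrite mul0r eq_sym oner_eq0.
have Uz p : p != m -> U p o2 = 0.
  by move=> pm; have /eqP := key p m pm; rewrite mulf_eq0 (negbTE Wm0) orbF => /eqP.
have U0 : U m o0 = 0.
  have := dot o2 o0; rewrite (bigD1 m) //= big1 ?addr0; last first.
    by move=> l lm; rewrite Wz ?mul0r.
  by move/eqP; rewrite mulf_eq0 (negbTE Wm0) => /eqP.
have W1 : W o1 m = 0.
  have := dot o1 o2; rewrite (bigD1 m) //= big1 ?addr0; last first.
    by move=> l lm; rewrite Uz ?mulr0.
  by move/eqP; rewrite mulf_eq0 (negbTE Um) orbF => /eqP.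
pose Nm p r := U p o0 * W o1 r.
have hE p r : h p r = ((p == r)%:R - U p o2 * W o2 r) *: g + Nm p r *: a
    + (U p o2 * W o2 r) *: f.
  rewrite (conj_entry h UW) -/h' !sum3.
  rewrite (h'z (p := o0) (r := o2)) // (h'z (p := o1) (r := o0)) //.
  rewrite (h'z (p := o1) (r := o2)) // (h'z (p := o2) (r := o0)) //.
  rewrite (h'z (p := o2) (r := o1)) // h'd -/g -/f -/a !scaler0 !addr0 !add0r.
  have -> : (p == r)%:R - U p o2 * W o2 r = U p o0 * W o0 r + U p o1 * W o1 r.
    by have /matrixP /(_ p r) := UW; rewrite !mxE sum3 => <-; rewrite addrK.
  by rewrite scalerDl [X in _ = X + _]addrAC.
have hm0 r : r != m -> h m r = 0 /\ h r m = 0.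
  move=> rm; rewrite !hE /Nm U0 W1 (Wz _ rm) (Uz _ rm) !(mul0r, mulr0) !subr0.
  by rewrite [m == r]eq_sym (negbTE rm) !scale0r !addr0.
have [j jm] : exists j, j != m by move: (m); apply: ord3P; [exists o1|exists o0|exists o0].
have [l /(_ jm) [ml jl]] := exists_third j m.
have mj : m != j by rewrite eq_sym.
have lj : l != j by rewrite eq_sym.
have e3 := ord3_third jm ml jl.
have hjl p r : p != m -> r != m -> h p r = (p == r)%:R *: g + Nm p r *: a.
  by move=> pm rm; rewrite hE (Wz _ rm) mulr0 subr0 scale0r addr0.
have off p r : p != r -> (p, r) != (j, l) -> (p, r) != (l, j) -> h p r = 0.
  case: (e3 p) => ->; case: (e3 r) => ->; rewrite ?eqxx //.
  - by case: (hm0 _ jm).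
  - by case: (hm0 _ jm).
  - by rewrite eq_sym in ml; case: (hm0 _ ml).
  - by rewrite eq_sym in ml; case: (hm0 _ ml).
have lm : l != m by rewrite eq_sym.
have gg := two_weights_g; have pa := two_weights_a.
have rel p r : p != r -> exists c c', c != 0 /\ c' != 0 /\
    c *: (h p r * h p p) = c' *: (h p p * h p r) /\ c != c'.
  rewrite -val_eqE neq_ltn => /orP [pr|rp]; [exists 1, q|exists q, 1];
    rewrite oner_neq0 q0 ?[1 == q]eq_sym q1 !scale1r; do !split=> //.
    exact: hq.1.
  by rewrite -hq.1.
have [a0|a0] := eqVneq a 0.
  exists j, l; split=> // [p r pr ne|]; last first.
    by left; rewrite hjl // a0 scaler0 (negbTE jl) scale0r addr0.
  have [[-> ->]|ne'] := eqVneq (p, r) (l, j); last exact: off.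
  by rewrite hjl // a0 scaler0 (negbTE lj) scale0r addr0.
(* If both coefficients were nonzero, the commutation of [h p r] with [h p p] could be solved for
   [a * a] in terms of [g * a] and [a * g]; the constants given to [gprimitive_sq] are those of the
   solution. *)
have k0 p r : p != r -> p != m -> r != m -> Nm p p * Nm p r = 0.
  move=> pr pm rm; apply/eqP; apply: contraT.
  rewrite mulf_eq0 negb_or => /andP [n1 n2].
  have [c [c' [c0 [c'0 [e cc]]]]] := rel _ _ pr.
  move: e; rewrite !hjl // eqxx (negbTE pr) scale0r scale1r add0r.
  move: n1 n2; move: (Nm p p) (Nm p r) => u v n1 n2.
  rewrite mulrDr mulrDl -!scalerAl -!scalerAr !scalerDr !scalerA => e.
  case/eqP: a0; apply: (@gprimitive_sq _ _ g a (c' * v / ((c - c') * v * u))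
     (- (c * v) / ((c - c') * v * u))) => //.
  have nz : (c - c') * v * u != 0 by rewrite !mulf_eq0 !negb_or subr_eq0 cc n2 n1.
  apply: (scalerI nz); rewrite scalerDr !scalerA ![_ * (_ / _)]mulrC !mulfVK //.
  have -> : ((c - c') * v * u) *: (a * a) = (c * v * u) *: (a * a) - (c' * v * u) *: (a * a).
    by rewrite -scalerBl; congr (_ *: _); ring.
  have {}e : (c * v) *: (a * g) + (c * v * u) *: (a * a) =
      (c' * v) *: (g * a) + (c' * v * u) *: (a * a).
    by rewrite e; congr (_ + _ *: _); ring.
  by apply/eqP; rewrite subr_eq scaleNr addrAC -e addrC addKr.
(* Trace and determinant of [Nm] on j, l vanish, as it is a column of [U] times a row of [W] that
   annihilate each other. *)
have tr : Nm j j + Nm l l = 0.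
  have := dot o1 o0; rewrite (sum3_distinct _ jm ml jl) W1 mul0r addr0 => e.
  by rewrite -[RHS]e /Nm ![W _ _ * _]mulrC.
have sq : Nm j l * Nm l j = Nm j j * Nm l l by rewrite /Nm; ring.
have Njj : Nm j j = 0.
  apply/eqP; apply: contraT => nj; have /eqP := k0 _ _ jl jm lm.
  rewrite mulf_eq0 (negbTE nj) /= => /eqP z; move: sq; rewrite z mul0r.
  have -> : Nm l l = - Nm j j by apply/eqP; rewrite -addr_eq0 addrC tr.
  by move/esym/eqP; rewrite mulrN oppr_eq0 mulf_eq0 orbb (negbTE nj).
have Nll : Nm l l = 0 by move: tr; rewrite Njj add0r.
have hjj : h j j = g by rewrite hjl // eqxx Njj scale1r scale0r addr0.
have hll : h l l = g by rewrite hjl // eqxx Nll scale1r scale0r addr0.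
have gp (c : k) : gprimitive g (c *: a).
  by rewrite /gprimitive linearZ /= pa scalerDr tensZl tensZr.
have /eqP := sq; rewrite Njj mul0r mulf_eq0 => /orP [] /eqP z.
  exists l, j; split=> // [p r pr ne|]; last first.
    right; rewrite hjj hll; split=> //.
    by rewrite hjl // (negbTE lj) scale0r add0r.
  have [[-> ->]|ne'] := eqVneq (p, r) (j, l); last exact: off.
  by rewrite hjl // z scale0r (negbTE jl) scale0r addr0.
exists j, l; split=> // [p r pr ne|]; last first.
  right; rewrite hjj hll; split=> //.
  by rewrite hjl // (negbTE jl) scale0r add0r.
have [[-> ->]|ne'] := eqVneq (p, r) (l, j); last exact: off.
by rewrite hjl // z scale0r (negbTE lj) scale0r addr0.
Qed.

End TwoWeights.

Lemma sum_mul3 (R : pzSemiRingType) (I : finType) (F G K : I -> R) :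
  (\sum_a F a) * (\sum_b G b) * (\sum_c K c) =
  \sum_a \sum_b \sum_c F a * G b * K c.
Proof.
rewrite !mulr_suml; apply: eq_bigr => a _; rewrite [F a * _]mulr_sumr mulr_suml.
by apply: eq_bigr => b _; rewrite mulr_sumr.
Qed.

Lemma exchange_sum3 (V : nmodType) (I : finType) (F : I -> I -> I -> I -> I -> I -> V) :
  \sum_i \sum_j \sum_l \sum_a \sum_b \sum_c F i j l a b c =
  \sum_a \sum_b \sum_c \sum_i \sum_j \sum_l F i j l a b c.
Proof.
have E (G : I -> I -> I -> V) : \sum_i \sum_j \sum_l G i j l =
    \sum_(p : I * (I * I)) G p.1 p.2.1 p.2.2.
  by under eq_bigr => i _ do rewrite pair_big; rewrite pair_big.
rewrite !E; under eq_bigr => p _ do rewrite E.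
by rewrite exchange_big; apply: eq_bigr => p _; rewrite E.
Qed.

(** * The quantum determinant and its commutation rule *)

Section QuantumDeterminant.
Variables (k : closedFieldType) (q : k) (H : hopfAlgType k) (h : 'M[H]_3).
Hypotheses (q0 : q != 0) (coc : cocommutative H) (hq : qrel q h) (hc : mcoalg h).
Implicit Types (i j l p r s : 'I_3).

(* The coefficients of the superpotential of the quantum affine space. *)
Definition qcoef i j l : k :=
  match val i, val j, val l with
  | 2%N, 1%N, 0%N => 1
  | 2%N, 0%N, 1%N | 1%N, 2%N, 0%N => - q
  | 0%N, 2%N, 1%N | 1%N, 0%N, 2%N => q ^+ 2
  | 0%N, 1%N, 2%N => - q ^+ 3
  | _, _, _ => 0
  end.

(* The eigenvalues of the Nakayama automorphism. *)
Definition nak i : k := match val i with 0%N => q ^- 2 | 1%N => 1 | _ => q ^+ 2 end.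

Lemma nak_neq0 i : nak i != 0.
Proof.
by move: i; apply: ord3P; rewrite /nak /= ?invr_eq0 ?expf_neq0 ?oner_neq0.
Qed.

(** Moving the last index to the front costs a factor [nak]; this twist is the source of the
    commutation rule of [qdet]. *)
Lemma qcoef_cyclic i j l : qcoef i j l = nak l * qcoef l i j.
Proof.
have e : q ^- 2 * q ^+ 2 = 1 by rewrite mulVf // expf_neq0.
have e' : q ^- 2 * q ^+ 3 = q by rewrite exprS mulrCA e mulr1.
move: i j l; do 3!apply: ord3P;
  by rewrite /qcoef /nak /= ?mulrN ?mulr0 ?mul1r ?mulr1 ?e ?e' -?exprSr.
Qed.

Definition qform (t : 'M[k]_3) r s : H := \sum_j \sum_l t j l *: (h r j * h s l).

Lemma qformZ c t r s : qform (c *: t) r s = c *: qform t r s.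
Proof.
rewrite scaler_sumr; apply: eq_bigr => i _; rewrite scaler_sumr.
by apply: eq_bigr => j _; rewrite mxE scalerA.
Qed.

Lemma qform_rel t : inR q t -> (forall r, qform t r r = 0) /\
  forall r s, (r < s)%N -> qform t r s = - q *: qform t s r.
Proof.
move=> tR; have E (f : {linear H -> k^o}) r s : f (qform t r s) = act2 f h t r s.
  rewrite act2E linear_sum; apply: eq_bigr => j _; rewrite linear_sum.
  by apply: eq_bigr => l _; rewrite linearZ.
split=> [r|r s rs]; apply: functional_ext => f.
  by rewrite E linear0 (inR_act2 f hq tR).1.
by rewrite linearZ /= !E (inR_act2 f hq tR).2.
Qed.

Lemma inR_qcoefl i : inR q (\matrix_(j, l) qcoef i j l).
Proof.
split=> [j|j l jl]; rewrite !mxE.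
  by move: i j; do 2!apply: ord3P.
by move: i j l jl; do 3!apply: ord3P => //; rewrite /qcoef /= => _; ring.
Qed.

Lemma inR_qcoefr l : inR q (\matrix_(i, j) qcoef i j l).
Proof.
split=> [j|i j ij]; rewrite !mxE.
  by move: j l; do 2!apply: ord3P.
by move: l i j ij; do 3!apply: ord3P => //; rewrite /qcoef /= => _; ring.
Qed.

Definition qminor p r s : H :=
  \sum_i \sum_j \sum_l qcoef i j l *: (h p i * h r j * h s l).

Lemma qminorl p r s :
  qminor p r s = \sum_i h p i * qform (\matrix_(j, l) qcoef i j l) r s.
Proof.
apply: eq_bigr => i _; rewrite mulr_sumr; apply: eq_bigr => j _.
rewrite mulr_sumr; apply: eq_bigr => l _.
by rewrite mxE -scalerAr mulrA.
Qed.

Lemma qminorr p r s :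
  qminor p r s = \sum_l qform (\matrix_(i, j) qcoef i j l) p r * h s l.
Proof.
rewrite /qminor; under eq_bigr => i _ do rewrite exchange_big.
rewrite exchange_big /=; apply: eq_bigr => l _; rewrite mulr_suml.
apply: eq_bigr => i _; rewrite mulr_suml; apply: eq_bigr => j _.
by rewrite mxE -scalerAl.
Qed.

Definition qdet : H := qminor o2 o1 o0.

(** Fixing the first or the last index of [qcoef] yields a relation, so [qminor] satisfies the
    relations in its last two and in its first two indices; these express all its values through the
    one called [qdet]. *)
Lemma qminorE p r s : qminor p r s = qcoef p r s *: qdet.
Proof.
have z1 a b : qminor a b b = 0.
  by rewrite qminorl big1 // => i _; rewrite (qform_rel (inR_qcoefl i)).1 mulr0.
have z2 a b : qminor a a b = 0.
  by rewrite qminorr big1 // => i _; rewrite (qform_rel (inR_qcoefr i)).1 mul0r.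
have s1 (a b c : 'I_3) : (b < c)%N -> qminor a b c = - q *: qminor a c b.
  move=> bc; rewrite !qminorl scaler_sumr; apply: eq_bigr => i _.
  by rewrite (qform_rel (inR_qcoefl i)).2 // -scalerAr.
have s2 (a b c : 'I_3) : (a < b)%N -> qminor a b c = - q *: qminor b a c.
  move=> bc; rewrite !qminorr scaler_sumr; apply: eq_bigr => i _.
  by rewrite (qform_rel (inR_qcoefr i)).2 // -scalerAl.
have z3 a b : qminor a b a = 0.
  have [ab|ba|/val_inj -> //] := ltngtP a b; first by rewrite s2 // z1 scaler0.
  by rewrite s1 // z2 scaler0.
have e201 : qminor o2 o0 o1 = - q *: qdet by rewrite s1.
have e120 : qminor o1 o2 o0 = - q *: qdet by rewrite s2.
have e021 : qminor o0 o2 o1 = q ^+ 2 *: qdet.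
  by rewrite s2 // e201 scalerA; congr (_ *: _); ring.
have e102 : qminor o1 o0 o2 = q ^+ 2 *: qdet.
  by rewrite s1 // e120 scalerA; congr (_ *: _); ring.
have e012 : qminor o0 o1 o2 = - q ^+ 3 *: qdet.
  by rewrite s1 // e021 scalerA; congr (_ *: _); ring.
move: p r s; do 3!apply: ord3P; rewrite ?z1 ?z2 ?z3 ?e201 ?e120 ?e021 ?e102 ?e012;
  by rewrite /qcoef /= ?scale0r ?scale1r.
Qed.

Lemma antipode_mull a c : \sum_b antipode (h a b) * h b c = (a == c)%:R.
Proof.
have [d e] := hc a c; have := antipodel (h a c); rewrite e d.
rewrite tlift_sum; last exact: Sl_bilinear.
by move=> ->; case: (a == c); rewrite ?scale1r ?scale0r.
Qed.

Lemma antipode_mulr a c : \sum_b h a b * antipode (h b c) = (a == c)%:R.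
Proof.
have [d e] := hc a c; have := antipoder (h a c); rewrite e d.
rewrite tlift_sum; last exact: Sr_bilinear.
by move=> ->; case: (a == c); rewrite ?scale1r ?scale0r.
Qed.

(** Cocommutativity allows the factors of the coproduct to be exchanged before the antipode axiom is
    used, which gives the identity for the transpose. *)
Lemma antipode_mulr_swap a c : \sum_b h b c * antipode (h a b) = (a == c)%:R.
Proof.
have [d e] := hc a c; have := antipoder (h a c); rewrite e -coc d linear_sum.
rewrite (eq_bigr (fun b => h b c ⊗ h a b)); last by move=> b _; apply: tswap_tens.
rewrite tlift_sum; last exact: Sr_bilinear.
by move=> ->; case: (a == c); rewrite ?scale1r ?scale0r.
Qed.

(** A form of the Cramer rule: multiplying [qminorE] by the antipode on the left strips the first
    factor of the cubic product. *)
Lemma qform_qdetl a r s : qform (\matrix_(j, l) qcoef a j l) r s =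
  \sum_p qcoef p r s *: (antipode (h a p) * qdet).
Proof.
under eq_bigr => p _ do rewrite scalerAr -qminorE qminorl mulr_sumr.
rewrite exchange_big /= (bigD1 a) //= [X in _ + X]big1 ?addr0.
  under eq_bigr => p _ do rewrite mulrA.
  by rewrite -mulr_suml antipode_mull eqxx mul1r.
move=> i ia; under eq_bigr => p _ do rewrite mulrA.
by rewrite -mulr_suml antipode_mull eq_sym (negbTE ia) mul0r.
Qed.

(** The same on the right. The sum to be collapsed runs over the row index of [h], hence the
    exchanged antipode identity. *)
Lemma qform_qdetr a p r : qform (\matrix_(i, j) qcoef i j a) p r =
  \sum_s qcoef p r s *: (qdet * antipode (h a s)).
Proof.
under eq_bigr => s _ do rewrite scalerAl -qminorE qminorr mulr_suml.
rewrite exchange_big /= (bigD1 a) //= [X in _ + X]big1 ?addr0.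
  under eq_bigr => s _ do rewrite -mulrA.
  by rewrite -mulr_sumr antipode_mulr_swap eqxx mulr1.
move=> i ia; under eq_bigr => s _ do rewrite -mulrA.
by rewrite -mulr_sumr antipode_mulr_swap eq_sym (negbTE ia) mulr0.
Qed.

(** Once [qcoef_cyclic] has moved the fixed index from the last place to the first, [qform_qdetr]
    and [qform_qdetl] evaluate the same expression, with [qdet] on opposite sides. *)
Lemma qdet_antipode a b :
  qdet * antipode (h a b) = (nak a / nak b) *: (antipode (h a b) * qdet).
Proof.
have E p r : \sum_s qcoef p r s *: (qdet * antipode (h a s)) =
    \sum_s qcoef p r s *: ((nak a / nak s) *: (antipode (h a s) * qdet)).
  rewrite -qform_qdetr.
  have -> : \matrix_(i, j) qcoef i j a = nak a *: \matrix_(i, j) qcoef a i j.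
    by apply/matrixP => i j; rewrite !mxE qcoef_cyclic.
  rewrite qformZ qform_qdetl scaler_sumr; apply: eq_bigr => s _.
  rewrite !scalerA (qcoef_cyclic p r s); congr (_ *: _).
  by field; apply: nak_neq0.
(* With [p] and [r] the two indices other than [b], a single term of each sum survives. *)
have [p [r [nz zero]]] : exists p r, qcoef p r b != 0 /\
    forall s, s != b -> qcoef p r s = 0.
  move: b {E}; apply: ord3P.
  - exists o2, o1; split; first exact: oner_neq0.
    by apply: ord3P.
  - exists o2, o0; split; first by rewrite /qcoef /= oppr_eq0.
    by apply: ord3P.
  - exists o1, o0; split; first by rewrite /qcoef /= expf_neq0.
    by apply: ord3P.
have := E p r; rewrite (bigD1 b) //= big1 ?addr0; last by move=> s sb; rewrite zero ?scale0r.
rewrite (bigD1 b) //= big1 ?addr0; last by move=> s sb; rewrite zero ?scale0r.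
exact: scalerI.
Qed.

Lemma qdet_nak a d : qdet * h a d = (nak a / nak d) *: (h a d * qdet).
Proof.
have E c : \sum_b (nak a / nak b) *: (h a b * (qdet * antipode (h b c))) =
    (a == c)%:R *: qdet.
  transitivity ((nak a / nak c) *: ((\sum_b h a b * antipode (h b c)) * qdet)).
    rewrite mulr_suml scaler_sumr; apply: eq_bigr => b _.
    rewrite qdet_antipode -scalerAr scalerA; congr (_ *: _); last exact: mulrA.
    by field; rewrite !nak_neq0.
  rewrite antipode_mulr; have [->|_] := eqVneq a c.
    by rewrite mul1r mulfV ?nak_neq0.
  by rewrite mul0r scaler0 scale0r.
have := erefl (\sum_c ((a == c)%:R *: qdet) * h c d).
rewrite {1}(bigD1 a) //= eqxx scale1r big1 ?addr0; last first.
  by move=> c ca; rewrite eq_sym (negbTE ca) scale0r mul0r.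
move=> ->; under eq_bigr => c _ do rewrite -E mulr_suml.
rewrite exchange_big (bigD1 d) //= [X in _ + X]big1 ?addr0; last first.
  move=> b bd; transitivity ((nak a / nak b) *: (h a b * (qdet *
     (\sum_c antipode (h b c) * h c d)))).
    rewrite !mulr_sumr scaler_sumr; apply: eq_bigr => c _.
    by rewrite -scalerAl !mulrA.
  by rewrite antipode_mull (negbTE bd) !mulr0 scaler0.
transitivity ((nak a / nak d) *: (h a d * (qdet *
     (\sum_c antipode (h d c) * h c d)))).
  rewrite !mulr_sumr scaler_sumr; apply: eq_bigr => c _.
  by rewrite -scalerAl !mulrA.
by rewrite antipode_mull eqxx mulr1.
Qed.

(** The second tensor factors of the coproduct assemble into [qminor a b c], which [qminorE]
    replaces by a scalar times [qdet]. *)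
Lemma qdet_grouplike : grouplike qdet.
Proof.
split.
  transitivity (\sum_a \sum_b \sum_c (h o2 a * h o1 b * h o0 c) ⊗ qminor a b c).
    have e i j l : comul (h o2 i * h o1 j * h o0 l) = \sum_a \sum_b \sum_c
        (h o2 a * h o1 b * h o0 c) ⊗ (h a i * h b j * h c l).
      rewrite !rmorphM /= (proj1 (hc o2 i)) (proj1 (hc o1 j)) (proj1 (hc o0 l)).
      apply: etrans (sum_mul3 _ _ _) _; apply: eq_bigr => a _.
      by apply: eq_bigr => b _; apply: eq_bigr => c _; rewrite !tensM.
    rewrite /qdet {1}/qminor linear_sum.
    transitivity (\sum_i \sum_j \sum_l \sum_a \sum_b \sum_c qcoef i j l *:
        ((h o2 a * h o1 b * h o0 c) ⊗ (h a i * h b j * h c l))).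
      apply: eq_bigr => i _; rewrite linear_sum; apply: eq_bigr => j _.
      rewrite linear_sum; apply: eq_bigr => l _; rewrite linearZ /= e.
      rewrite scaler_sumr; apply: eq_bigr => a _; rewrite scaler_sumr.
      by apply: eq_bigr => b _; rewrite scaler_sumr.
    rewrite exchange_sum3; apply: eq_bigr => a _; apply: eq_bigr => b _.
    apply: eq_bigr => c _; rewrite tens_sumr; apply: eq_bigr => i _.
    rewrite tens_sumr; apply: eq_bigr => j _; rewrite tens_sumr.
    by apply: eq_bigr => l _; rewrite tensZr.
  apply: esym; rewrite {1}/qdet {1}/qminor tens_suml; apply: eq_bigr => a _.
  rewrite tens_suml; apply: eq_bigr => b _; rewrite tens_suml.
  by apply: eq_bigr => c _; rewrite qminorE tensZr tensZl.
rewrite /qdet /qminor; have ce i j : (counit (h i j) : k) = (i == j)%:R := (hc i j).2.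
transitivity (\sum_i \sum_j \sum_l
    qcoef i j l * ((o2 == i)%:R * (o1 == j)%:R * (o0 == l)%:R)).
  rewrite /qdet /qminor linear_sum; apply: eq_bigr => i _.
  rewrite linear_sum; apply: eq_bigr => j _; rewrite linear_sum.
  by apply: eq_bigr => l _; rewrite linearZ !rmorphM /= !ce.
by rewrite !sum3 /qcoef /=; ring.
Qed.

Section Conjugate.
Variables (U W : 'M[k]_3) (g : H).
Hypotheses (UW : U *m W = 1%:M) (WU : W *m U = 1%:M).
Let h' := algmx H W *m h *m algmx H U.
Hypotheses (up : forall p r, (r < p)%N -> h' p r = 0) (dg : forall p, h' p p = g).

Lemma conj_slot (F : 'I_3 -> H) i :
  \sum_p W i p *: (\sum_x h p x * F x) = \sum_a h' i a * (\sum_x W a x *: F x).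
Proof.
have e : algmx H W *m h = h' *m algmx H W.
  by rewrite /h' -!mulmxA -algmxM UW algmx1 mulmx1.
transitivity (\sum_x (algmx H W *m h) i x * F x).
  under eq_bigr => p _ do rewrite scaler_sumr.
  rewrite exchange_big; apply: eq_bigr => x _; rewrite algmxl mulr_suml.
  by apply: eq_bigr => p _; rewrite scalerAl.
rewrite e; under [RHS]eq_bigr => a _ do rewrite mulr_sumr.
rewrite exchange_big; apply: eq_bigr => x _ /=; rewrite algmxr mulr_suml.
by apply: eq_bigr => a _; rewrite -scalerAl scalerAr.
Qed.

Lemma unconj (V : lmodType k) (F : 'I_3 -> V) p :
  \sum_i U p i *: (\sum_r W i r *: F r) = F p.
Proof.
under eq_bigr => i _ do rewrite scaler_sumr.
have E r : \sum_i U p i *: (W i r *: F r) = (p == r)%:R *: F r.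
  under eq_bigr => i _ do rewrite scalerA.
  by rewrite -scaler_suml; have /matrixP /(_ p r) := UW; rewrite !mxE => ->.
rewrite exchange_big /=; under eq_bigr => r _ do rewrite E.
rewrite (bigD1 p) //= eqxx scale1r big1 ?addr0 // => r rp.
by rewrite eq_sym (negbTE rp) scale0r.
Qed.

(** In the new basis the superpotential has coefficients [w]. At a triple with [w] nonzero and
    largest index sum, triangularity admits only larger indices and maximality discards all of them
    but the triple itself; there [w] times [qdet] equals [w] times [g * g * g]. *)
Lemma qdet_triangular : qdet = g * g * g.
Proof.
pose w i j l : k := \sum_p W i p * (\sum_r W j r * (\sum_s W l s * qcoef p r s)).
pose T i j l : H :=
  \sum_p W i p *: (\sum_r W j r *: (\sum_s W l s *: qminor p r s)).
have Tw i j l : T i j l = w i j l *: qdet.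
  rewrite scaler_suml; apply: eq_bigr => p _; rewrite -scalerA scaler_suml.
  congr (_ *: _); apply: eq_bigr => r _; rewrite -scalerA scaler_suml.
  by congr (_ *: _); apply: eq_bigr => s _; rewrite -scalerA qminorE.
have push (A : 'I_3 -> H) (c : 'I_3 -> k) (Y : 'I_3 -> 'I_3 -> H) :
    \sum_s c s *: (\sum_x A x * Y x s) = \sum_x A x * (\sum_s c s *: Y x s).
  under eq_bigr => s _ do rewrite scaler_sumr.
  rewrite exchange_big; apply: eq_bigr => x _; rewrite mulr_sumr.
  by apply: eq_bigr => s _; rewrite scalerAr.
have Th i j l : T i j l =
    \sum_a h' i a * (\sum_b h' j b * (\sum_c h' l c * (w a b c)%:A)).
  have mE p r s : qminor p r s =
      \sum_x h p x * (\sum_y h r y * (\sum_z h s z * (qcoef x y z)%:A)).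
    apply: eq_bigr => x _; rewrite mulr_sumr; apply: eq_bigr => y _.
    rewrite !mulr_sumr; apply: eq_bigr => z _.
    by rewrite -!scalerAr mulr1 mulrA.
  transitivity (\sum_p W i p *: (\sum_x h p x * (\sum_r W j r *: (\sum_y h r y *
      (\sum_s W l s *: (\sum_z h s z * (qcoef x y z)%:A)))))).
    apply: eq_bigr => p _; congr (_ *: _); rewrite -push; apply: eq_bigr => r _.
    congr (_ *: _); under [RHS]eq_bigr => x _ do rewrite -push.
    by rewrite -push; apply: eq_bigr => s _; rewrite mE.
  rewrite conj_slot; apply: eq_bigr => a _; congr (_ * _).
  under eq_bigr => x _ do rewrite conj_slot.
  rewrite push; apply: eq_bigr => b _; congr (_ * _).
  under eq_bigr => x _ do under eq_bigr => y _ do rewrite conj_slot.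
  under eq_bigr => x _ do rewrite push.
  rewrite push; apply: eq_bigr => c _; congr (_ * _).
  rewrite scaler_suml; apply: eq_bigr => x _; rewrite -scalerA scaler_suml.
  congr (_ *: _); apply: eq_bigr => y _; rewrite -scalerA scaler_suml.
  by congr (_ *: _); apply: eq_bigr => z _; rewrite -scalerA.
(* If [w] were zero, undoing the change of basis would give [qdet = 0], which no grouplike
   allows. *)
have [t0 wt0] : exists t : 'I_3 * ('I_3 * 'I_3), w t.1 t.2.1 t.2.2 != 0.
  apply: contrapT => /forallNP z.
  have w0 i j l : w i j l = 0.
    by apply/eqP; apply: contraT => nz; case: (z (i, (j, l))).
  have T0 i j l : T i j l = 0 by rewrite Tw w0 scale0r.
  have z1 p j l : \sum_r W j r *: (\sum_s W l s *: qminor p r s) = 0.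
    rewrite -(unconj (fun p => \sum_r W j r *: (\sum_s W l s *: qminor p r s)) p).
    by rewrite big1 // => i _; rewrite -/(T i j l) T0 scaler0.
  have z2 p r l : \sum_s W l s *: qminor p r s = 0.
    rewrite -(unconj (fun r => \sum_s W l s *: qminor p r s) r).
    by rewrite big1 // => j _; rewrite z1 scaler0.
  have := grouplike_neq0 qdet_grouplike; rewrite /qdet.
  rewrite -(unconj (fun s => qminor o2 o1 s) o0) big1 ?eqxx // => l _.
  by rewrite z2 scaler0.
have [t wt tmax] := @arg_maxnP _ t0 (fun t => w t.1 t.2.1 t.2.2 != 0)
  (fun t => t.1 + t.2.1 + t.2.2)%N wt0.
have big (F : 'I_3 -> H) i : (forall a : 'I_3, (i < a)%N -> F a = 0) ->
    \sum_a h' i a * F a = g * F i.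
  move=> z; rewrite (bigD1 i) //= dg big1 ?addr0 // => a ai.
  have [ia|] := ltnP i a; first by rewrite z ?mulr0.
  by rewrite leq_eqVlt val_eqE (negbTE ai) => /up ->; rewrite mul0r.
have wz (a b c : 'I_3) : (t.1 + t.2.1 + t.2.2 < a + b + c)%N -> w a b c = 0.
  move=> lt; apply/eqP; apply: contraT => nz.
  by have := tmax (a, (b, c)) nz; rewrite /= leqNgt lt.
have := Th t.1 t.2.1 t.2.2; rewrite Tw (big (fun a => \sum_b _)); last first.
  move=> a ai; rewrite big1 // => b _.
  have [bj|bj] := ltnP b t.2.1; first by rewrite up // mul0r.
  rewrite big1 ?mulr0 // => c _.
  have [cl|cl] := ltnP c t.2.2; first by rewrite up // mul0r.
  rewrite wz ?scale0r ?mulr0 //.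
  by rewrite -addnA -[X in (_ < X)%N]addnA -addSn leq_add // leq_add.
rewrite (big (fun b => \sum_c _)); last first.
  move=> b bj; rewrite big1 // => c _.
  have [cl|cl] := ltnP c t.2.2; first by rewrite up // mul0r.
  rewrite wz ?scale0r ?mulr0 //.
  by rewrite -addSn -addnS leq_add // leq_add.
rewrite (big (fun c => _)); last first.
  by move=> c cl; rewrite wz ?scale0r // ltn_add2l.
rewrite -!scalerAr mulr1 mulrA => /(scalerI wt) ->.
by [].
Qed.

End Conjugate.

End QuantumDeterminant.

(** * A single weight *)

Section OneWeight.
Variables (k : closedFieldType) (q : k) (H : hopfAlgType k) (h : 'M[H]_3).
Hypotheses (char0 : [pchar k] =i pred0) (q0 : q != 0) (q1 : q != 1) (qN1 : q != -1).
Hypotheses (coc : cocommutative H) (hq : qrel q h) (hc : mcoalg h).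
Variables (U W : 'M[k]_3) (g : H).
Hypotheses (UW : U *m W = 1%:M) (WU : W *m U = 1%:M).
Let h' := algmx H W *m h *m algmx H U.
Hypotheses (up : forall p r : 'I_3, (r < p)%N -> h' p r = 0) (dg : forall p, h' p p = g).
Implicit Types (i j p r : 'I_3) (s : 'I_3 -> k).

Let gg : grouplike g.
Proof.
rewrite -(dg o2); apply: diag_grouplike => // j j2; apply: up.
by move: j j2; apply: ord3P.
Qed.

Let DE : qdet q h = g * g * g.
Proof. exact: (qdet_triangular hq hc UW up dg). Qed.

Let gD : grouplike (qdet q h).
Proof. exact: (qdet_grouplike hq hc). Qed.

Let gDcomm : qdet q h * g = g * qdet q h.
Proof. by rewrite DE !mulrA. Qed.

Let q2 : q ^+ 2 != 1.
Proof. by rewrite sqrf_eq1 negb_or q1 qN1. Qed.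

(** Coefficient vectors of linear forms spanning a one-dimensional subcomodule with coefficient [g];
    [rsocle] describes the one-dimensional quotients in the same way. *)
Definition socle s := forall i, \sum_j s j *: h i j = s i *: g.
Definition rsocle s := forall j, \sum_p s p *: h p j = s j *: g.

Lemma socle_col : socle (fun i => U i o0).
Proof.
move=> i; rewrite -algmxr.
have -> : h *m algmx H U = algmx H U *m h'.
  by rewrite /h' !mulmxA -algmxM UW algmx1 mul1mx.
rewrite algmxl (bigD1 o0) //= dg big1 ?addr0 // => l l0.
by rewrite up ?scaler0 //; move: l l0; apply: ord3P.
Qed.

Lemma rsocle_row : rsocle (fun p => W o2 p).
Proof.
move=> j; rewrite -algmxl.
have -> : algmx H W *m h = h' *m algmx H W.
  by rewrite /h' -!mulmxA -algmxM UW algmx1 mulmx1.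
rewrite algmxr (bigD1 o2) //= dg big1 ?addr0 // => l l0.
by rewrite up ?scaler0 //; move: l l0; apply: ord3P.
Qed.

Lemma socle_lin c s s' : socle s -> socle s' -> socle (fun i => c * s i + s' i).
Proof.
move=> hs hs' i; rewrite scalerDl -scalerA -hs -hs' scaler_sumr -big_split.
by apply: eq_bigr => j _; rewrite scalerDl scalerA.
Qed.

(** As [qdet] commutes with [g], and with [h] up to [nak], the diagonal Nakayama matrix acts on the
    socle, which therefore splits along the eigenvalues. *)
Lemma socle_nak s : socle s -> socle (fun i => (nak q i)^-1 * s i).
Proof.
move=> hs i; apply: (grouplike_mulIr gD).
rewrite /= -scalerAl -gDcomm -scalerA scalerAr -hs mulr_suml [in RHS]mulr_sumr scaler_sumr.
apply: eq_bigr => j _; rewrite -scalerAr (qdet_nak q0 coc hq hc) -scalerAl !scalerA.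
by congr (_ *: _); field; rewrite !nak_neq0.
Qed.

Lemma rsocle_nak s : rsocle s -> rsocle (fun i => nak q i * s i).
Proof.
move=> hs j; apply: (grouplike_mulIr gD).
rewrite /= -scalerAl -gDcomm -scalerA scalerAr -hs mulr_suml [in RHS]mulr_sumr scaler_sumr.
apply: eq_bigr => p _; rewrite -scalerAr (qdet_nak q0 coc hq hc) -scalerAl !scalerA.
by congr (_ *: _); field; rewrite !nak_neq0.
Qed.

(** Since [qdet = g * g * g], the hypothesis moves [h p j] past [qdet] with the factor [c ^+ 3], and
    [qdet_nak] does so with another factor; the two are compatible only for zero. *)
Lemma gcomm_eq0 c p j : h p j * g = c *: (g * h p j) ->
  nak q p / nak q j * c ^+ 3 != 1 -> h p j = 0.
Proof.
move=> e ne; have := qdet_nak q0 coc hq hc p j; rewrite DE.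
have -> : h p j * (g * g * g) = c ^+ 3 *: (g * g * g * h p j).
  rewrite !mulrA e -!scalerAl -[g * h p j * g]mulrA e -!scalerAr -!scalerAl.
  rewrite -[g * (g * h p j) * g]mulrA -[g * h p j * g]mulrA e -!scalerAr !scalerA.
  by rewrite !mulrA; congr (_ *: _); ring.
rewrite scalerA => /eqP; rewrite -subr_eq0 -{1}[g * g * g * h p j]scale1r -scalerBl.
rewrite scaler_eq0 subr_eq0 eq_sym (negbTE ne) /= => /eqP e'.
have gD' := gD; rewrite DE in gD'.
by apply: (grouplike_mulrI gD'); rewrite e' mulr0.
Qed.

(** Column [m] of [h] is [g] at [m] and zero elsewhere, so [qrel] makes the remaining off-diagonal
    entries commute with [g] up to a power of [q]. The factor tested in [gcomm_eq0] is then always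
    [q], [q ^+ 2] or one of their inverses, never 1. *)
Lemma socle_coord_diag m : socle (fun i => (i == m)%:R) ->
  forall p r, p != r -> h p r = 0.
Proof.
move=> hs; have col i : h i m = (i == m)%:R *: g.
  rewrite -hs (bigD1 m) //= eqxx scale1r big1 ?addr0 // => j /negbTE ->.
  by rewrite scale0r.
have [r1 r2] := hq; have q2' : q ^+ 2 != 0 by rewrite expf_neq0.
have Vq x y : x = q *: y -> y = q^-1 *: x :> H.
  by move=> ->; rewrite scalerA mulVf // scale1r.
have nk0 : nak q o0 = q ^- 2 by []. have nk1 : nak q o1 = 1 by [].
have nk2 : nak q o2 = q ^+ 2 by [].
elim/ord3P: m hs col => hs col; have c0 := col o0; have c1 := col o1;
  have c2 := col o2; rewrite /= ?scale0r ?scale1r in c0 c1 c2.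
- have k01 : h o0 o1 = 0.
    apply: (@gcomm_eq0 q); first by rewrite -c0 r1.
    rewrite nk0 nk1; have -> : q ^- 2 / 1 * q ^+ 3 = q by field; rewrite ?q0 ?oner_neq0.
    by [].
  have k02 : h o0 o2 = 0.
    apply: (@gcomm_eq0 q); first by rewrite -c0 r1.
    rewrite nk0 nk2; have -> : q ^- 2 / q ^+ 2 * q ^+ 3 = q^-1 by field; rewrite ?q0 ?oner_neq0.
    by rewrite invr_eq1.
  have cm (b j : 'I_3) : (0 < b)%N -> (0 < j)%N -> h b j * g = 1 *: (g * h b j).
    move=> b0 j0; have := r2 o0 b o0 j b0 j0; rewrite c0 (col b).
    rewrite (_ : (b == o0) = false) ?scale0r ?mulr0 ?mul0r ?scaler0 ?add0r ?addr0.
      by move/(scalerI q0); rewrite scale1r.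
    by apply/negbTE; rewrite -val_eqE -lt0n.
  have k12 : h o1 o2 = 0.
    apply: (gcomm_eq0 (cm o1 o2 isT isT)).
    by rewrite nk1 nk2 mul1r expr1n mulr1 invr_eq1.
  have k21 : h o2 o1 = 0.
    apply: (gcomm_eq0 (cm o2 o1 isT isT)).
    by rewrite nk1 nk2 divr1 expr1n mulr1.
  by apply: ord3P; apply: ord3P.
- have k12 : h o1 o2 = 0.
    apply: (@gcomm_eq0 q); first by rewrite -c1 r1.
    rewrite nk1 nk2; have -> : 1 / q ^+ 2 * q ^+ 3 = q by field; rewrite ?q0 ?oner_neq0.
    by [].
  have k10 : h o1 o0 = 0.
    apply: (@gcomm_eq0 q^-1); first by apply: Vq; rewrite -c1 r1.
    rewrite nk1 nk0; have -> : 1 / q ^- 2 * q^-1 ^+ 3 = q^-1 by field; rewrite ?q0 ?oner_neq0.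
    by rewrite invr_eq1.
  have k02 : h o0 o2 = 0.
    apply: (@gcomm_eq0 (q ^+ 2)).
      have := r2 o0 o1 o1 o2 isT isT; rewrite c0 c1 !(mulr0, mul0r, scaler0).
      by rewrite !(addr0, add0r).
    rewrite nk0 nk2; have -> : q ^- 2 / q ^+ 2 * q ^+ 2 ^+ 3 = q ^+ 2 by field; rewrite ?q0 ?oner_neq0.
    by [].
  have k20 : h o2 o0 = 0.
    apply: (@gcomm_eq0 (q ^- 2)).
      have := r2 o1 o2 o0 o1 isT isT; rewrite c2 c1 !(mulr0, mul0r, scaler0).
      by rewrite !(addr0, add0r) => ->; rewrite scalerA mulVf // scale1r.
    rewrite nk0 nk2; have -> : q ^+ 2 / q ^- 2 * q ^- 2 ^+ 3 = q ^- 2 by field; rewrite ?q0 ?oner_neq0.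
    by rewrite invr_eq1.
  by apply: ord3P; apply: ord3P.
have k20 : h o2 o0 = 0.
  apply: (@gcomm_eq0 q^-1); first by apply: Vq; rewrite -c2 r1.
  rewrite nk2 nk0; have -> : q ^+ 2 / q ^- 2 * q^-1 ^+ 3 = q by field; rewrite ?q0 ?oner_neq0.
  by [].
have k21 : h o2 o1 = 0.
  apply: (@gcomm_eq0 q^-1); first by apply: Vq; rewrite -c2 r1.
  rewrite nk2 nk1; have -> : q ^+ 2 / 1 * q^-1 ^+ 3 = q^-1 by field; rewrite ?q0 ?oner_neq0.
  by rewrite invr_eq1.
have cm (a i : 'I_3) : (a < 2)%N -> (i < 2)%N -> h a i * g = 1 *: (g * h a i).
  move=> a2 i2; have := r2 a o2 i o2 a2 i2; rewrite c2 (col a).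
  rewrite (_ : (a == o2) = false) ?scale0r ?mulr0 ?mul0r ?scaler0 ?add0r ?addr0.
    by move/(scalerI q0) ->; rewrite scale1r.
  by apply/negbTE; rewrite -val_eqE neq_ltn a2.
have k01 : h o0 o1 = 0.
  apply: (gcomm_eq0 (cm o0 o1 isT isT)).
  by rewrite nk0 nk1 divr1 expr1n mulr1 invr_eq1.
have k10 : h o1 o0 = 0.
  apply: (gcomm_eq0 (cm o1 o0 isT isT)).
  by rewrite nk1 nk0 mul1r invrK expr1n mulr1.
by apply: ord3P; apply: ord3P.
Qed.

Lemma socle_single m s : socle s -> s m != 0 -> (forall i, i != m -> s i = 0) ->
  socle (fun i => (i == m)%:R).
Proof.
move=> hs sm z i; apply: (scalerI sm).
have e j : s m * (j == m)%:R = s j.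
  by have [->|/z ->] := eqVneq j m; rewrite ?mulr1 ?mulr0.
rewrite scaler_sumr scalerA e -hs; apply: eq_bigr => j _.
by rewrite scalerA e.
Qed.

Lemma socle_nak_sub c s : socle s -> socle (fun i => ((nak q i)^-1 - c) * s i).
Proof.
move=> hs; have := socle_lin (- c) hs (socle_nak hs).
congr socle; apply/funext => i; rewrite mulrBl addrC mulNr.
by [].
Qed.

(** The three Nakayama eigenvalues are distinct here, so two factors of the form [nak^-1 - c] reduce
    a socle vector to one nonzero coordinate. *)
Lemma one_weight_generic : q ^+ 4 != 1 -> forall p r, p != r -> h p r = 0.
Proof.
move=> q4 p r pr.
have [m s0] : exists m, U m o0 != 0.
  apply: contrapT => /forallNP z; have /matrixP /(_ o0 o0) := WU.
  rewrite !mxE big1 => [/eqP|i _]; first by rewrite eq_sym oner_eq0.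
  by have [->|/z //] := eqVneq (U i o0) 0; rewrite mulr0.
have vE i j : i != j -> (nak q i)^-1 - (nak q j)^-1 != 0.
  rewrite subr_eq0 (inj_eq invr_inj) /nak.
  have q2V : q ^- 2 != 1 by rewrite invr_eq1.
  have q2n : q ^- 2 != q ^+ 2.
    apply: contra_neq q4 => e; rewrite -[q ^+ 4]/(q ^+ (2 + 2)) exprD -{1}e.
    by rewrite mulVf // expf_neq0.
  by move: i j; do 2!apply: ord3P; rewrite //= 1?eq_sym.
have [b [c [mb mc bc]]] : exists b c : 'I_3, [/\ m != b, m != c & b != c].
  by move: m {s0}; apply: ord3P; [exists o1, o2|exists o0, o2|exists o0, o1].
apply: (@socle_coord_diag m) pr.
have := socle_nak_sub (nak q c)^-1 (socle_nak_sub (nak q b)^-1 socle_col).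
move=> /(@socle_single m); apply=> [|i im].
  by rewrite !mulf_neq0 ?vE.
have [->|ib] := eqVneq i b; first by rewrite subrr mul0r mulr0.
have [->|ic] := eqVneq i c; first by rewrite subrr mul0r.
by move: im ib ic mb mc bc; move: i m b c {s0}; do 4!apply: ord3P.
Qed.

(** When q^2 = -1, x_0 and x_2 share a Nakayama eigenvalue and the socle may be spanned by x_0 + al
    x_2. A row of [rsocle] orthogonal to this vector supplies the missing equations: if its middle
    entry is nonzero it determines row [o1] of [h], otherwise it ties rows [o0] and [o2]
    together. *)
Lemma one_weight_special_col al : q ^+ 2 = -1 -> al != 0 ->
  (forall i, h i o0 + al *: h i o2 = (i == o0)%:R *: g + (al * (i == o2)%:R) *: g) ->
  (exists2 xi : 'I_3 -> k, rsocle xi & xi o0 + al * xi o2 = 0 /\ exists p, xi p != 0) ->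
  [/\ h o1 o0 = 0, h o0 o2 = 0 & h o2 o0 = 0].
Proof.
move=> qq al0 hs [xi hxi [orth [p xip]]].
have two : 2%:R != 0 :> k by rewrite ((pcharf0P k).1 char0).
have anti (x : H) : x = - x -> x = 0.
  move=> /eqP; rewrite -subr_eq0 opprK -mulr2n -scaler_nat scaler_eq0.
  by rewrite (negbTE two) => /eqP.
have [r1 r2] := hq.
have e0 := hs o0; have e1 := hs o1; have e2 := hs o2.
rewrite /= ?mulr0 ?mulr1 ?scale0r ?scale1r ?addr0 ?add0r in e0 e1 e2.
have h00 : h o0 o0 = g - al *: h o0 o2 by rewrite -e0 addrK.
have h10 : h o1 o0 = - al *: h o1 o2.
  by rewrite scaleNr; apply/eqP; rewrite -addr_eq0 e1.
have vn : q ^- 2 = -1 :> k by rewrite qq invrN1.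
case: (eqVneq (xi o1) 0) => [xi1|xi1]; last first.
  (* The Nakayama eigenvalues are -1, 1, -1, so [xi] plus its Nakayama image is twice its middle
     coordinate. *)
  have row j : h o1 j = (j == o1)%:R *: g.
    apply: (scalerI xi1); apply: (scalerI two); rewrite !scalerA.
    have := hxi j; have := rsocle_nak hxi j; rewrite !sum3 /nak /= vn qq => a b.
    have : xi o1 *: h o1 j + xi o1 *: h o1 j = (j == o1)%:R *: (xi o1 *: g + xi o1 *: g).
      move: (congr2 +%R a b); rewrite !mulN1r !mul1r !scaleNr addrACA addNr addr0.
      rewrite addrACA addNr add0r => ->.
      move: j {a b}; apply: ord3P; rewrite /= ?scale0r ?scale1r.
      - by rewrite mulN1r scaleNr addNr.
      - by rewrite mul1r.
      - by rewrite mulN1r scaleNr addNr.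
    rewrite -!mulr2n -!scaler_nat !scalerA => ->.
    by congr (_ *: _); rewrite -mulrA mulrC.
  have r10 := row o0; have r11 := row o1; have r12 := row o2.
  rewrite /= ?scale0r ?scale1r in r10 r11 r12.
  have k20 : h o2 o0 = 0.
    have := r2 o1 o2 o0 o1 isT isT; have := r2 o1 o2 o1 o2 isT isT.
    rewrite r10 r11 r12 !(mulr0, mul0r, scaler0, add0r, addr0) qq scaleN1r.
    move=> /(scalerI q0) a b; have h20 : h o2 o0 = al *: (g - h o2 o2).
      by rewrite scalerBr -e2 addrK.
    apply: (grouplike_mulrI gg); rewrite mulr0; apply: anti; rewrite {1}b h20.
    by rewrite -scalerAl -scalerAr mulrBl mulrBr a.
  split=> //.
  have := r2 o0 o1 o0 o1 isT isT; have := r2 o0 o1 o1 o2 isT isT.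
  rewrite r10 r11 r12 !(mulr0, mul0r, scaler0, add0r, addr0) qq scaleN1r => a.
  move/(scalerI q0); rewrite h00 mulrBl mulrBr => /addrI /oppr_inj.
  rewrite -scalerAl -scalerAr => /(scalerI al0); rewrite a => /anti b.
  by apply: (grouplike_mulrI gg); rewrite b mulr0.
have xi2 : xi o2 != 0.
  apply: contra_neq xip => z; move: orth; rewrite z mulr0 addr0 => z0.
  by move: p; apply: ord3P.
have xi0 : xi o0 = - al * xi o2 by apply/eqP; rewrite mulNr -addr_eq0 orth.
have row j : h o2 j - al *: h o0 j = (j == o2)%:R *: g - (al * (j == o0)%:R) *: g.
  apply: (scalerI xi2); have := hxi j; rewrite sum3 xi0 xi1 scale0r addr0.
  rewrite scalerBr !scalerA mulNr scaleNr addrC [xi o2 * al]mulrC => ->.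
  rewrite scalerBr !scalerA; move: j; apply: ord3P; rewrite /= ?xi0 ?xi1.
  - by rewrite !mulr0 scale0r add0r mulr1 mulNr mulrC scaleNr.
  - by rewrite !mulr0 !scale0r subrr.
  - by rewrite !mulr0 mulr1 scale0r subr0.
have f1 := row o1; have f2 := row o2.
rewrite /= ?mulr0 ?mulr1 ?scale0r ?scale1r ?subr0 in f1 f2.
have h21 : h o2 o1 = al *: h o0 o1 by apply/eqP; rewrite -subr_eq0 f1.
have h22 : h o2 o2 = g + al *: h o0 o2 by rewrite -f2 subrK.
have d i j := (hc i j).1; have ct i j := (hc i j).2.
(* The two other terms of the coproduct cancel, as [h o1 o0] is [- al] times [h o1 o2] and [h o2 o1]
   is [al] times [h o0 o1]. *)
have g11 : grouplike (h o1 o1).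
  split; last by rewrite ct.
  rewrite d sum3 h10 h21 tensZl tensZr scaleNr addrAC addNr.
  by rewrite add0r.
have h12 : h o1 o2 = 0.
  have a := r1 o1 o0 o1 isT; have b := r1 o1 o1 o2 isT.
  rewrite h10 -scalerAr -scalerAl scalerA mulrC -scalerA in a.
  move: a; rewrite !scaleNr => /oppr_inj /(scalerI al0).
  rewrite b scalerA -expr2 qq scaleN1r => /anti z.
  by apply: (grouplike_mulrI g11); rewrite z mulr0.
suff k02 : h o0 o2 = 0.
  split=> //; first by rewrite h10 h12 scaler0.
  by move: e2; rewrite h22 k02 scaler0 addr0 -[RHS]add0r => /addIr.
(* The coefficients come from the commutation of [h o0 o2] with [h o0 o0], which is [g] minus [al]
   times [h o0 o2], solved for the square of [h o0 o2]. *)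
apply: (@gprimitive_sq _ _ g _ (q / (al * (q - 1))) (- (al * (q - 1))^-1)) => //.
  rewrite /gprimitive d sum3 h12 tens0r addr0 h00 h22 tensBl tensDr tensZl tensZr.
  by rewrite addrACA addNr addr0 addrC.
have := r1 o0 o0 o2 isT; rewrite h00 mulrBl mulrBr -scalerAl -scalerAr scalerBr.
move=> e; have c0 : al * (q - 1) != 0 by rewrite mulf_neq0 // subr_eq0.
apply: (scalerI c0); rewrite scalerDr !scalerA mulrN mulrCA mulfV // mulr1 scaleN1r.
move: e => /eqP; rewrite subr_eq addrAC => /eqP e.
rewrite e opprB opprD [RHS]addrCA [in RHS](addrA (q *: (g * _))) subrr add0r scalerA -scalerBl.
by congr (_ *: _); ring.
Qed.

Lemma one_weight p r : p != r -> h p r = 0.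
Proof.
case: (eqVneq (q ^+ 4) 1) => [q4|/one_weight_generic]; last exact.
have qq : q ^+ 2 = -1.
  apply/eqP; rewrite -addr_eq0; have : (q ^+ 2 - 1) * (q ^+ 2 + 1) = 0.
    by rewrite -subr_sqr expr1n -exprM q4 subrr.
  by move/eqP; rewrite mulf_eq0 subr_eq0 (negbTE q2).
have vn : q ^- 2 = -1 :> k by rewrite qq invrN1.
have two : 2%:R != 0 :> k by rewrite ((pcharf0P k).1 char0).
have hs := socle_col; set s := fun i => U i o0 in hs.
(* With eigenvalues -1, 1, -1, a nonzero middle coordinate can be isolated; a mixture of the outer
   two cannot and is left to [one_weight_special_col]. *)
have [s1|s1] := eqVneq (s o1) 0; last first.
  apply: (@socle_coord_diag o1); have := socle_nak_sub (-1) hs.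
  move/(@socle_single o1); apply.
    by rewrite /nak /= invr1 opprK mulf_neq0.
  by apply: ord3P; rewrite // /nak /= ?vn ?qq ?invrN1 subrr mul0r.
have [s0|s0] := eqVneq (s o0) 0.
  apply: (@socle_coord_diag o2); move: hs => /(@socle_single o2); apply.
    apply/eqP => s2; have /matrixP /(_ o0 o0) := WU; rewrite !mxE sum3.
    rewrite -/(s o0) -/(s o1) -/(s o2) s0 s1 s2 !mulr0 !addr0 => /eqP.
    by rewrite eq_sym oner_eq0.
  by apply: ord3P.
have [s2|s2] := eqVneq (s o2) 0.
  apply: (@socle_coord_diag o0); move: hs => /(@socle_single o0); apply => //.
  by apply: ord3P.
pose al := s o2 / s o0.
have sal : s o2 = s o0 * al by rewrite /al mulrCA mulfV // mulr1.
have col i : h i o0 + al *: h i o2 =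
    (i == o0)%:R *: g + (al * (i == o2)%:R) *: g.
  apply: (scalerI s0); have := hs i; rewrite sum3 s1 scale0r addr0 sal -scalerA.
  rewrite -scalerDr => ->; rewrite -scalerDl scalerA; congr (_ *: _).
  by move: i; apply: ord3P; rewrite /= ?s1 ?sal; ring.
have [||h10 h02 h20] := one_weight_special_col qq _ col.
- by rewrite mulf_neq0 // invr_neq0.
(* Orthogonality of the last row of [W] and the first column of [U] is an entry of
   [W *m U = 1%:M]. *)
- exists (fun p => W o2 p); first exact: rsocle_row.
  split.
    have /matrixP /(_ o2 o0) := WU; rewrite !mxE sum3 -/(s o0) -/(s o1) -/(s o2).
    rewrite s1 mulr0 addr0 => e; apply: (mulfI s0).
    by rewrite mulr0 -[RHS]e sal; ring.
  apply: contrapT => /forallNP z; have /matrixP /(_ o2 o2) := WU.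
  rewrite !mxE big1 => [/eqP|i _]; first by rewrite eq_sym oner_eq0.
  by have [->|/z //] := eqVneq (W o2 i) 0; rewrite mul0r.
apply: (@socle_coord_diag o0) => i; rewrite (bigD1 o0) //= scale1r.
rewrite big1 ?addr0 => [|j /negbTE ->]; last exact: scale0r.
have e00 : h o0 o0 = g.
  by have := col o0; rewrite h02 /= mulr0 scaler0 scale0r !addr0 scale1r.
by move: i; apply: ord3P; rewrite /= ?scale0r ?scale1r.
Qed.

End OneWeight.

Lemma qmatrix_classification (k : closedFieldType) (q : k) (H : hopfAlgType k)
    (h : 'M[H]_3) : [pchar k] =i pred0 -> q != 0 -> q != 1 -> q != -1 ->
  cocommutative H -> qrel q h -> mcoalg h ->
  (forall p r, p != r -> h p r = 0) \/
  exists m n, [/\ m != n, forall p r, p != r -> (p, r) != (m, n) -> h p r = 0,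
    h m m = h n n & gprimitive (h m m) (h m n)].
Proof.
move=> char0 q0 q1 qN1 coc hq hc.
have [U [W]] := normal_forms coc hc => /= -[UW WU [w|[w1 w2 w3]|[w1 w2]]].
- by left=> p r; apply: (distinct_weights char0 q0 q1 qN1 UW WU hq hc w).
- have [m [n [mn z e]]] := two_weights char0 q0 q1 qN1 UW WU hq hc w1 w2 w3.
  case: e => [e|[e1 e2]]; last by right; exists m, n.
  left=> p r pr; have [[-> ->] //|ne] := eqVneq (p, r) (m, n).
  exact: z.
- left=> p r; apply: (one_weight char0 q0 q1 qN1 coc hq hc UW WU w1 (g := _ o0 o0)).
  by move=> s; apply: w2.
Qed.

(** * Universal property and coefficient functionals of the quantum affine space *)

Section QuantumAffine.
Variables (k : fieldType) (q : k) (n : nat).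
Local Notation A := (quantum_affine q n).
Local Notation x := (@qvar k q n).
Let S := Relators (@quantum_relator_proper k q n).

Lemma quantum_affine_lift (B : algType k) (v : 'I_n -> B) :
  (forall i j : 'I_n, (i < j)%N -> v j * v i = q *: (v i * v j)) ->
  exists f : {lrmorphism A -> B}, forall i, f (x i) = v i.
Proof.
move=> vC; have rel s : S s -> free_eval v s = 0.
  case=> -[i j] /= ij ->; apply: etrans (free_eval_qcomm _ _ _ _) _.
  by rewrite vC // subrr.
exists (qlift (S := S) rel) => i.
exact: etrans (qliftE _ _) (free_eval_gen _ _).
Qed.

Lemma qvarC (i j : 'I_n) : (i < j)%N -> x j * x i = q *: (x i * x j).
Proof.
move=> ij; pose g (l : 'I_n) := free_gen k l.
have e1 : qproj S (g j * g i) = x j * x i by exact: (rmorphM (qproj S)).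
have e2 : qproj S (q *: (g i * g j)) = q *: (x i * x j).
  have -> : x i * x j = qproj S (g i * g j) by exact/esym/(rmorphM (qproj S)).
  exact: (linearZ_LR (qproj S)).
apply: etrans (esym e1) (etrans _ e2); apply/qprojP; apply: ideal_gen_sub.
by exists (i, j).
Qed.

Lemma quantum_affine_ind (P : A -> Prop) : P 1 -> (forall i, P (x i)) ->
  (forall a b, P a -> P b -> P (a * b)) ->
  (forall c a b, P a -> P b -> P (c *: a + b)) -> forall a, P a.
Proof.
move=> P1 Px PM PL; apply: (@quotient_ind _ _ S); apply: free_algebra_ind.
- exact: P1.
- exact: Px.
- move=> a b Pa Pb; have -> := rmorphM (qproj S) a b.
  exact: PM.
- move=> c a b Pa Pb; have -> := linearP (qproj S) c a b.
  exact: PL.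
Qed.

Lemma qvar_degree i : degree_part 1 (x i).
Proof.
exists [:: (1, [tuple i])]; apply: esym; apply: etrans (big_seq1 _ _ _) _.
by apply: etrans (scale1r _) _; apply: big_seq1.
Qed.

End QuantumAffine.

(* Unification must not look through the quotient construction. *)
Opaque quantum_affine qvar.

Section QuantumCoefficients.
Variables (k : fieldType) (q : k).
Local Notation A := (quantum_affine q 3).
Local Notation x := (@qvar k q 3).

(** A representation on four states: the path 0, 1, 3 reads x_a and then x_b, and for a != b the
    path 0, 2, 3 reads x_b and then x_a with weight q. Its entries (0, 1) and (0, 3) extract the
    coefficients of x_a and of x_a x_b, with no appeal to a monomial basis. *)
Definition monomial_rep (a b i : 'I_3) : 'M[k]_4 :=
  \matrix_(s, t) ((i == a)%:R * ((s == 0) && (t == 1))%:R +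
    (i == b)%:R * ((s == 1) && (t == 3))%:R +
    (a != b)%:R * ((i == b)%:R * ((s == 0) && (t == 2))%:R +
      q * (i == a)%:R * ((s == 2) && (t == 3))%:R)).

Lemma monomial_repM a b i j s t : (monomial_rep a b i * monomial_rep a b j) s t =
  ((i == a)%:R * (j == b)%:R + (a != b)%:R * (q * (i == b)%:R * (j == a)%:R)) *
  ((s == 0) && (t == 3))%:R.
Proof.
rewrite -[_ * _]/(_ *m _) mxE !big_ord_recl big_ord0 addr0 !mxE.
case: s => [[|[|[|[|//]]]] ?]; case: t => [[|[|[|[|//]]]] ?];
  case: (a != b); rewrite /=; ring.
Qed.

Lemma monomial_coef (a b : 'I_3) : (a <= b)%N ->
  exists f1 f2 : {linear A -> k^o},
    (forall i, f1 (x i) = (i == a)%:R) /\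
    (forall i j, f2 (x i * x j) = (i == a)%:R * (j == b)%:R +
        (a != b)%:R * (q * (i == b)%:R * (j == a)%:R)).
Proof.
move=> ab; have [|f fE] := @quantum_affine_lift k q 3 _ (monomial_rep a b).
  move=> i j ij; apply/matrixP => s t; rewrite [RHS]mxE !monomial_repM.
  have z (c d : 'I_3) : (i == d)%:R * (j == c)%:R = 0 :> k \/ (d < c)%N.
    have [<-|_] := eqVneq i d; last by left; rewrite mul0r.
    by have [<-|_] := eqVneq j c; [right|left; rewrite mulr0].
  have z1 : (i == b)%:R * (j == a)%:R = 0 :> k.
    by case: (z a b) => // ba; move: ab; rewrite leqNgt ba.
  have z2 : a = b -> (i == a)%:R * (j == b)%:R = 0 :> k.
    by move=> e; case: (z b a) => //; rewrite e ltnn.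
  have [e|ne] := eqVneq a b.
    rewrite !mul0r !addr0 z2 // [(j == a)%:R * _]mulrC.
    by rewrite z1 !mul0r mulr0.
  rewrite !mul1r -![q * _ * _]mulrA z1 [(j == a)%:R * _]mulrC z1.
  by rewrite [(j == b)%:R * _]mulrC; ring.
pose L s t (y : A) : k^o := f y s t.
have Ll s t : linear (L s t) by move=> c u v; rewrite /L linearP !mxE.
pose F s t : {linear A -> k^o} :=
  HB.pack (L s t) (GRing.isLinear.Build _ _ _ _ (L s t) (Ll s t)).
exists (F 0 1), (F 0 3); split=> [i|i j].
  by rewrite -[LHS]/(f (x i) 0 1) fE mxE /= !(mulr1, mulr0, addr0).
transitivity ((monomial_rep a b i * monomial_rep a b j) 0 3).
    by rewrite -!fE; congr (fun_of_matrix _ 0 3); exact: (rmorphM f (x i) (x j)).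
  by rewrite monomial_repM mulr1.
Qed.

Lemma degree_part1 a : degree_part 1 a -> exists c, a = \sum_i c i *: x i.
Proof.
case=> s ->; elim: s => [|[c m] s [d e]].
  by exists (fun=> 0); rewrite big_nil big1 // => i _; rewrite scale0r.
exists (fun i => (i == tnth m ord0)%:R * c + d i); rewrite big_cons e.
under [RHS]eq_bigr => i _ do rewrite scalerDl.
rewrite big_split /=; congr (_ + _); rewrite (bigD1 (tnth m ord0)) //= eqxx mul1r.
rewrite [X in _ + X]big1 ?addr0; last by move=> i /negbTE ->; rewrite mul0r scale0r.
by rewrite big_tuple big_ord1.
Qed.

End QuantumCoefficients.

(** * From a coaction to its matrix *)

Section CoactionMatrix.
Variables (k : closedFieldType) (q : k) (H : hopfAlgType k).
Local Notation A := (quantum_affine q 3).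
Local Notation x := (@qvar k q 3).
Variable rho : {lrmorphism A -> (A ⊗ H)%type}.

Lemma coaction_matrix : preserves_degree rho ->
  exists h : 'M[H]_3, forall j, rho (x j) = \sum_i x i ⊗ h i j.
Proof.
move=> deg; have ex j : exists h : 'I_3 -> H, rho (x j) = \sum_i x i ⊗ h i.
  have [s [sP ->]] := deg 1%N (x j) (qvar_degree q j).
  elim: s sP => [|[a b] s IHs] sP.
    by exists (fun=> 0); rewrite big_nil big1 // => i _; rewrite tens0r.
  have [|g e] := IHs; first by move=> p ps; apply: sP; rewrite inE ps orbT.
  have [|/degree_part1 [c /= ->] _] := sP (a, b); first by rewrite inE eqxx.
  exists (fun i => c i *: b + g i); rewrite big_cons e /= tens_suml -big_split /=.
  by apply: eq_bigr => i _; rewrite tensDr tensZl tensZr.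
have [h hP] := choice ex; exists (\matrix_(i, j) h j i) => j.
by rewrite hP; apply: eq_bigr => i _; rewrite mxE.
Qed.

Variable h : 'M[H]_3.
Hypothesis rhoE : forall j, rho (x j) = \sum_i x i ⊗ h i j.

Lemma coaction_entry a :
  exists f : {linear A -> k^o}, forall j, contractl f (rho (x j)) = h a j.
Proof.
have [f [_ [fE _]]] := monomial_coef q (leqnn a); exists f => j.
rewrite rhoE linear_sum (bigD1 a) //= contractl_tens fE eqxx scale1r.
by rewrite big1 ?addr0 // => i /negbTE ia; rewrite contractl_tens fE ia scale0r.
Qed.

Lemma coaction_qrel : qrel q h.
Proof.
have rM i j : rho (x i * x j) = \sum_p \sum_r (x p * x r) ⊗ (h p i * h r j).
  apply: etrans (rmorphM rho (x i) (x j)) _.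
  rewrite [X in X * _]rhoE [X in _ * X]rhoE mulr_suml; apply: eq_bigr => p _.
  by rewrite mulr_sumr; apply: eq_bigr => r _; rewrite tensM.
have E (a b : 'I_3) (ab : (a <= b)%N) (i j : 'I_3) : (i < j)%N ->
    h a j * h b i + ((a != b)%:R * q) *: (h b j * h a i) =
    q *: (h a i * h b j + ((a != b)%:R * q) *: (h b i * h a j)).
  have [_ [f [_ fE]]] := monomial_coef q ab.
  have cE l m : contractl f (rho (x l * x m)) =
      h a l * h b m + ((a != b)%:R * q) *: (h b l * h a m).
    rewrite rM linear_sum.
    transitivity (\sum_p \sum_r ((p == a)%:R * (r == b)%:R +
        (a != b)%:R * (q * (p == b)%:R * (r == a)%:R)) *: (h p l * h r m)).
      apply: eq_bigr => p _; rewrite linear_sum; apply: eq_bigr => r _.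
      by apply: etrans (contractl_tens _ _ _) _; congr (_ *: _).
    rewrite !sum3; move: a b ab {fE}; do 2!apply: ord3P => //; move=> _;
    by rewrite /= !(mulr0, mul0r, mulr1, mul1r, addr0, add0r, scale0r, scale1r).
  move=> ij; apply: etrans (esym (cE j i)) (etrans _ (congr1 _ (cE i j))).
  apply: etrans (congr1 (fun y => contractl f (rho y)) (qvarC q ij)) _.
  by rewrite (linearZ_LR rho q (x i * x j)) (linearZ_LR (contractl f)).
split=> [a i j ij|a b i j ab ij].
  by have := E a a (leqnn _) i j ij; rewrite eqxx mul0r !scale0r !addr0.
have := E a b (ltnW ab) i j ij; rewrite neq_ltn ab mul1r scalerDr scalerA.
by rewrite expr2.
Qed.

Lemma coaction_mcoalg : is_coaction rho -> mcoalg h.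
Proof.
move=> [ca cu] i j; have [f [_ [fE _]]] := monomial_coef q (leqnn i); split.
  have rl : linear rho by exact: linearP.
  have cl : linear (comul : H -> (H ⊗ H)%type) by exact: linearP.
  have idl (V : lmodType k) : linear (idfun : V -> V) by [].
  have := ca (x j); rewrite rhoE.
  have sumE (V W : lmodType k) (F : V -> W) (G : 'I_3 -> V) : linear F ->
      F (\sum_i G i) = \sum_i F (G i).
    move=> Fl; pose F' : {linear V -> W} :=
      HB.pack F (GRing.isLinear.Build _ _ _ _ F Fl).
    by rewrite -[F]/(F' : _ -> _) linear_sum.
  rewrite (sumE _ _ _ _ (tmap_linear rl (idl H))) (sumE _ _ _ _ (@tassoc_linear _ _ _ _)).
  rewrite (sumE _ _ _ _ (tmap_linear (idl A) cl)).
  move/(congr1 (contractl f)); rewrite !linear_sum.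
  have E l : contractl f (tassoc (tmap rho idfun (x l ⊗ h l j))) = h i l ⊗ h l j.
    rewrite tmap_tens // rhoE tens_suml (sumE _ _ _ _ (@tassoc_linear _ _ _ _)).
    rewrite linear_sum (bigD1 i) //= tassoc_tens contractl_tens fE eqxx scale1r.
    rewrite big1 ?addr0 // => p /negbTE pi.
    by rewrite tassoc_tens contractl_tens fE pi scale0r.
  rewrite (eq_bigr _ (fun l _ => E l)).
  move=> ->; rewrite (bigD1 i) //= tmap_tens // contractl_tens fE eqxx scale1r.
  rewrite big1 ?addr0 // => p /negbTE pi.
  by rewrite tmap_tens // contractl_tens fE pi scale0r.
have e := congr1 f (cu (x j)); rewrite rhoE in e.
rewrite tlift_sum in e; last exact: contractr_bilinear.
rewrite linear_sum fE in e.
transitivity (\sum_p (counit (h p j) : k) * (p == i)%:R).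
  rewrite (bigD1 i) //= eqxx mulr1 big1 ?addr0 // => p /negbTE ->.
  exact: mulr0.
rewrite eq_sym -e; apply: eq_bigr => p _; rewrite -fE.
exact/esym/(linearZ_LR f).
Qed.

End CoactionMatrix.

Lemma subtensor_add (k : fieldType) (A B : lmodType k) (U : A -> Prop) (V : B -> Prop)
    (t t' : (A ⊗ B)%type) :
  subtensor U V t -> subtensor U V t' -> subtensor U V (t + t').
Proof.
move=> [s [sP ->]] [s' [sP' ->]]; exists (s ++ s'); rewrite big_cat; split=> //.
by move=> p; rewrite mem_cat => /orP [/sP|/sP'].
Qed.

Lemma subtensor_sum (k : fieldType) (A B : lmodType k) (U : A -> Prop) (V : B -> Prop)
    I (r : seq I) (F : I -> (A ⊗ B)%type) :
  (forall i, subtensor U V (F i)) -> subtensor U V (\sum_(i <- r) F i).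
Proof.
move=> FP; elim: r => [|i r IHr]; last by rewrite big_cons; apply: subtensor_add.
by exists [::]; rewrite !big_nil.
Qed.

Lemma subtensor_tens (k : fieldType) (A B : lmodType k) (U : A -> Prop) (V : B -> Prop)
    (a : A) (b : B) : U a -> V b -> subtensor U V (a ⊗ b).
Proof.
by move=> Ua Vb; exists [:: (a, b)]; rewrite big_seq1; split=> // p /[!inE] /eqP ->.
Qed.

Lemma subtensor_scale (k : fieldType) (A B : lmodType k) (U : A -> Prop) (V : B -> Prop)
    (c : k) (t : (A ⊗ B)%type) : (forall a, U a -> U (c *: a)) ->
  subtensor U V t -> subtensor U V (c *: t).
Proof.
move=> UZ [s [sP ->]]; exists [seq (c *: p.1, p.2) | p <- s]; split.
  by move=> _ /mapP [p /sP [u v] ->]; split=> //; apply: UZ.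
by rewrite scaler_sumr big_map; apply: eq_bigr => p _; rewrite tensZl.
Qed.

Lemma subtensor_mul (k : fieldType) (A B : algType k) (U : A -> Prop) (V : B -> Prop)
    (t t' : (A ⊗ B)%type) : (forall a b, U a -> U b -> U (a * b)) ->
  (forall a b, V a -> V b -> V (a * b)) ->
  subtensor U V t -> subtensor U V t' -> subtensor U V (t * t').
Proof.
move=> UM VM [s [sP ->]] [s' [sP' ->]].
have -> : (\sum_(p <- s) p.1 ⊗ p.2) * (\sum_(p <- s') p.1 ⊗ p.2) =
    \sum_(p <- [seq (p.1 * r.1, p.2 * r.2) | p <- s, r <- s']) p.1 ⊗ p.2.
  rewrite big_allpairs_dep mulr_suml; apply: eq_bigr => p _; rewrite mulr_sumr.
  by apply: eq_bigr => r _; rewrite tensM.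
exists [seq (p.1 * r.1, p.2 * r.2) | p <- s, r <- s']; split=> //.
move=> _ /allpairsP [[p r] [/= /sP [u1 v1] /sP' [u2 v2] ->]].
by split; [apply: UM|apply: VM].
Qed.

(** * From a matrix to a coaction *)

Section MakeCoaction.
Variables (k : closedFieldType) (q : k) (H : hopfAlgType k).
Local Notation A := (quantum_affine q 3).
Local Notation x := (@qvar k q 3).
Variable h : 'M[H]_3.

Definition coaction_val (j : 'I_3) : (A ⊗ H)%type := \sum_i x i ⊗ h i j.

Lemma coaction_valM i j : coaction_val i * coaction_val j =
  \sum_p \sum_r (x p * x r) ⊗ (h p i * h r j).
Proof.
rewrite mulr_suml; apply: eq_bigr => p _.
by rewrite mulr_sumr; apply: eq_bigr => r _; rewrite tensM.
Qed.

(** Collects quadratic terms on the ordered monomials, where the two halves of [qrel] can be applied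
    term by term. *)
Lemma qvar_sum (F : 'I_3 -> 'I_3 -> H) : \sum_(p : 'I_3) \sum_(r : 'I_3) (x p * x r) ⊗ F p r =
  \sum_p (x p * x p) ⊗ F p p +
  \sum_(p : 'I_3) \sum_(r : 'I_3 | (p < r)%N) (x p * x r) ⊗ (F p r + q *: F r p).
Proof.
transitivity (\sum_p (x p * x p) ⊗ F p p +
    (\sum_(p : 'I_3) \sum_(r : 'I_3 | (p < r)%N) (x p * x r) ⊗ F p r +
     \sum_(p : 'I_3) \sum_(r : 'I_3 | (r < p)%N) (x p * x r) ⊗ F p r)).
  rewrite -!big_split; apply: eq_bigr => p _ /=.
  rewrite (bigD1 p) //=; congr (_ + _); rewrite (bigID (fun r : 'I_3 => p < r)%N) /=.
  congr (_ + _); apply: eq_bigl => r; last by rewrite -leqNgt [in RHS]ltn_neqAle.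
  by rewrite andbC -val_eqE; case: ltngtP.
congr (_ + _); rewrite [X in _ + X](exchange_big_dep predT) //= -big_split; apply: eq_bigr => p _ /=.
rewrite -big_split; apply: eq_bigr => r pr /=.
apply: etrans (esym (tensDr _ _ _)); congr (_ + _).
apply: etrans (congr1 (fun y => y ⊗ F r p) (qvarC q pr)) _.
exact: etrans (tensZl _ _ _) (esym (tensZr _ _ _)).
Qed.

Lemma exists_coaction : qrel q h ->
  exists rho : {lrmorphism A -> (A ⊗ H)%type}, forall j, rho (x j) = \sum_i x i ⊗ h i j.
Proof.
move=> [r1 r2]; apply: quantum_affine_lift => i j ij.
rewrite -/(coaction_val i) -/(coaction_val j) !coaction_valM !qvar_sum scalerDr.
rewrite !scaler_sumr; congr (_ + _).
  by apply: eq_bigr => p _; rewrite r1 //; apply: tensZr.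
apply: eq_bigr => p _; rewrite scaler_sumr; apply: eq_bigr => r pr.
rewrite r2 //; apply: etrans (tensZr q _ _).
by rewrite scalerDr scalerA.
Qed.

Variable rho : {lrmorphism A -> (A ⊗ H)%type}.
Hypothesis rhoE : forall j, rho (x j) = \sum_i x i ⊗ h i j.

Lemma coaction_from_matrix : mcoalg h -> is_coaction rho.
Proof.
move=> hc; have idA : linear (idfun : A -> A) by [].
have idH : linear (idfun : H -> H) by [].
have rl : linear rho by exact: linearP.
have cl : linear (comul : H -> (H ⊗ H)%type) by exact: linearP.
pose T := tmap rho (idfun : H -> H).
have Tl : linear T := tmap_linear rl idH.
pose C := tmap (idfun : A -> A) (comul : H -> (H ⊗ H)%type).
have Cl : linear C := tmap_linear idA cl.
have asl := @tassoc_linear k A H H.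
pose E : (A ⊗ H)%type -> A := tlift (fun (a : A) (b : H) => (counit b : k) *: a).
have Eb := @contractr_bilinear k A H counit.
have El : linear E := tlift_is_linear Eb.
have sumE (V W : lmodType k) (f : V -> W) (F : 'I_3 -> V) : linear f ->
    f (\sum_i F i) = \sum_i f (F i).
  move=> fl; pose f' : {linear V -> W} :=
    HB.pack f (GRing.isLinear.Build _ _ _ _ f fl).
  by rewrite -[f]/(f' : _ -> _) linear_sum.
split; apply: quantum_affine_ind => [|i|a b|c a b].
- by rewrite rmorph1 -tens1 -/T -/C /T /C !tmap_tens // !rmorph1 -tens1 tassoc_tens.
- rewrite -/T -/C rhoE (sumE _ _ T) // (sumE _ _ _ _ asl) (sumE _ _ C) //.
  rewrite /T /C; transitivity (\sum_l \sum_p x p ⊗ (h p l ⊗ h l i)).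
    apply: eq_bigr => l _; rewrite tmap_tens // rhoE tens_suml.
    by rewrite (sumE _ _ _ _ asl); apply: eq_bigr => p _; rewrite tassoc_tens.
  rewrite exchange_big; apply: eq_bigr => p _ /=; rewrite tmap_tens // (hc p i).1.
  by rewrite tens_sumr.
- move=> ea eb; rewrite rmorphM /=.
  rewrite (tmapM rho idfun) tassocM (tmapM idfun comul).
  by rewrite ea eb.
- by move=> ea eb; rewrite linearP -/T -/C Tl asl Cl /T /C ea eb.
- by rewrite rmorph1 -tens1 -/E /E tlift_tens // rmorph1 scale1r.
- rewrite rhoE tlift_sum // (bigD1 i) //= (hc i i).2 eqxx scale1r.
  by rewrite big1 ?addr0 // => p pi; rewrite (hc p i).2 (negbTE pi) scale0r.
- move=> ea eb; rewrite rmorphM /= -[in RHS]ea -[in RHS]eb.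
  move: (rho a) (rho b) => {ea eb} u v; rewrite -/E.
  move: u; apply: tensor_ext => [c u w|c u w|a' b'].
  + by rewrite mulrDl -scalerAl El.
  + by rewrite El mulrDl -scalerAl.
  move: v; apply: tensor_ext => [c u w|c u w|c' d'].
  + by rewrite mulrDr -scalerAr El.
  + by rewrite El mulrDr -scalerAr.
  by rewrite tensM /E !tlift_tens // rmorphM /= -scalerAl -scalerAr scalerA.
- by move=> ea eb; rewrite linearP -/E El /E ea eb.
Qed.

Lemma coaction_degree : preserves_degree rho.
Proof.
have scale_deg d (c : k) (a : A) : degree_part d a -> degree_part d (c *: a).
  case=> s ->; exists [seq (c * m.1, m.2) | m <- s].
  by rewrite big_map scaler_sumr; apply: eq_bigr => m _; rewrite scalerA.
have mul_deg d i (a : A) : degree_part d a -> degree_part d.+1 (x i * a).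
  case=> s ->; exists [seq (m.1, cons_tuple i m.2) | m : k * d.-tuple 'I_3 <- s].
  rewrite big_map mulr_sumr; apply: eq_bigr => m _ /=.
  by rewrite big_cons -scalerAr.
have words (w : seq 'I_3) :
    subtensor (degree_part (size w)) (fun=> True) (rho (\prod_(i <- w) x i)).
  elim: w => [|i w [s [sP e]]].
    rewrite big_nil rmorph1 -tens1; apply: subtensor_tens => //.
    by exists [:: (1, [tuple])]; rewrite big_seq1 big_nil scale1r.
  rewrite big_cons rmorphM /= rhoE e mulr_suml; apply: subtensor_sum => l.
  rewrite mulr_sumr; elim: s sP {e} => [|p s IHs] sP.
    by exists [::]; rewrite !big_nil.
  rewrite big_cons; apply: subtensor_add; last first.
    by apply: IHs => r rs; apply: sP; rewrite inE rs orbT.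
  rewrite tensM; apply: subtensor_tens => //; apply: mul_deg.
  by have [] := sP p; rewrite ?inE ?eqxx.
move=> d a [s ->]; rewrite linear_sum; apply: subtensor_sum => m.
rewrite linearZ /=; apply: subtensor_scale; first by move=> b; apply: scale_deg.
by have := words m.2; rewrite size_tuple.
Qed.

(** Contracting the coaction with a coefficient functional shows that a Hopf subalgebra receiving it
    contains every entry of [h]. *)
Lemma coaction_inner_faithful :
  (forall V : H -> Prop, is_hopf_subalgebra V -> (forall i j, V (h i j)) ->
    forall c, V c) ->
  inner_faithful rho.
Proof.
move=> gen V hV rV; apply: gen => // i j; have [V1 VL _ _ _] := hV.
have V0 : V 0 by have := VL (-1) _ _ V1 V1; rewrite scaleN1r addNr.
have [s [sP e]] := rV (x j); have [f fE] := coaction_entry rhoE i.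
rewrite -fE e linear_sum.
elim: s sP {e} => [|p s IHs] sP; first by rewrite big_nil.
rewrite big_cons /= contractl_tens; apply: VL.
  by have [] := sP p; rewrite ?inE ?eqxx.
by apply: IHs => r rs; apply: sP; rewrite inE rs orbT.
Qed.

End MakeCoaction.

(** * Morphisms, images and preimages of Hopf algebras *)

Section BialgebraMorphism.
Variables (k : fieldType) (B H : hopfAlgType k) (f : {lrmorphism B -> H}).

Definition bialgebra_at b : Prop :=
  comul (f b) = tmap f f (comul b) /\ (counit (f b) : k) = counit b.

Let fl : linear f. Proof. exact: linearP. Qed.

Lemma bialgebra_at1 : bialgebra_at 1.
Proof. by split; rewrite !rmorph1 // -tens1 tmap_tens // rmorph1. Qed.

Lemma bialgebra_atM a b : bialgebra_at a -> bialgebra_at b -> bialgebra_at (a * b).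
Proof.
move=> [a1 a2] [b1 b2]; split; first by rewrite !rmorphM /= (tmapM f f) a1 b1.
by rewrite !rmorphM /= a2 b2.
Qed.

Lemma bialgebra_at_lin c a b :
  bialgebra_at a -> bialgebra_at b -> bialgebra_at (c *: a + b).
Proof.
move=> [a1 a2] [b1 b2]; split.
  by rewrite !linearP /= (tmap_linear fl fl) a1 b1.
by rewrite !linearP /= a2 b2.
Qed.

Lemma bialgebra_at_grouplike b : grouplike b -> grouplike (f b) -> bialgebra_at b.
Proof. by move=> [d e] [d' e']; split; rewrite ?e // d' d tmap_tens. Qed.

Hypothesis fb : forall b, bialgebra_at b.

(* Both sides are convolution inverses of f. *)
Lemma bialgebra_antipode b : antipode (f b) = f (antipode b).
Proof.
pose m (a c : B) : H := f a * f (antipode c).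
have mb : bilinear_for *:%R *:%R m.
  by apply: bilinearP => [c|a] e u v; rewrite /m !linearP ?mulrDl ?mulrDr
    -?scalerAl -?scalerAr.
(* Evaluated on the two sides of coassociativity, [F] computes the convolution of antipode after
   [f], [f], and [f] after antipode, bracketed in the two possible ways. *)
pose F (a : B) (t : (B ⊗ B)%type) : H := antipode (f a) * tlift m t.
have ml := tlift_is_linear mb.
have Fb : bilinear_for *:%R *:%R F.
  apply: bilinearP => [t|a] e u v; rewrite /F.
    by rewrite !linearP mulrDl -scalerAl.
  by rewrite ml mulrDr -scalerAr.
have Fl := tlift_is_linear Fb.
have idl : linear (idfun : B -> B) by [].
have cl : linear (comul : B -> (B ⊗ B)%type) by exact: linearP.
have asl := @tassoc_linear k B B B.
have := congr1 (tlift F) (coassoc b).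
have -> : tlift F (tmap idfun comul (comul b)) = antipode (f b).
  rewrite -[in RHS](counitr b); move: (comul b); apply: tensor_ext.
  - by move=> c u v; rewrite (tmap_linear idl cl) Fl.
  - by move=> c u v; rewrite (tlift_is_linear (@er_bilinear _ _ counit)) !linearP.
  move=> a c; rewrite tmap_tens // !tlift_tens //; last exact: er_bilinear.
  rewrite /F; have -> : tlift m (comul c) = (counit c : k)%:A.
    rewrite -[RHS](rmorph_alg f) -antipoder; move: (comul c); apply: tensor_ext => //.
      move=> e u v; rewrite (tlift_is_linear (@Sr_bilinear _ _ _)).
      by rewrite linearP.
    move=> u v; rewrite !tlift_tens //; last exact: Sr_bilinear.
    by rewrite /m rmorphM.
  by rewrite -scalerAr mulr1 !linearZ.
have -> : tlift F (tassoc (tmap comul idfun (comul b))) = f (antipode b).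
  rewrite -[in RHS](counitl b); move: (comul b); apply: tensor_ext.
  - by move=> c u v; rewrite (tmap_linear cl idl) asl Fl.
  - by move=> c u v; rewrite (tlift_is_linear (@el_bilinear _ _ counit)) !linearP.
  move=> a c; rewrite tmap_tens // !tlift_tens //; last exact: el_bilinear.
  have -> : f (antipode ((counit a : k) *: c)) =
      tlift (fun u v => antipode u * v) (comul (f a)) * f (antipode c).
    rewrite antipodel (fb a).2 -scalerAl mul1r; apply: etrans (congr1 f _) _.
      exact: linearZ_LR.
    exact: linearZ_LR.
  rewrite (fb a).1 /=; move: (comul a); apply: tensor_ext.
  - by move=> e u v; rewrite tensZDl asl Fl.
  - by move=> e u v; rewrite (tmap_linear fl fl) (tlift_is_linear (@Sl_bilinear _ _ _)) mulrDl -scalerAl.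
  move=> u v; rewrite tassoc_tens !tlift_tens // tmap_tens // tlift_tens; last exact: Sl_bilinear.
  by rewrite /F tlift_tens // mulrA.
by [].
Qed.

Lemma bialgebra_hopf : is_hopf_morphism f.
Proof. by split=> b; [exact: (fb b).1|exact: (fb b).2|exact: bialgebra_antipode]. Qed.

End BialgebraMorphism.

Section HopfImage.
Variables (k : fieldType) (B H : hopfAlgType k) (f : {lrmorphism B -> H}).
Hypothesis fh : is_hopf_morphism f.

Lemma hopf_image : is_hopf_subalgebra (fun h => exists b, f b = h).
Proof.
have [fc _ fS] := fh; split.
- by exists 1; rewrite rmorph1.
- by move=> c _ _ [a <-] [b <-]; exists (c *: a + b); rewrite linearP.
- by move=> _ _ [a <-] [b <-]; exists (a * b); rewrite rmorphM.
- move=> _ [b <-]; rewrite fc [comul b]tensorE.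
  pose T : {linear (B ⊗ B)%type -> (H ⊗ H)%type} := HB.pack (tmap f f)
    (GRing.isLinear.Build _ _ _ _ (tmap f f) (tmap_linear (linearP f) (linearP f))).
  rewrite -[tmap f f]/(T : _ -> _) linear_sum; apply: subtensor_sum => p.
  rewrite /T /= tmap_tens; try exact: linearP.
  by apply: subtensor_tens; eexists.
- by move=> _ [b <-]; exists (antipode b); rewrite fS.
Qed.

Lemma hopf_image_cocommutative : (forall h, exists b, f b = h) ->
  cocommutative B -> cocommutative H.
Proof.
move=> fs cB h; have [b <-] := fs h; have [-> _ _] := fh.
have fl : linear f by exact: linearP.
rewrite -[in RHS]cB; move: (comul b); apply: tensor_ext.
- by move=> c u v; rewrite (tmap_linear fl fl) linearP.
- by move=> c u v; rewrite linearP (tmap_linear fl fl).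
by move=> u v; rewrite tswap_tens !tmap_tens // tswap_tens.
Qed.

Lemma hopf_preimage (V : H -> Prop) : is_hopf_subalgebra V ->
  [/\ V (f 1), forall c a b, V (f a) -> V (f b) -> V (f (c *: a + b)),
      forall a b, V (f a) -> V (f b) -> V (f (a * b)) &
      forall a, V (f a) -> V (f (antipode a))].
Proof.
have [_ _ fS] := fh; move=> [V1 VL VM _ VS]; split.
- by rewrite rmorph1.
- by move=> c a b Va Vb; rewrite linearP; apply: VL.
- by move=> a b Va Vb; rewrite rmorphM; apply: VM.
- by move=> a Va; rewrite -fS; apply: VS.
Qed.

End HopfImage.

Lemma tswapM (k : fieldType) (A B : algType k) : {morph @tswap k A B : x y / x * y}.
Proof.
have tl : linear (@tswap k A B) by exact: linearP.
move=> x y; move: x; apply: tensor_ext => [c u v|c u v|a b].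
- by rewrite mulrDl -scalerAl tl.
- by rewrite tl mulrDl -scalerAl.
move: y; apply: tensor_ext => [c u v|c u v|a' b'].
- by rewrite mulrDr -scalerAr tl.
- by rewrite tl mulrDr -scalerAr.
by rewrite tensM !tswap_tens tensM.
Qed.

(** Both [comul (antipode g)] and [antipode g ⊗ antipode g] are inverse to [g ⊗ g]. *)
Lemma grouplike_antipode (k : fieldType) (H : hopfAlgType k) (g : H) :
  grouplike g -> grouplike (antipode g).
Proof.
move=> gg; have [d e] := gg; have [gV Vg] := grouplikeV gg; split.
  transitivity ((antipode g ⊗ antipode g) * (comul g * comul (antipode g))).
    by rewrite mulrA d tensM Vg mul1r.
  by rewrite -[comul g * _]rmorphM gV rmorph1 mulr1.
have := congr1 counit gV; rewrite rmorphM /= rmorph1 => <-.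
by rewrite -[RHS]/((counit g : k) * (counit (antipode g) : k)) e mul1r.
Qed.

Lemma primitive_counit (k : fieldType) (H : hopfAlgType k) (z : H) :
  comul z = z ⊗ 1 + 1 ⊗ z -> (counit z : k) = 0.
Proof.
move=> d; have := counitl z; rewrite d.
have l := tlift_is_linear (el_bilinear (@counit k H)).
have := l 1 (z ⊗ 1) (1 ⊗ z); rewrite !scale1r => ->.
rewrite !tlift_tens; try exact: el_bilinear.
have -> : (counit (1 : H) : k) = 1 by exact: rmorph1.
rewrite scale1r -[X in _ = X -> _]add0r => /addIr /eqP.
by rewrite scaler_eq0 oner_eq0 orbF => /eqP.
Qed.

Lemma gprimitive_primitive (k : fieldType) (H : hopfAlgType k) (g w : H) :
  grouplike g -> gprimitive g w ->
  comul (antipode g * w) = (antipode g * w) ⊗ 1 + 1 ⊗ (antipode g * w).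
Proof.
move=> gg pw; have [_ Vg] := grouplikeV gg; have [d _] := grouplike_antipode gg.
by rewrite rmorphM /= d pw mulrDr !tensM Vg addrC.
Qed.

(** * Maps out of the skew algebras and out of group algebras *)

Section SkewAlgebraMaps.
Variables (k : fieldType) (a b : k).
Local Notation B := (skew_algebra a b).
Local Notation X := (skew_elt a b GenX).
Local Notation Y := (skew_elt a b GenY).
Local Notation Z := (skew_elt a b GenZ).
Let S := Relators (@skew_relator_proper k a b).

Lemma skew_ind (P : B -> Prop) : P 1 -> (forall g, P (skew_elt a b g)) ->
  (forall u v, P u -> P v -> P (u * v)) ->
  (forall c u v, P u -> P v -> P (c *: u + v)) -> forall u, P u.
Proof.
move=> P1 Pg PM PL; apply: (@quotient_ind _ _ S); apply: free_algebra_ind.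
- exact: P1.
- exact: Pg.
- move=> u v Pu Pv; have -> := rmorphM (qproj S) u v.
  exact: PM.
- move=> c u v Pu Pv; have -> := linearP (qproj S) c u v.
  exact: PL.
Qed.

Lemma skew_lift (A : algType k) (v : skew_gen -> A) :
  (forall r, r \in skew_relations a b v -> r = 0) ->
  exists f : {lrmorphism B -> A}, forall g, f (skew_elt a b g) = v g.
Proof.
move=> v0; exists (qlift (S := S) (skew_eval_relator v0)) => g.
exact: etrans (qliftE _ _) (free_eval_gen _ _).
Qed.

Lemma skew_comul_gen g : comul (skew_elt a b g) = skew_comul_val (skew_elt a b) g.
Proof. exact: skew_comulE. Qed.

Lemma skew_counit_gen g : (counit (skew_elt a b g) : k) = skew_counit_val k g.
Proof. exact: skew_counitE. Qed.

Lemma skew_antipode_gen g : antipode (skew_elt a b g) = skew_antipode_val (skew_elt a b) g.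
Proof. exact: skew_antipodeE. Qed.

End SkewAlgebraMaps.

Opaque skew_algebra skew_elt.

Section SkewHopf.
Variables (k : fieldType) (a b : k).
Local Notation B := (skew_algebra a b).
Local Notation X := (skew_elt a b GenX).
Local Notation Y := (skew_elt a b GenY).
Local Notation Z := (skew_elt a b GenZ).

Lemma skew_hopf_lift (H : hopfAlgType k) (x y z : H) :
  grouplike x -> grouplike y -> comul z = z ⊗ 1 + 1 ⊗ z ->
  y * x = x * y -> z * x = a *: (x * z) -> z * y = b *: (y * z) ->
  exists f : {lrmorphism B -> H},
    [/\ is_hopf_morphism f, f X = x, f Y = y & f Z = z].
Proof.
move=> gx gy dz yx zx zy; have [xV Vx] := grouplikeV gx; have [yV Vy] := grouplikeV gy.
pose v g := match g with GenX => x | GenXinv => antipode x | GenY => y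
  | GenYinv => antipode y | GenZ => z end.
have [|f fE] := @skew_lift k a b H v; first exact: skew_relationsP.
exists f; split; try exact: fE.
apply: bialgebra_hopf; apply: skew_ind => [|g|u w|c u w].
- exact: bialgebra_at1.
- have fl : linear f by exact: linearP.
  case: g; rewrite /bialgebra_at skew_comul_gen skew_counit_gen fE /=.
  + by rewrite tmap_tens // fE; split; [apply: gx.1|apply: gx.2].
  + have [d e] := grouplike_antipode gx.
    by rewrite tmap_tens // fE; split; [apply: d|apply: e].
  + by rewrite tmap_tens // fE; split; [apply: gy.1|apply: gy.2].
  + have [d e] := grouplike_antipode gy.
    by rewrite tmap_tens // fE; split; [apply: d|apply: e].
  + split; last exact: primitive_counit.
    have := tmap_linear fl fl 1 (Z ⊗ 1) (1 ⊗ Z); rewrite !scale1r => ->.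
    by rewrite !tmap_tens // fE rmorph1.
- exact: bialgebra_atM.
- exact: bialgebra_at_lin.
Qed.

Lemma skew_cocommutative : cocommutative B.
Proof.
apply: skew_ind => [|g|u w eu ew|c u w eu ew].
- by rewrite rmorph1 -tens1 tswap_tens.
- rewrite skew_comul_gen; case: g; rewrite /= ?tswap_tens //.
  apply: etrans (linearD (@tswap k B B) (Z ⊗ 1) (1 ⊗ Z)) _.
  by rewrite /= !tswap_tens addrC.
- have e := rmorphM (@comul k B) u w; apply: etrans (congr1 _ e) (etrans _ (esym e)).
  exact: etrans (tswapM _ _) (congr2 ( *%R) eu ew).
- have e := linearP (@comul k B) c u w.
  apply: etrans (congr1 _ e) (etrans _ (esym e)).
  exact: etrans (linearP (@tswap k B B) c _ _) (congr2 (fun s t => c *: s + t) eu ew).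
Qed.

(** The coaction matrix has the entries X, Y and X Z rather than Z, hence this choice of generators;
    Z is recovered by means of the inverse of X, which is its antipode. *)
Lemma skew_generated (V : B -> Prop) : V 1 ->
  (forall c u v, V u -> V v -> V (c *: u + v)) ->
  (forall u v, V u -> V v -> V (u * v)) -> (forall u, V u -> V (antipode u)) ->
  V X -> V Y -> V (X * Z) -> forall u, V u.
Proof.
move=> V1 VL VM VS VX VY VXZ.
have VX' : V (skew_elt a b GenXinv).
  by have := VS _ VX; rewrite skew_antipode_gen.
have VY' : V (skew_elt a b GenYinv).
  by have := VS _ VY; rewrite skew_antipode_gen.
apply: skew_ind => // g; case: g => //.
have [[_ e _ _] _] := skew_eqs a b.
by have := VM _ _ VX' VXZ; rewrite mulrA e mul1r.
Qed.

Lemma skew_grouplikes : [/\ grouplike X, grouplike Y & gprimitive X (X * Z)].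
Proof.
split; try by split; [exact: skew_comul_gen|exact: skew_counit_gen].
rewrite /gprimitive; apply: etrans (rmorphM (@comul k B) X Z) _.
rewrite /= !skew_comul_gen /= mulrDr !tensM !mulr1.
by rewrite addrC.
Qed.

End SkewHopf.

Section GroupAlgebraMaps.
Variables (k : fieldType) (G : groupType).
Local Notation B := (group_algebra k G).

Lemma group_comul_elt (g : G) :
  comul (group_elt k g : B) = group_elt k g ⊗ group_elt k g.
Proof. exact: mlift_basis. Qed.

Lemma group_counit_elt (g : G) : (counit (group_elt k g : B) : k) = 1.
Proof. exact: (@mlift_basis k G k^o (fun=> 1) g). Qed.

Lemma group_elt_grouplike (g : G) : grouplike (group_elt k g : B).
Proof. split; [exact: group_comul_elt|exact: group_counit_elt]. Qed.

Lemma group_eltM (g h : G) :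
  group_elt k (g * h)%g = group_elt k g * group_elt k h.
Proof. exact: mbasisM. Qed.

Lemma group_ind (P : B -> Prop) : (forall g, P (group_elt k g)) ->
  (forall c u v, P u -> P v -> P (c *: u + v)) -> forall u, P u.
Proof.
move=> Pg PL u; rewrite [u]monoid_algebraE.
have P0 : P 0 by have := PL (-1) _ _ (Pg 1%g) (Pg 1%g); rewrite scaleN1r addNr.
by elim/big_rec: _ => // g b _ Pb; apply: PL => //; apply: Pg.
Qed.

Lemma group_cocommutative : cocommutative B.
Proof.
apply: group_ind => [g|c u w eu ew]; first by rewrite group_comul_elt tswap_tens.
have e := linearP (@comul k B) c u w.
apply: etrans (congr1 _ e) (etrans _ (esym e)).
exact: etrans (linearP (@tswap k B B) c _ _) (congr2 (fun s t => c *: s + t) eu ew).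
Qed.

Lemma group_hopf_lift (H : hopfAlgType k) (f : G -> H) :
  f 1%g = 1 -> {morph f : g h / (g * h)%g >-> g * h} ->
  (forall g, grouplike (f g)) ->
  exists F : {lrmorphism B -> H},
    is_hopf_morphism F /\ forall g, F (group_elt k g) = f g.
Proof.
move=> f1 fM fg.
pose M := GRing.isMonoidMorphism.Build B H (mlift f) (mlift_monoid_morphism f1 fM).
pose L := GRing.isLinear.Build k B H *:%R (mlift f) (mlift_is_linear f).
pose F : {lrmorphism B -> H} := HB.pack (mlift f) M L.
have FE g : F (group_elt k g) = f g by exact: mlift_basis.
exists F; split=> //; apply: bialgebra_hopf; apply: group_ind => [g|c u w].
  by apply: bialgebra_at_grouplike; [exact: group_elt_grouplike|rewrite FE].
exact: bialgebra_at_lin.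
Qed.

End GroupAlgebraMaps.

(** * Every quotient of the listed Hopf algebras coacts *)

Section QuotientCoaction.
Variables (k : closedFieldType) (q : k).

Definition coacts (H : hopfAlgType k) : Prop := cocommutative H /\
  exists rho : {lrmorphism quantum_affine q 3 -> (quantum_affine q 3 ⊗ H)%type},
    [/\ is_coaction rho, preserves_degree rho & inner_faithful rho].

(** The class of [V] is chosen so as to be stable under preimages along Hopf morphisms, which
    transfers generation from [B] to its quotients. *)
Definition hopf_generated (B : hopfAlgType k) (M : 'M[B]_3) : Prop :=
  forall V : B -> Prop, V 1 -> (forall c u v, V u -> V v -> V (c *: u + v)) ->
    (forall u v, V u -> V v -> V (u * v)) -> (forall u, V u -> V (antipode u)) ->
    (forall i j, V (M i j)) -> forall u, V u.

Lemma quotient_coacts (B H : hopfAlgType k) (M : 'M[B]_3) : cocommutative B ->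
  qrel q M -> mcoalg M -> hopf_generated M -> is_hopf_quotient B H -> coacts H.
Proof.
move=> cB [r1 r2] Mc gen [f [fh fs]]; split; first exact: hopf_image_cocommutative fh fs cB.
pose h : 'M[H]_3 := \matrix_(i, j) f (M i j); have hE i j : h i j = f (M i j) by rewrite mxE.
have hq : qrel q h.
  have fM u v : f (u * v) = f u * f v by exact: rmorphM.
  have fZ c u : f (c *: u) = c *: f u by exact: linearZ_LR.
  have fD u v : f (u + v) = f u + f v by exact: linearD.
  split=> [a i j ij|a b i j ab ij]; rewrite !hE -!fM -!fZ.
    by rewrite (r1 a i j ij).
  by rewrite -!fD (r2 a b i j ab ij).
have hc : mcoalg h.
  have [fc fe _] := fh; move=> i j; rewrite hE fc fe (Mc i j).2; split=> //.
  have fl : linear f by exact: linearP.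
  pose T : {linear (B ⊗ B)%type -> (H ⊗ H)%type} := HB.pack (tmap f f)
    (GRing.isLinear.Build _ _ _ _ (tmap f f) (tmap_linear fl fl)).
  rewrite (Mc i j).1 -[tmap f f]/(T : _ -> _) linear_sum; apply: eq_bigr => l _.
  by rewrite /T /= tmap_tens // !hE.
have [rho rhoE] := exists_coaction hq; exists rho; split.
- exact: coaction_from_matrix rhoE hc.
- exact: coaction_degree rhoE.
- apply: (coaction_inner_faithful rhoE) => V Vh Vij c; have [b <-] := fs c.
  have [V1 VL VM VS] := hopf_preimage fh Vh.
  apply: (gen (fun b => V (f b))) => // i j.
  by rewrite -hE.
Qed.

End QuotientCoaction.

Section SparseMatrix.
Variables (k : closedFieldType) (q : k) (H : hopfAlgType k) (h : 'M[H]_3).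
Variables (m n l : 'I_3) (x y w : H).
Hypotheses (mn : m != n) (ml : m != l) (nl : n != l).
Hypothesis hE : forall i j, h i j = if i == j then if i == l then y else x
  else if (i == m) && (j == n) then w else 0.

Lemma sparse_mcoalg : grouplike x -> grouplike y -> gprimitive x w -> mcoalg h.
Proof.
move=> gx gy pw i j; have cw : (counit w : k) = 0.
  have := counitl w; rewrite pw.
  have l' := tlift_is_linear (el_bilinear (@counit k H)).
  have := l' 1 (x ⊗ w) (w ⊗ x); rewrite !scale1r => ->.
  rewrite !tlift_tens; try exact: el_bilinear.
  rewrite gx.2 scale1r -[X in _ = X -> _]addr0 => /addrI /eqP.
  by rewrite scaler_eq0 (negbTE (grouplike_neq0 gx)) orbF => /eqP.
have hd p : h p p = if p == l then y else x by rewrite hE eqxx.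
have gd p : grouplike (h p p) by rewrite hd; case: ifP.
split; last first.
  have [<-|ij] := eqVneq i j; first exact: (gd i).2.
  by rewrite hE (negbTE ij); case: ifP => _; rewrite ?linear0.
have z p r : p != r -> (p == m) && (r == n) = false -> h p r = 0.
  by move=> pr e; rewrite hE (negbTE pr) e.
have [<-|ij] := eqVneq i j.
  rewrite (bigD1 i) //= big1 ?addr0 => [|p pi]; first exact: (gd i).1.
  have [/andP [/eqP im /eqP pn]|e] := boolP ((i == m) && (p == n)).
    by rewrite [h p i]z ?tens0r // pn eq_sym (negbTE mn).
  by rewrite [h i p]z ?tens0l // ?(negbTE e) // eq_sym.
rewrite (bigD1 i) // (bigD1 j) //=; last by rewrite eq_sym.
rewrite big1 ?addr0 => [|p /andP [pi pj]].
  have [/andP [/eqP im /eqP jn]|e] := boolP ((i == m) && (j == n)).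
    rewrite !hd im jn (negbTE ml) (negbTE nl).
    by rewrite hE (negbTE mn) !eqxx.
  by rewrite z ?(negbTE e) // tens0r tens0l addr0 linear0.
have [/andP [/eqP im /eqP pn]|e] := boolP ((i == m) && (p == n)).
  by rewrite [h p j]z ?tens0r // pn eq_sym (negbTE mn).
by rewrite [h i p]z ?tens0l // ?(negbTE e) // eq_sym.
Qed.

(** Each alternative is a position of the off-diagonal entry with the commutation scalars it calls
    for, one for each of the four skew algebras; the positions (1, 2) and (2, 1) would give B_q and
    its analogue for q^-1 again. *)
Lemma sparse_qrel al be : q != 0 -> y * x = x * y ->
  w * x = al *: (x * w) -> w * y = be *: (y * w) ->
  [\/ [/\ m = o0, n = o1, al = q & be = 1],
      [/\ m = o1, n = o0, al = q^-1 & be = 1],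
      [/\ m = o0, n = o2, al = q & be = q ^+ 2] |
      [/\ m = o2, n = o0, al = q^-1 & be = q^-1 ^+ 2]] -> qrel q h.
Proof.
move=> q0 yx wx wy par.
have xw : al = q^-1 -> x * w = q *: (w * x).
  by move=> e; rewrite wx e scalerA mulfV // scale1r.
have yw : be = q^-1 ^+ 2 -> y * w = q ^+ 2 *: (w * y).
  by move=> e; rewrite wy e scalerA -exprMn mulfV // expr1n scale1r.
case: par => -[em en ea eb].
- have el : l = o2 by move: ml nl; rewrite em en; elim/ord3P: l.
  rewrite ea in wx; rewrite eb scale1r in wy.
  split=> [a i j|a b i j]; rewrite !hE em en el.
    elim/ord3P: a; elim/ord3P: i; elim/ord3P: j => //= _;
    by rewrite ?(mulr0, mul0r, scaler0).
  elim/ord3P: a; elim/ord3P: b => //= _; elim/ord3P: i; elim/ord3P: j => //= _;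
    by rewrite ?(mulr0, mul0r, scaler0, addr0, add0r) ?yx ?wy.
- have el : l = o2 by move: ml nl; rewrite em en; elim/ord3P: l.
  move: xw => /(_ ea) xw; rewrite eb scale1r in wy.
  split=> [a i j|a b i j]; rewrite !hE em en el.
    elim/ord3P: a; elim/ord3P: i; elim/ord3P: j => //= _;
    by rewrite ?(mulr0, mul0r, scaler0).
  elim/ord3P: a; elim/ord3P: b => //= _; elim/ord3P: i; elim/ord3P: j => //= _;
    by rewrite ?(mulr0, mul0r, scaler0, addr0, add0r) ?yx ?wy.
- have el : l = o1 by move: ml nl; rewrite em en; elim/ord3P: l.
  rewrite ea in wx; rewrite eb in wy.
  split=> [a i j|a b i j]; rewrite !hE em en el.
    elim/ord3P: a; elim/ord3P: i; elim/ord3P: j => //= _;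
    by rewrite ?(mulr0, mul0r, scaler0).
  elim/ord3P: a; elim/ord3P: b => //= _; elim/ord3P: i; elim/ord3P: j => //= _;
    by rewrite ?(mulr0, mul0r, scaler0, addr0, add0r) ?yx ?wy.
- have el : l = o1 by move: ml nl; rewrite em en; elim/ord3P: l.
  move: xw yw => /(_ ea) xw /(_ eb) yw.
  split=> [a i j|a b i j]; rewrite !hE em en el.
    elim/ord3P: a; elim/ord3P: i; elim/ord3P: j => //= _;
    by rewrite ?(mulr0, mul0r, scaler0).
  elim/ord3P: a; elim/ord3P: b => //= _; elim/ord3P: i; elim/ord3P: j => //= _;
    by rewrite ?(mulr0, mul0r, scaler0, addr0, add0r) ?yx ?yw.
Qed.

End SparseMatrix.

Lemma skew_product_commutation (k : fieldType) (A : algType k) (a b : k) (x y z : A) :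
  y * x = x * y -> z * x = a *: (x * z) -> z * y = b *: (y * z) ->
  x * z * x = a *: (x * (x * z)) /\ x * z * y = b *: (y * (x * z)).
Proof.
move=> yx zx zy; split; first by rewrite -mulrA zx -scalerAr.
by rewrite -mulrA zy -scalerAr !mulrA yx.
Qed.

Section SkewQuotient.
Variables (k : closedFieldType) (q a b : k) (m n l : 'I_3).
Hypotheses (q0 : q != 0) (mn : m != n) (ml : m != l) (nl : n != l).
Hypothesis par : [\/ [/\ m = o0, n = o1, a = q & b = 1],
    [/\ m = o1, n = o0, a = q^-1 & b = 1],
    [/\ m = o0, n = o2, a = q & b = q ^+ 2] |
    [/\ m = o2, n = o0, a = q^-1 & b = q^-1 ^+ 2]].
Local Notation B := (skew_algebra a b).
Local Notation X := (skew_elt a b GenX).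
Local Notation Y := (skew_elt a b GenY).
Local Notation Z := (skew_elt a b GenZ).

Lemma skew_quotient_coacts (H : hopfAlgType k) : is_hopf_quotient B H -> coacts q H.
Proof.
pose M : 'M[B]_3 := \matrix_(i, j) if i == j then if i == l then Y else X
  else if (i == m) && (j == n) then X * Z else 0.
have ME i j : M i j = if i == j then if i == l then Y else X
  else if (i == m) && (j == n) then X * Z else 0 by rewrite mxE.
have Mm : M m m = X by rewrite ME eqxx (negbTE ml).
have Ml : M l l = Y by rewrite ME !eqxx.
have Mw : M m n = X * Z by rewrite ME (negbTE mn) !eqxx.
have [gx gy pz] := skew_grouplikes a b.
have [_ [yx zx zy]] := skew_eqs a b.
have [wx wy] := skew_product_commutation yx zx zy.
apply: (@quotient_coacts k q B H M).
- exact: skew_cocommutative.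
- exact: (sparse_qrel ml nl ME q0 yx wx wy par).
- exact: (sparse_mcoalg mn ml nl ME gx gy pz).
move=> V V1 VL VM VS Vij; apply: (skew_generated V1 VL VM VS).
- exact: (eq_ind _ V (Vij m m) _ Mm).
- exact: (eq_ind _ V (Vij l l) _ Ml).
- exact: (eq_ind _ V (Vij m n) _ Mw).
Qed.

End SkewQuotient.

Section DiagonalMatrix.
Variables (k : closedFieldType) (q : k) (H : hopfAlgType k) (h : 'M[H]_3).
Variable e : 'I_3 -> H.
Hypothesis hE : forall i j, h i j = if i == j then e i else 0.

Lemma diagonal_qrel : (forall i j, e i * e j = e j * e i) -> qrel q h.
Proof.
move=> eC; split=> [a i j|a b i j].
  rewrite !hE; elim/ord3P: a; elim/ord3P: i; elim/ord3P: j => //= _;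
  by rewrite ?(mulr0, mul0r, scaler0).
rewrite !hE; elim/ord3P: a; elim/ord3P: b => //= _; elim/ord3P: i; elim/ord3P: j => //= _;
  by rewrite ?(mulr0, mul0r, scaler0, addr0, add0r) // eC.
Qed.

Lemma diagonal_mcoalg : (forall i, grouplike (e i)) -> mcoalg h.
Proof.
move=> eg i j; rewrite (bigD1 i) //= !hE eqxx big1 ?addr0 => [|p pi]; last first.
  by rewrite hE eq_sym (negbTE pi) tens0l.
have [_|_] := eqVneq i j; first exact: eg.
by rewrite tens0r !linear0.
Qed.

End DiagonalMatrix.

Section Z3Quotient.
Variables (k : closedFieldType) (q : k).

Definition Z3_gen (i : 'I_3) : Z3 := (delta_mx 0 i : 'rV[int]_3).

Lemma Z3_commute (u v : Z3) : (u * v)%g = (v * u)%g.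
Proof. exact: (addrC (u : 'rV[int]_3) v). Qed.

Lemma Z3_ind (P : Z3 -> Prop) : P 1%g -> (forall i, P (Z3_gen i)) ->
  (forall u v, P u -> P v -> P (u * v)%g) -> (forall u, P u -> P u^-1%g) ->
  forall u, P u.
Proof.
move=> P1 Pg PM PV u; pose P' (v : 'rV[int]_3) := P (v : Z3).
have P'D v w : P' v -> P' w -> P' (v + w) by exact: PM.
have P'N v : P' v -> P' (- v) by exact: PV.
have P'0 : P' 0 by exact: P1.
have Pn i (c : nat) : P' (c%:Z *: delta_mx 0 i).
  elim: c => [|c IHc]; first by rewrite scale0r.
  by rewrite intS scalerDl scale1r; apply: P'D => //; apply: Pg.
have Pz i (c : int) : P' (c *: delta_mx 0 i).
  by case: c => c; rewrite ?NegzE ?scaleNr //; apply: P'N.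
rewrite -/(P' u) [u : 'rV[int]_3]row_sum_delta.
by elim/big_rec: _ => // i v _ Pv; apply: P'D.
Qed.

Lemma Z3_quotient_coacts (H : hopfAlgType k) :
  is_hopf_quotient (group_algebra k Z3) H -> coacts q H.
Proof.
pose e i : group_algebra k Z3 := group_elt k (Z3_gen i).
pose M : 'M[group_algebra k Z3]_3 := \matrix_(i, j) if i == j then e i else 0.
have ME i j : M i j = if i == j then e i else 0 by rewrite mxE.
have eC i j : e i * e j = e j * e i.
  apply: etrans (esym (group_eltM k _ _)) (etrans _ (group_eltM k _ _)).
  exact: congr1 (Z3_commute _ _).
have eg i : grouplike (e i) by exact: group_elt_grouplike.
apply: (@quotient_coacts k q _ H M).
- exact: group_cocommutative.
- exact: (diagonal_qrel q ME eC).
- exact: (diagonal_mcoalg ME eg).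
move=> V V1 VL VM VS Vij; have V0 : V 0.
  by have := VL (-1) _ _ V1 V1; rewrite scaleN1r addNr.
apply: group_ind; last exact: VL.
move=> u; elim/Z3_ind: u => [|i|u v Vu Vv|u Vu].
- exact: V1.
- by have := Vij i i; rewrite ME eqxx.
- by rewrite group_eltM; apply: VM.
- by have := VS _ Vu; congr V; apply: mlift_basis.
Qed.

End Z3Quotient.

(** * Every coacting Hopf algebra is a listed quotient *)

Section GrouplikePowers.
Variables (k : fieldType) (H : hopfAlgType k).
Implicit Types g c : H.

Definition zpow g (n : int) : H :=
  match n with Posz m => g ^+ m | Negz m => antipode g ^+ m.+1 end.

Lemma zpowS g n : grouplike g -> zpow g (n + 1) = zpow g n * g.
Proof.
move=> /grouplikeV [_ Vg]; case: n => [m|[|m]].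
- by rewrite -PoszD addn1 /= exprSr.
- by rewrite [LHS]/= /zpow expr1 Vg.
- have -> : Negz m.+1 + 1 = Negz m by rewrite !NegzE -[m.+2]addn1 PoszD opprD addrNK.
  by rewrite /zpow [in RHS]exprSr -mulrA Vg mulr1.
Qed.

Lemma zpowD g m n : grouplike g -> zpow g (m + n) = zpow g m * zpow g n.
Proof.
move=> gg; have [gV _] := grouplikeV gg.
have pred l : zpow g (l - 1) = zpow g l * antipode g.
  by rewrite -{2}[l](subrK 1) zpowS // -mulrA gV mulr1.
elim/int_ind: n => [|n IHn|n IHn]; first by rewrite addr0 mulr1.
  by rewrite intS addrCA addrC zpowS // IHn -mulrA -zpowS // addrC.
by rewrite intS opprD addrCA addrC pred IHn -mulrA -pred addrC.
Qed.

Lemma zpow_grouplike g n : grouplike g -> grouplike (zpow g n).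
Proof.
have X c m : grouplike c -> grouplike (c ^+ m).
  move=> gc; elim: m => [|m IHm]; first exact: grouplike1.
  by rewrite exprS; apply: grouplikeM.
by move=> gg; case: n => m; apply: X => //; apply: grouplike_antipode.
Qed.

Lemma antipode_comm g c : grouplike g -> g * c = c * g ->
  antipode g * c = c * antipode g.
Proof.
move=> gg gc; have [gV Vg] := grouplikeV gg.
by rewrite -[LHS]mulr1 -gV mulrA -[antipode g * c * g]mulrA -gc mulrA Vg mul1r.
Qed.

Lemma zpow_comm g c n : grouplike g -> g * c = c * g -> zpow g n * c = c * zpow g n.
Proof.
move=> gg gc; have X u m : u * c = c * u -> u ^+ m * c = c * u ^+ m.
  by move=> uc; apply/esym/commrX.
by case: n => m; apply: X => //; apply: antipode_comm.
Qed.

End GrouplikePowers.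

(** A further term [h i p ⊗ h p i] in the coproduct of [h i i] would need nonzero entries at two
    opposite positions, and only one off-diagonal entry is available. *)
Lemma sparse_grouplike (k : fieldType) (H : hopfAlgType k) (h : 'M[H]_3) :
  mcoalg h -> forall m n : 'I_3, m != n ->
  (forall p r, p != r -> (p, r) != (m, n) -> h p r = 0) -> forall i, grouplike (h i i).
Proof.
move=> hc m n mn z i; have [d e] := hc i i; split; last by rewrite e eqxx.
rewrite d (bigD1 i) //= big1 ?addr0 // => p pi.
have [[im pn]|ne] := eqVneq (i, p) (m, n); last by rewrite z ?tens0l // eq_sym.
by rewrite im pn [h n m]z ?tens0r 1?eq_sym // xpair_eqE (negbTE mn).
Qed.

Lemma diagonal_comm (k : closedFieldType) (q : k) (H : hopfAlgType k) (h : 'M[H]_3) :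
  q != 0 -> qrel q h -> (forall p r, p != r -> h p r = 0) ->
  forall i j, h i i * h j j = h j j * h i i.
Proof.
move=> q0 [_ r2] z; have lt (i j : 'I_3) : (i < j)%N -> h i i * h j j = h j j * h i i.
  move=> ij; have := r2 i j i j ij ij; have ne : i != j by rewrite neq_ltn ij.
  rewrite (z i j ne) mul0r mulr0 scaler0 addr0 add0r.
  by move/(scalerI q0).
by move=> i j; have [/lt|/lt/esym|/val_inj ->] := ltngtP i j.
Qed.

Section Classification.
Variables (k : closedFieldType) (q : k) (H : hopfAlgType k).
Local Notation A := (quantum_affine q 3).
Local Notation x := (@qvar k q 3).
Variable rho : {lrmorphism A -> (A ⊗ H)%type}.
Variable h : 'M[H]_3.
Hypothesis rhoE : forall j, rho (x j) = \sum_i x i ⊗ h i j.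
Hypothesis faithful : inner_faithful rho.

(** The image of [f] is a Hopf subalgebra, and it receives the coaction as soon as it contains the
    entries of [h]; inner-faithfulness makes it everything. *)
Lemma inner_faithful_surjective (B : hopfAlgType k) (f : {lrmorphism B -> H}) :
  is_hopf_morphism f -> (forall i j, exists b, f b = h i j) -> is_hopf_quotient B H.
Proof.
move=> fh fij; exists f; split=> //; apply: faithful; first exact: hopf_image.
apply: quantum_affine_ind => [|i|a b|c a b].
- by rewrite rmorph1 -tens1; apply: subtensor_tens => //; exists 1; rewrite rmorph1.
- by rewrite rhoE; apply: subtensor_sum => l; apply: subtensor_tens.
- move=> ra rb; rewrite (rmorphM rho a b); apply: subtensor_mul ra rb => //.
  by move=> _ _ [u <-] [v <-]; exists (u * v); rewrite rmorphM.
- move=> ra rb; rewrite (linearP rho c a b); apply: subtensor_add rb.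
  exact: subtensor_scale.
Qed.

Lemma diagonal_quotient : q != 0 -> qrel q h -> mcoalg h ->
  (forall p r, p != r -> h p r = 0) -> is_hopf_quotient (group_algebra k Z3) H.
Proof.
move=> q0 hq hc z; have hd : forall i, grouplike (h i i).
  by apply: (@sparse_grouplike _ _ _ hc o0 o1) => // p r pr _; apply: z.
have hC := diagonal_comm q0 hq z.
pose f (v : Z3) : H := let w := (v : 'rV[int]_3) in
  zpow (h o0 o0) (w 0 o0) * zpow (h o1 o1) (w 0 o1) * zpow (h o2 o2) (w 0 o2).
have zC i j m n : zpow (h i i) m * zpow (h j j) n = zpow (h j j) n * zpow (h i i) m.
  by apply: zpow_comm => //; apply/esym/zpow_comm.
have [|u v|v|F [Fh FE]] := @group_hopf_lift k Z3 H f.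
- by rewrite /f !mxE /= !mulr1.
- rewrite /f /= !mxE !zpowD //.
  have CA (r s t : H) : r * s = s * r -> r * (s * t) = s * (r * t).
    by move=> rs; rewrite !mulrA rs.
  rewrite -!mulrA; congr (_ * _).
  rewrite (CA _ _ _ (zC o2 o0 _ _)) (CA _ _ _ (zC o2 o1 _ _)).
  by rewrite (CA _ _ _ (zC o1 o0 _ _)).
- by rewrite /f; do !apply: grouplikeM; apply: zpow_grouplike.
apply: (inner_faithful_surjective Fh) => i j; have [<-|ij] := eqVneq i j; last first.
  by exists 0; rewrite linear0 z.
exists (group_elt k (Z3_gen i)); rewrite FE /f !mxE.
by elim/ord3P: i; rewrite /= ?mulr1 ?mul1r.
Qed.

Section Sparse.
Variables m n l : 'I_3.
Hypotheses (q0 : q != 0) (hq : qrel q h) (hc : mcoalg h).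
Hypotheses (mn : m != n) (lm : l != m) (ln : l != n).
Hypotheses (z : forall p r, p != r -> (p, r) != (m, n) -> h p r = 0).
Hypotheses (xx : h m m = h n n) (pw : gprimitive (h m m) (h m n)).

(** The primitive generator is sent to the antipode of [h m m] times [h m n]. It obeys the same
    commutation rules as [h m n], because [h m m] commutes with [h l l]. *)
Lemma sparse_quotient al be : h m n * h m m = al *: (h m m * h m n) ->
  h m n * h l l = be *: (h l l * h m n) -> is_hopf_quotient (skew_algebra al be) H.
Proof.
set x' := h m m; set y := h l l; set w := h m n => wx wy.
have gd := sparse_grouplike hc mn z.
have gx : grouplike x' by exact: gd.
have gy : grouplike y by exact: gd.
have [xV Vx] := grouplikeV gx.
have [r1 r2] := hq.
have yx : y * x' = x' * y.
  have C (i j : 'I_3) : (i < j)%N -> (i, j) != (m, n) -> h i i * h j j = h j j * h i i.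
    move=> ij ne; have := r2 i j i j ij ij.
    rewrite (z _ ne); last by rewrite neq_ltn ij.
    rewrite mul0r mulr0 scaler0 addr0 add0r.
    by move/(scalerI q0).
  have [ml|ml|/val_inj ml] := ltngtP m l; last by move: lm; rewrite ml eqxx.
    by apply/esym/(C m l ml); rewrite xpair_eqE (negbTE ln) andbF.
  by apply/(C l m ml); rewrite xpair_eqE (negbTE lm).
have x'y := antipode_comm gx (esym yx).
have dz := gprimitive_primitive gx pw.
have zx : antipode x' * w * x' = al *: (x' * (antipode x' * w)).
  by rewrite -mulrA wx -scalerAr !mulrA Vx xV.
have zy : antipode x' * w * y = be *: (y * (antipode x' * w)).
  by rewrite -mulrA wy -scalerAr !mulrA x'y.
have [f [fh fX fY fZ]] := skew_hopf_lift gx gy dz yx zx zy.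
apply: (inner_faithful_surjective fh) => i j.
have hm : exists b, f b = x' by exists (skew_elt al be GenX).
have [<-|ij] := eqVneq i j.
  have [->|im] := eqVneq i m; first exact: hm.
  have [->|i_n] := eqVneq i n; first by rewrite -xx.
  have -> : i = l.
    by move: mn lm ln im i_n; elim/ord3P: m; elim/ord3P: n; elim/ord3P: l; elim/ord3P: i.
  by exists (skew_elt al be GenY).
have [[-> ->]|ne] := eqVneq (i, j) (m, n).
  exists (skew_elt al be GenX * skew_elt al be GenZ).
  by apply: etrans (rmorphM f _ _) _; rewrite /= fX fZ mulrA xV mul1r.
by exists 0; rewrite linear0 z.
Qed.

End Sparse.

Lemma coaction_classification : [pchar k] =i pred0 -> q != 0 -> q != 1 -> q != -1 ->
  cocommutative H -> qrel q h -> mcoalg h ->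
  is_hopf_quotient (group_algebra k Z3) H \/ is_hopf_quotient (B_alg q) H \/
  is_hopf_quotient (B_alg q^-1) H \/ is_hopf_quotient (C_alg q) H \/
  is_hopf_quotient (C_alg q^-1) H.
Proof.
move=> char0 q0 q1 qN1 coc hq hc.
have [z|[m [n [mn z xx pw]]]] := qmatrix_classification char0 q0 q1 qN1 coc hq hc.
  by left; apply: diagonal_quotient.
right; have S l al be (lm : l != m) (ln : l != n) :=
  sparse_quotient q0 hq hc mn lm ln z xx pw (al := al) (be := be).
have [r1 r2] := hq.
have Vq (u v : H) : u = q *: v -> v = q^-1 *: u.
  by move=> ->; rewrite scalerA mulVf // scale1r.
have up : (m < n)%N -> h m n * h m m = q *: (h m m * h m n) by exact: r1.
have down : (n < m)%N -> h m n * h m m = q^-1 *: (h m m * h m n).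
  by move=> nm; apply: Vq; apply: r1.
(* The relation within row m gives the scalar [al]; the relation on rows m, l and columns n, l gives
   [be], which differs from the B-type value 1 exactly when l lies between m and n. *)
elim/ord3P: m mn z xx pw S up down; elim/ord3P: n => // mn z xx pw S up down.
- left; apply: (S o2 q 1) => //; first exact: up.
  rewrite scale1r; apply/(scalerI q0); have := r2 o0 o2 o1 o2 isT isT.
  by rewrite [h o0 o2]z // [h o2 o1]z // !(mul0r, mulr0, scaler0, addr0, add0r).
- do 2!right; left; apply: (S o1 q (q ^+ 2)) => //; first exact: up.
  have := r2 o0 o1 o1 o2 isT isT.
  by rewrite [h o0 o1]z // [h o1 o2]z // !(mul0r, mulr0, scaler0, addr0, add0r).
- right; left; apply: (S o2 q^-1 1) => //; first exact: down.
  rewrite scale1r; apply/(scalerI q0); have := r2 o1 o2 o0 o2 isT isT.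
  by rewrite [h o1 o2]z // [h o2 o0]z // !(mul0r, mulr0, scaler0, addr0, add0r).
- left; apply: (S o0 q 1) => //; first exact: up.
  rewrite scale1r; apply/(scalerI q0); have := r2 o0 o1 o0 o2 isT isT.
  by rewrite [h o0 o2]z // [h o1 o0]z // !(mul0r, mulr0, scaler0, addr0, add0r).
- do 3!right; apply: (S o1 q^-1 (q^-1 ^+ 2)) => //; first exact: down.
  have := r2 o1 o2 o0 o1 isT isT.
  rewrite [h o1 o0]z // [h o2 o1]z // !(mul0r, mulr0, scaler0, addr0, add0r) => ->.
  by rewrite scalerA -exprMn mulVf // expr1n scale1r.
- right; left; apply: (S o0 q^-1 1) => //; first exact: down.
  rewrite scale1r; apply/(scalerI q0); have := r2 o0 o2 o0 o1 isT isT.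
  by rewrite [h o0 o1]z // [h o2 o0]z // !(mul0r, mulr0, scaler0, addr0, add0r).
Qed.

End Classification.

(** * Group algebras and gradings *)

Section GroupAlgebraElements.
Variables (k : fieldType) (G : groupType).
Local Notation B := (group_algebra k G).

Definition group_coef (g : G) : {linear B -> k^o} :=
  mlift (fun h : G => (h == g)%:R : k^o).

Lemma group_coefE g h : group_coef g (group_elt k h) = (h == g)%:R.
Proof. exact: (@mlift_basis k G k^o (fun h : G => (h == g)%:R) h). Qed.

Lemma group_elt_inj : injective (@group_elt k G).
Proof.
move=> g h e; have := group_coefE g g; rewrite e group_coefE eqxx.
by have [//|_ /esym/eqP] := eqVneq h g; rewrite oner_eq0.
Qed.

(** Contracting the coproduct with the coefficient at the identity always leaves a multiple of 1,
    namely by that coefficient; on a primitive element it leaves the same multiple of 1 plus [z]. *)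
Lemma group_primitive_eq0 (z : B) : comul z = z ⊗ 1 + 1 ⊗ z -> z = 0.
Proof.
move=> d; have E : contractl (group_coef 1%g) (comul z) = (group_coef 1%g z : k) *: 1.
  elim/group_ind: z {d} => [g|c u v eu ev].
    rewrite group_comul_elt contractl_tens group_coefE.
    by have [->|_] := eqVneq g 1%g; rewrite ?scale1r ?scale0r.
  have -> : comul (c *: u + v) = c *: comul u + comul v by exact: linearP.
  have -> : group_coef 1%g (c *: u + v) = c * group_coef 1%g u + group_coef 1%g v :> k.
    exact: linearP.
  have -> : contractl (group_coef 1%g) (c *: comul u + comul v) =
      c *: contractl (group_coef 1%g) (comul u) + contractl (group_coef 1%g) (comul v).
    exact: linearP.
  by rewrite scalerDl -scalerA eu ev.
have e1 : group_coef 1%g 1 = 1.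
  by apply: etrans (group_coefE 1%g 1%g) _; rewrite eqxx.
have L : contractl (group_coef 1%g) (z ⊗ 1 + 1 ⊗ z) =
    contractl (group_coef 1%g) (z ⊗ 1) + contractl (group_coef 1%g) (1 ⊗ z).
  exact: linearD.
rewrite -d E !contractl_tens e1 scale1r in L.
by move: L; rewrite -[X in X = _ -> _]addr0 => /addrI.
Qed.

Lemma group_gprimitive_eq0 (g w : B) : grouplike g -> gprimitive g w -> w = 0.
Proof.
move=> gg pw; have [gV _] := grouplikeV gg.
have z := group_primitive_eq0 (gprimitive_primitive gg pw).
by rewrite -[w]mul1r -gV -mulrA z mulr0.
Qed.

End GroupAlgebraElements.

Lemma mulr_lin (k : fieldType) (A : algType k) (c : k) (a b b' : A) :
  a * (c *: b + b') = c *: (a * b) + a * b'.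
Proof. by rewrite mulrDr -scalerAr. Qed.

Lemma lin_mulr (k : fieldType) (A : algType k) (c : k) (a a' b : A) :
  (c *: a + a') * b = c *: (a * b) + a' * b.
Proof. by rewrite mulrDl -scalerAl. Qed.

Lemma commr_inverse (R : nzRingType) (u g g' : R) :
  g * g' = 1 -> g' * g = 1 -> u * g = g * u -> u * g' = g' * u.
Proof.
by move=> gg' g'g ug; rewrite -[LHS]mul1r -g'g -mulrA [g * _]mulrA -ug -[u * g * g']mulrA
  gg' mulr1.
Qed.

Lemma tens_comm (k : fieldType) (A B : algType k) (a : A) (g u : B) : a != 0 ->
  (a ⊗ g) * (1 ⊗ u) = (1 ⊗ u) * (a ⊗ g) -> u * g = g * u.
Proof.
move=> a0; have [f fa] := functional_eq1 a0; move/(congr1 (contractl f)).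
by rewrite !tensM mul1r mulr1 !contractl_tens fa !scale1r.
Qed.

Section Grading.
Variables (k : closedFieldType) (q : k) (G : groupType).
Local Notation A := (quantum_affine q 3).
Local Notation x := (@qvar k q 3).
Local Notation B := (group_algebra k G).
Variable Ag : G -> A -> Prop.
Hypothesis gr : is_grading Ag.

Lemma homogeneous_ind (P : A -> Prop) : (forall g a, Ag g a -> P a) ->
  (forall c a b, P a -> P b -> P (c *: a + b)) -> forall a, P a.
Proof.
have [g0 _ gs _ _] := gr; move=> Ph PL a; have [s [c [cP ->]]] := gs a.
have P0 : P 0 by apply: (Ph 1%g).
elim: s => [|g s IHs]; first by rewrite big_nil.
by rewrite big_cons -[c g]scale1r; apply: PL => //; apply: Ph.
Qed.

Variable rho : {linear A -> (A ⊗ B)%type}.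
Hypothesis rhoE : is_grading_coaction Ag rho.

Lemma grading_rhoM : {morph rho : a b / a * b}.
Proof.
have [_ _ _ _ gM] := gr; move=> a b.
elim/homogeneous_ind: a => [g a ga|c a a' ea ea'].
  elim/homogeneous_ind: b => [g' b gb|c b b' eb eb'].
    rewrite (rhoE (gM _ _ _ _ ga gb)) (rhoE ga) (rhoE gb) group_eltM.
    by rewrite tensM.
  have e1 : rho (a * (c *: b + b')) = c *: rho (a * b) + rho (a * b').
    exact: etrans (congr1 rho (mulr_lin _ _ _ _)) (linearP rho _ _ _).
  have e2 : rho (c *: b + b') = c *: rho b + rho b' by exact: linearP.
  apply: etrans e1 (etrans (congr2 (fun s t => c *: s + t) eb eb') _).
  exact: etrans (esym (mulr_lin _ _ _ _)) (congr1 ( *%R (rho a)) (esym e2)).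
have e1 : rho ((c *: a + a') * b) = c *: rho (a * b) + rho (a' * b).
  exact: etrans (congr1 rho (lin_mulr _ _ _ _)) (linearP rho _ _ _).
have e2 : rho (c *: a + a') = c *: rho a + rho a' by exact: linearP.
apply: etrans e1 (etrans (congr2 (fun s t => c *: s + t) ea ea') _).
exact: etrans (esym (lin_mulr _ _ _ _)) (congr1 ( *%R^~ (rho b)) (esym e2)).
Qed.

(** Homogeneity of 1 is not among the axioms, so unitality is drawn from multiplicativity: [rho 1]
    fixes every [rho a], hence also [a ⊗ 1] for homogeneous [a], on multiplying by the inverse of
    the degree. *)
Lemma grading_rho1 : rho 1 = 1.
Proof.
suff e a : rho 1 * (a ⊗ 1) = a ⊗ 1 by rewrite -[LHS]mulr1 -tens1 e.
elim/homogeneous_ind: a => [g a ga|c a b ea eb].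
  have e : a ⊗ 1 = rho a * (1 ⊗ group_elt k g^-1%g).
    by rewrite (rhoE ga) tensM mulr1 -group_eltM mulgV.
  by rewrite e mulrA -grading_rhoM mul1r.
by rewrite tensZDl mulrDr -scalerAr ea eb.
Qed.

(** By multiplicativity [1 ⊗ u] commutes with the whole image of [rho], so [u] commutes with the
    degree of every nonzero homogeneous element, and faithfulness says that these degrees generate
    [G]. *)
Lemma grading_central (u : B) : (forall i, exists2 d, rho (x i) = x i ⊗ d & u * d = d * u) ->
  is_faithful_grading Ag -> forall g, u * group_elt k g = group_elt k g * u.
Proof.
move=> ud fg.
have comm a : rho a * (1 ⊗ u) = (1 ⊗ u) * rho a.
  elim/quantum_affine_ind: a => [|i|a b ea eb|c a b ea eb].
  - by rewrite grading_rho1 mul1r mulr1.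
  - have [d de e] := ud i; rewrite de; apply: etrans (tensM _ _ _ _) _.
    apply: etrans (esym (tensM _ _ _ _)).
    have e1 : x i * 1 = 1 * x i := etrans (mulr1 (x i)) (esym (mul1r (x i))).
    exact: (congr2 (fun (s : A) (t : B) => s ⊗ t) e1 (esym e)).
  - by rewrite grading_rhoM -mulrA eb !mulrA ea.
  - have -> : rho (c *: a + b) = c *: rho a + rho b by exact: linearP.
    by rewrite mulr_lin lin_mulr ea eb.
apply: fg => [|g h eg eh|g eg|g [a ga a0]].
- have -> : group_elt k (1%g : G) = 1 by [].
  exact: commr1.
- have -> := group_eltM k g h.
  exact: commrM.
- apply: commr_inverse eg.
    exact: etrans (esym (group_eltM k _ _)) (congr1 _ (mulgV g)).
  exact: etrans (esym (group_eltM k _ _)) (congr1 _ (mulVg g)).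
apply: (tens_comm a0); rewrite -(rhoE ga).
exact: comm.
Qed.

End Grading.

Lemma no_nonabelian_grading (k : closedFieldType) (q : k) (G : groupType)
    (Ag : G -> quantum_affine q 3 -> Prop) :
  [pchar k] =i pred0 -> q != 0 -> q != 1 -> q != -1 ->
  is_grading Ag -> refines_degree Ag -> is_faithful_grading Ag ->
  forall g h : G, (g * h)%g = (h * g)%g.
Proof.
move=> char0 q0 q1 qN1 gr [rho [rhoE deg]] fg.
pose M := GRing.isMonoidMorphism.Build _ _ rho
  (conj (grading_rho1 gr rhoE) (grading_rhoM gr rhoE)).
pose R : {lrmorphism quantum_affine q 3 ->
    (quantum_affine q 3 ⊗ group_algebra k G)%type} := HB.pack (rho : _ -> _) M rho.
have Rdeg : preserves_degree R by exact: deg.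
have Rc : is_coaction R.
  have idA : linear (idfun : quantum_affine q 3 -> _) by [].
  have idB : linear (idfun : group_algebra k G -> _) by [].
  have rl : linear rho by exact: linearP.
  have cl : linear (comul : group_algebra k G -> _) by exact: linearP.
  split; apply: (homogeneous_ind gr) => [g a ga|c a b ea eb].
  - rewrite -[R a]/(rho a) -[R : _ -> _]/(rho : _ -> _) (rhoE g a ga).
    by rewrite !tmap_tens // (rhoE g a ga) tassoc_tens group_comul_elt.
  - have -> : R (c *: a + b) = c *: R a + R b by exact: linearP.
    by rewrite (tmap_linear rl idB) (@tassoc_linear _ _ _ _) (tmap_linear idA cl) ea eb.
  - rewrite -[R a]/(rho a) (rhoE g a ga) tlift_tens; last exact: contractr_bilinear.
    by rewrite group_counit_elt scale1r.
  - have -> : R (c *: a + b) = c *: R a + R b by exact: linearP.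
    by rewrite (tlift_is_linear (contractr_bilinear _ _)) ea eb.
have [h hE] := coaction_matrix Rdeg.
have hq := coaction_qrel hE; have hc := coaction_mcoalg hE Rc.
have z p r : p != r -> h p r = 0.
  case: (qmatrix_classification char0 q0 q1 qN1 (@group_cocommutative k G) hq hc).
    exact.
  move=> [m [n [mn z _ pw]]] pr.
  have [[-> ->]|ne] := eqVneq (p, r) (m, n); last exact: z.
  exact: group_gprimitive_eq0 (sparse_grouplike hc mn z m) pw.
have rx j : rho (qvar q j) = qvar q j ⊗ h j j.
  apply: etrans (hE j) _; rewrite (bigD1 j) //= big1 ?addr0 // => i ij.
  by rewrite z // tens0r.
have dC j g : h j j * group_elt k g = group_elt k g * h j j.
  apply: (grading_central gr rhoE) => // i; exists (h i i); first exact: rx.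
  exact: (diagonal_comm q0 hq z).
move=> g g'; apply: (@group_elt_inj k G).
apply: etrans (group_eltM k g g') (etrans _ (esym (group_eltM k g' g))).
apply: (grading_central gr rhoE) => // i; exists (h i i); first exact: rx.
exact/esym/dC.
Qed.

Theorem theorem1p3 (k : closedFieldType) (q : k)
    (char0 : [pchar k] =i pred0) (q_neq0 : q != 0) (q_neq1 : q != 1)
    (q_neqN1 : q != -1) :
  (forall H : hopfAlgType k,
     (cocommutative H /\
      exists rho : {lrmorphism quantum_affine q 3 ->
                               (quantum_affine q 3 ⊗ H)%type},
        [/\ is_coaction rho, preserves_degree rho & inner_faithful rho])
     <->
     (is_hopf_quotient (group_algebra k Z3) H \/
      is_hopf_quotient (B_alg q) H \/
      is_hopf_quotient (B_alg q^-1) H \/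
      is_hopf_quotient (C_alg q) H \/
      is_hopf_quotient (C_alg q^-1) H)) /\
  (forall G : groupType, ~ (forall g h : G, (g * h)%g = (h * g)%g) ->
     ~ exists Ag : G -> quantum_affine q 3 -> Prop,
         [/\ is_grading Ag, refines_degree Ag & is_faithful_grading Ag]).
Proof.
split=> [H|G nab [Ag [gr deg fg]]]; last first.
  exact: nab (no_nonabelian_grading char0 q_neq0 q_neq1 q_neqN1 gr deg fg).
split=> [[coc [rho [rc rd rf]]]|].
  have [h hE] := coaction_matrix rd.
  exact: coaction_classification hE rf char0 q_neq0 q_neq1 q_neqN1 coc
    (coaction_qrel hE) (coaction_mcoalg hE rc).
case=> [|[|[|[|]]]].
- exact: Z3_quotient_coacts.
- by apply: (@skew_quotient_coacts k q q 1 o0 o1 o2) => //; apply: Or41.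
- by apply: (@skew_quotient_coacts k q q^-1 1 o1 o0 o2) => //; apply: Or42.
- by apply: (@skew_quotient_coacts k q q (q ^+ 2) o0 o2 o1) => //; apply: Or43.
- by apply: (@skew_quotient_coacts k q q^-1 (q^-1 ^+ 2) o2 o0 o1) => //; apply: Or44.
Qed.
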